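(* Let $n\ge 1$ be an integer and $0<\alpha\leqslant 1$. A function $\Pi\colon\mathbb R^n_+\times(0,\infty)\to[0,\infty)$ can be represented in the form $$\Pi(p,p_0)=\Pi_\alpha[\mu](p,p_0),$$ where $\mu$ is a nonnegative Borel measure with support in $\mathbb R^n_+$ and such that $\mu(\{0\})=0$, if and only if the following four conditions hold: 1. $\Pi(p,p_0)$ is convex; 2. $\Pi(\lambda p,\lambda p_0)=\lambda\,\Pi(p,p_0)$ for any $\lambda>0$; 3. $\Pi(p,+0)=\frac{\partial\Pi}{\partial p_0}(p,+0)=0$ for $p\in\operatorname{int}\mathbb R^n_+$; 4. the function $$F(p)=\int_0^\infty e^{-\tau^\alpha}\,d\,\frac{\partial\Pi}{\partial\tau}\bigl(p_1^{1/\alpha},\ldots,p_n^{1/\alpha};\tau\bigr)$$ is bounded in $\mathbb R^n_+$ and completely monotone in $\operatorname{int}\mathbb R^n_+$.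
   Context: $\mathbb R^n_+=\{x\in\mathbb R^n: x_1\ge 0,\ldots,x_n\ge 0\}$ is the positive orthant. For $p,x\in\mathbb R^n_+$ put $p\odot_\alpha x=\bigl((p_1x_1)^\alpha+\ldots+(p_nx_n)^\alpha\bigr)^{1/\alpha}$, and $a_+=\max(0,a)$ for real $a$. For a Borel measure $\mu$ supported in $\mathbb R^n_+$, $$\Pi_\alpha[\mu](p,p_0)=\int_{\mathbb R^n_+}(p_0-p\odot_\alpha x)_+\,\mu(dx).$$ The notation $g(p,+0)$ means $\lim_{p_0\to+0}g(p,p_0)$. The integral defining $F$ is a Stieltjes integral in $\tau$ over $(0,\infty)$ with respect to the function $\tau\mapsto\frac{\partial\Pi}{\partial\tau}(p_1^{1/\alpha},\ldots,p_n^{1/\alpha};\tau)$ (nondecreasing when $\Pi$ is convex); equivalently, it is the integral of $e^{-\tau^\alpha}$ against the second distributional derivative of $\Pi$ in its last argument. A function $F\in C^\infty(\operatorname{int}\mathbb R^n_+,\mathbb R)$ is completely monotone if $(-1)^{|\beta|}\,\partial^{\beta}F(p)\geqslant 0$ for every multi-index $\beta\in\mathbb Z^n_+$ and every $p\in\operatorname{int}\mathbb R^n_+$.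
   Formalization: Condition 1 is read as ''Π is convex and continuous on R^n_+ × (0,∞)''; with convexity alone the ''if'' part fails (n=1, α=1, Π(p,p_0)=0 for p>0, Π(0,p_0)=p_0). ∂Π/∂p_0 is taken as the right derivative. *)

(* Defs.v *)
From HB Require Import structures.
From mathcomp Require Import all_boot all_order all_algebra.
From mathcomp Require Import all_classical all_reals all_analysis.

Set Implicit Arguments.
Unset Strict Implicit.
Unset Printing Implicit Defensive.

Import Order.TTheory GRing.Theory Num.Theory.
Import numFieldNormedType.Exports.

Local Open Scope classical_set_scope.
Local Open Scope ring_scope.

Definition orthant (R : realType) (n : nat) : set 'rV[R]_n :=
  [set x | forall i, 0 <= x ord0 i].
Arguments orthant {R} n _.

(* R^n with its Borel sigma-algebra; the carrier is convertible to 'rV[R]_n. *)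
Definition borel_rV (R : realType) (n : nat) :=
  g_sigma_algebraType (@open 'rV[R]_n).

Definition supported_in d (T : measurableType d) (R : realType)
    (mu : {measure set T -> \bar R}) (A : set T) : Prop :=
  mu (~` A) = 0%E.

Definition odot (R : realType) (n : nat) (alpha : R) (p x : 'rV[R]_n) : R :=
  (\sum_(i < n) (p ord0 i * x ord0 i) `^ alpha) `^ alpha^-1.

(* The value may be +oo; equating it with a real number includes finiteness. *)
Definition profit (R : realType) (n : nat) (alpha : R)
    (mu : {measure set (borel_rV R n) -> \bar R}) (p : 'rV[R]_n) (p0 : R) :
    \bar R :=
  \int[mu]_(x in (orthant n : set (borel_rV R n)))
    (Num.max 0 (p0 - odot alpha p x))%:E.

(* A convex function on this domain can jump upwards at the faces p_i = 0: with
   n = 1, the function equal to 0 for p > 0 and to p0 for p = 0 is convex. Hence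
   continuity on the domain is not implied by convexity. *)
Definition price_domain (R : realType) (n : nat) : set ('rV[R]_n * R) :=
  orthant n `*` `]0, +oo[.
Arguments price_domain {R} n _.

(* For f convex on (0, +oo) this right derivative exists at every t > 0,
   coincides with the derivative outside a countable set, and is the
   right-continuous nondecreasing version of it. *)
Definition rderive (R : realType) (f : R -> R) (t : R) : R :=
  lim ((fun h : R => h^-1 * (f (t + h) - f t)) @ 0^'+).

(* I is the Stieltjes integral over the open half-line (0, +oo) of phi with
   respect to g. Only the values of g on (0, +oo) matter: G is an arbitrary
   extension of g to a nondecreasing right-continuous function on R, and the
   Stieltjes measures of two such extensions agree on (0, +oo), a possible atom
   at 0 being left out of the domain of integration. *)
Definition is_stieltjes_integral (R : realType) (g phi : R -> R) (I : R) :
    Prop :=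
  exists G : cumulative R R,
    (forall t, 0 < t -> G t = g t) /\
    (\int[lebesgue_stieltjes_measure G]_(t in `]0%R, +oo[) (phi t)%:E
       = I%:E)%E.

Definition powR_rV (R : realType) (n : nat) (r : R) (p : 'rV[R]_n) :
    'rV[R]_n :=
  \row_(i < n) (p ord0 i `^ r).

Definition partial (R : realType) (n : nat) (i : 'I_n) (f : 'rV[R]_n -> R) :
    'rV[R]_n -> R :=
  'D_(delta_mx ord0 i) f.

(* All iterated partial derivatives, in any order, exist and are continuous at
   the points of U; meant for U open. *)
Definition smooth_on (R : realType) (n : nat) (U : set 'rV[R]_n)
    (f : 'rV[R]_n -> R) : Prop :=
  forall (s : seq 'I_n) (p : 'rV[R]_n), U p ->
    {for p, continuous (foldr (@partial R n) f s)} /\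
    (forall i, derivable (foldr (@partial R n) f s) p (delta_mx ord0 i)).

Definition multi_partial (R : realType) (n : nat) (beta : 'I_n -> nat)
    (f : 'rV[R]_n -> R) : 'rV[R]_n -> R :=
  foldr (fun i g => iter (beta i) (@partial R n i) g) f (enum 'I_n).

Definition completely_monotone (R : realType) (n : nat)
    (f : 'rV[R]_n -> R) : Prop :=
  smooth_on (orthant n)° f /\
  forall (beta : 'I_n -> nat) (p : 'rV[R]_n), (orthant n)° p ->
    0 <= (-1) ^+ (\sum_(i < n) beta i)%N * multi_partial beta f p.

(* Main.v *)
(* Substitute y_i = x_i^alpha: then F(p) = int e^{-<p,y>}, so for the direct implication F is a
   Laplace transform and the other properties follow from the reverse Minkowski inequality and
   dominated convergence; the derivative of Pi(p, .) is the distribution function of p (.) x.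

   Conversely, condition 4 makes F a Laplace transform of a finite measure. Complete monotonicity
   makes all iterated differences of F on a lattice of mesh h alternate in sign, and the partition
   1 = sum_i C(D,i) T^i (1 - T)^{D-i}, T a shift, writes the values of F on the lattice as moments
   of a finite positive measure on [0,1]^n up to O(1/D). An ultrafilter limit (h -> 0) gives a
   positive functional whose moments of dyadic orders are the values of F, and this functional is
   realized by integration against Lebesgue measure on an interval. Fix a dyadic p. Then F(k p),
   k >= 1, are the moments of u = e^{-tau^alpha} for d(dPi/dtau)(p^{1/alpha}, tau) (homogeneity)
   and of e^{-<p,y>} for mu. As F(k p) -> 0, mu has no atom at 0. By Bernstein approximation of
   (tau - s)_+ / u both measures give the same integral to the gain (tau - s)_+, and the convex
   function Pi(p^{1/alpha}, .) is recovered from its derivative. Continuity in (p, p_0) extends the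
   equality from dyadic p to the whole orthant. *)

Require Import Defs.
From HB Require Import structures.
From mathcomp Require Import all_boot all_order all_algebra.
From mathcomp Require Import all_classical all_reals all_analysis.
From mathcomp Require Import measurable_realfun.
From mathcomp Require Import ring lra zify.

Set Implicit Arguments.
Unset Strict Implicit.
Unset Printing Implicit Defensive.

Import Order.TTheory GRing.Theory Num.Theory.
Import numFieldNormedType.Exports.

Local Open Scope classical_set_scope.
Local Open Scope ring_scope.

(** Dyadic points are used because each of them lies on all lattices of mesh [2^-N] with [N] large,
    so that one sequence of lattices captures them all; they are also dense in the orthant and
    stable under multiplication by positive integers. Two kinds of degeneration shape the converse.
    On the side of [mu], the limit functional lives on the closed cube, where a coordinate equal to
    0 stands for [y_l = +oo]; a monomial whose exponents are all positive vanishes there, so the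
    lost mass does not affect [F] at interior points. On the side of [Pi], the second derivative
    along a ray is a measure that is only known to integrate [u]. Its total mass may a priori be
    infinite, which is why the moments start at exponent 1 and the gain is divided by [u]: the
    quotient remains bounded and continuous because the gain vanishes for [s >= tau], that is, near
    [u = 0]. Condition 3 supplies the two constants of integration that are lost in passing from
    [Pi] to its second derivative. *)

(** * Dominated convergence along filters; measurability in R^n *)

Lemma bounded_integrable (R : realType) d (Y : measurableType d)
    (mu : {measure set Y -> \bar R}) (B : set Y) (f : Y -> R) (C : R) :
  measurable B -> (mu B < +oo)%E -> measurable_fun B f ->
  (forall x, B x -> `|f x| <= C) -> mu.-integrable B (EFin \o f).
Proof.
move=> mB muB mf fC; apply: (@le_integrable _ _ _ _ _ mB _ (cst C%:E)).
- exact/measurable_EFinP.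
- by move=> x Bx /=; rewrite lee_fin (le_trans (fC _ Bx))// ler_norm.
- apply/integrableP; split; first exact: measurable_cst.
  by rewrite /= integral_cst// lte_mul_pinfty// lee_fin.
Qed.

(** Neighbourhood filters of a pseudometric space have countable bases, so a failure would be
    witnessed by a sequence [t k] in [D] within [1/(k+1)] of [z], and sequential dominated
    convergence refutes it. The set [D] lets one statement cover one-sided limits, punctured limits
    and continuity within a domain. *)
Lemma Rintegral_within_cvg (R : realType) d (Y : measurableType d)
    (mu : {measure set Y -> \bar R}) (B : set Y) (Z : pseudoMetricType R)
    (D : set Z) (z : Z) (f : Z -> Y -> R) (f0 : Y -> R) (C : R) :
  measurable B -> (mu B < +oo)%E ->
  (\forall t \near within D (nbhs z), measurable_fun B (f t) /\
     forall x, B x -> `|f t x| <= C) ->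
  measurable_fun B f0 ->
  (forall x, B x -> f t x @[t --> within D (nbhs z)] --> f0 x) ->
  (\int[mu]_(x in B) f t x)%R @[t --> within D (nbhs z)] -->
    (\int[mu]_(x in B) f0 x)%R.
Proof.
move=> mB muB nf mf0 ff0.
pose U k : set Z := [set t | D t /\ ball z (k.+1%:R^-1) t /\
   (measurable_fun B (f t) /\ forall x, B x -> `|f t x| <= C)].
apply/cvgrPdist_lt => e e0; apply: contrapT => nF.
have key k : exists t, U k t /\
    e <= `|(\int[mu]_(x in B) f0 x)%R - (\int[mu]_(x in B) f t x)%R|.
  apply: contrapT => nex; apply: nF.
  have nb : nbhs z (ball z (k.+1%:R^-1 : R)) by apply: nbhsx_ballx; rewrite invr_gt0.
  rewrite near_withinE in nf.
  suff : \forall t \near z, D t ->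
    `|(\int[mu]_(x in B) f0 x)%R - (\int[mu]_(x in B) f t x)%R| < e by [].
  near=> t => Dt.
  rewrite ltNge; apply/negP => le; apply: nex; exists t; split => //.
  split => //; split; first by near: t.
  by move: Dt; near: t.
have [t /all_and2[Ut dt]] := choice key.
have tz (A : set Z) : within D (nbhs z) A -> exists K, forall k, (K <= k)%N -> A (t k).
  rewrite /within /= => /nbhs_ballP[r /= r0 rA].
  have [K _ HK] := near_infty_natSinv_lt (PosNum r0).
  exists K => k Kk; apply: rA; last by case: (Ut k).
  case: (Ut k) => _ [bt _]; apply: le_ball bt; apply: ltW; exact: HK.
have C0 x : B x -> 0 <= C.
  by move=> Bx; case: (Ut 0%N) => _ [_ [_ /(_ _ Bx)]]; apply: le_trans.
have [] := @dominated_convergence _ Y R mu B mB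
  (fun k x => (f (t k) x)%:E) (EFin \o f0) (cst (C%:E)).
- by move=> k; apply/measurable_EFinP; case: (Ut k) => _ [_ []].
- exact/measurable_EFinP.
- apply: aeW => x Bx; apply: cvg_EFin; first exact: nearW.
  rewrite /=; apply/cvgrPdist_lt => r r0.
  have /cvgrPdist_lt/(_ _ r0)/tz[K HK] := ff0 _ Bx.
  by exists K.
- case: (pselect (exists x, B x)) => [[x Bx]|nB]; last first.
    by rewrite (_ : B = set0) ?integrable_set0// -subset0 => x Bx; apply: nB; exists x.
  by apply: (@bounded_integrable _ _ _ _ _ (cst C) C) => // ? ?; rewrite ger0_norm// (C0 x).
- by apply: aeW => x k Bx; rewrite lee_fin; case: (Ut k) => _ [_ [_ ]]; apply.
move=> if0 _ cv.
have /fine_cvgP[_] : ((\int[mu]_(x in B) (f (t k) x)%:E)%E @[k --> \oo] -->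
   (\int[mu]_(x in B) (f0 x))%R%:E)%classic.
  rewrite /Rintegral fineK; first exact: cv.
  exact: integrable_fin_num.
move/cvgrPdist_lt => /(_ _ e0)[K _ /(_ K (leqnn K))] /=.
by rewrite ltNge => /negP; apply; exact: dt.
Unshelve. all: by end_near.
Qed.

Lemma cvgr_sum (R : realType) (T I : Type) (F : set_system T) (s : seq I)
    (f : I -> T -> R) (l : I -> R) : Filter F ->
  (forall i, f i t @[t --> F] --> l i) ->
  \sum_(i <- s) f i t @[t --> F] --> \sum_(i <- s) l i.
Proof.
move=> FF fl; elim: s => [|i s IH].
  by rewrite big_nil; under eq_cvg do rewrite big_nil; exact: cvg_cst.
rewrite big_cons; under eq_cvg do rewrite big_cons.
by apply: cvgD; [exact: fl|exact: IH].
Qed.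

Lemma cvgr_prod (R : realType) (T I : Type) (F : set_system T) (s : seq I)
    (f : I -> T -> R) (l : I -> R) : Filter F ->
  (forall i, f i t @[t --> F] --> l i) ->
  \prod_(i <- s) f i t @[t --> F] --> \prod_(i <- s) l i.
Proof.
move=> FF fl; elim: s => [|i s IH].
  by rewrite big_nil; under eq_cvg do rewrite big_nil; exact: cvg_cst.
rewrite big_cons; under eq_cvg do rewrite big_cons.
by apply: cvgM; [exact: fl|exact: IH].
Qed.

(** Without the clamp continuity fails at 0: [powR] equals 1 at negative bases, because [ln] is 0
    there. *)
Lemma continuous_powR_max (R : realType) (a : R) : 0 < a ->
  continuous (fun t : R => (Num.max 0 t) `^ a).
Proof.
move=> a0 t; have [t0|t0|->] := ltgtP t 0.
- rewrite /continuous_at (max_idPl (ltW t0)); apply: cvg_near_cst.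
  near=> s; rewrite (max_idPl _)//; apply: ltW; near: s; exact: lt_nbhsl.
- have : {for t, continuous (fun t : R => t `^ a)}.
    apply: differentiable_continuous; apply/derivable1_diffP.
    by apply: derivable_powR; rewrite in_itv/= t0.
  rewrite /prop_for /continuous_at (max_idPr (ltW t0)); apply: cvg_trans.
  apply: near_eq_cvg; near=> s; rewrite (max_idPr _)//; apply: ltW; near: s; exact: lt_nbhsr.
- rewrite /continuous_at maxxx powR0 ?gt_eqF//; apply/cvgrPdist_lt => e e0.
  near=> s; rewrite sub0r normrN ger0_norm ?powR_ge0//.
  have -> : e = (e `^ a^-1) `^ a by rewrite -powRrM mulVf ?gt_eqF// powRr1// ltW.
  rewrite gt0_ltr_powR// ?nnegrE ?powR_ge0 ?le_max ?lexx// gt_max powR_gt0//=.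
  near: s; apply: lt_nbhsl; exact: powR_gt0.
Unshelve. all: by end_near. Qed.

Lemma measurable_coord (R : realType) n (i : 'I_n) :
  measurable_fun [set: borel_rV R n] (fun x : borel_rV R n => (x : 'rV[R]_n) ord0 i).
Proof.
apply: (measurability _ (RGenOpens.measurableE R)) => _ [_ [a [b ->]] <-].
rewrite setTI; apply: sub_sigma_algebra.
by move: (@coord_continuous R 1 n ord0 i) => /continuousP; apply; exact: interval_open.
Qed.

(** An open set is the union of the cubes [V c] it contains, with rational centres and radii
    [1/(k+1)]. There are countably many of them, and the preimage of each is a finite intersection
    of coordinate preimages. *)
Lemma measurable_fun_rV (R : realType) n d (T : measurableType d) (f : T -> 'rV[R]_n) :
  (forall i, measurable_fun setT (fun x => f x ord0 i)) ->
  measurable_fun setT (f : T -> borel_rV R n).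
Proof.
move=> mf; apply: measurability => [|_ [U oU <-]]; first by [].
rewrite setTI.
pose V (c : 'rV[rat]_n * nat) : set 'rV[R]_n :=
  ball (\row_i (ratr (c.1 ord0 i) : R) : 'rV[R]_n) (c.2.+1%:R^-1 : R).
have mV c : measurable (f @^-1` V c).
  have -> : f @^-1` V c = \bigcap_(i in [set: 'I_n])
      ((fun x => f x ord0 i) @^-1` ball (ratr (c.1 ord0 i) : R) (c.2.+1%:R^-1 : R)).
    apply/seteqP; split => [x [_ /(_ ord0) b] i _|x b].
      by move: (b i); rewrite mxE.
    split => [|i j]; first by rewrite invr_gt0.
    by rewrite mxE (ord1 i); exact: b.
  apply: fin_bigcap_measurable => // i _; rewrite -[_ @^-1` _]setTI; apply: mf => //.
  by apply: open_measurable; apply: ball_open; rewrite invr_gt0.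
have -> : f @^-1` U = \bigcup_(c in [set c | V c `<=` U]) f @^-1` V c.
  apply/seteqP; split => [x Ux|x [c cU Vc]]; last exact: cU.
  move: oU; rewrite openE => /(_ _ Ux) /nbhs_ballP[e /= e0 eU].
  have [k _ /(_ k (leqnn k)) /= ke] := near_infty_natSinv_lt (PosNum (divr_gt0 e0 (@ltr0n R 2))).
  have k0 : 0 < k.+1%:R^-1 :> R by rewrite invr_gt0.
  have rq (i : 'I_n) : exists q : rat, `|ratr q - f x ord0 i| < k.+1%:R^-1.
    have [|q /itvP qi] := @rat_in_itvoo R (f x ord0 i) (f x ord0 i + k.+1%:R^-1); first by rewrite ltrDl.
    exists q; rewrite ger0_norm ?subr_ge0 ?ltrBlDl ?qi// ltW// qi.
  have [q Hq] := choice rq.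
  have Vx : V (\row_i q i, k) (f x).
    by split => // i j; rewrite !mxE (ord1 i); exact: Hq.
  exists (\row_i q i, k) => // y Vy; apply: eU.
  have -> : e = e / 2 + e / 2 by rewrite -splitr.
  apply: (@ball_triangle _ _ (\row_i (ratr ((\row_i q i) ord0 i) : R) : 'rV[R]_n)).
    by apply: ball_sym; apply: le_ball Vx; exact: ltW.
  by apply: le_ball Vy; exact: ltW.
by rewrite bigcup_mkcond; apply: countable_bigcupT_measurable => // c; case: ifPn.
Qed.

Lemma interior_orthantE (R : realType) n (p : 'rV[R]_n) :
  (orthant n)° p <-> forall i, 0 < p ord0 i.
Proof.
split => [|p0].
  move=> /nbhs_ballP[e /= e0 eO] i.
  have /eO/(_ i) : ball p e (p - const_mx (e / 2)).
    split => // a b; rewrite /ball /= !mxE (ord1 a) opprB addrC subrK ger0_norm; lra.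
  rewrite !mxE; lra.
have : \forall q \near p, forall i, 0 < (q : 'rV[R]_n) ord0 i; last first.
  by apply: filterS => q Oq i; exact/ltW/Oq.
apply: (@filter_forall _ _ (fun i q => 0 < (q : 'rV[R]_n) ord0 i) (nbhs p)) => i.
exact: (cvgr_gt _ (@coord_continuous R 1 n ord0 i p) _ (p0 i)).
Qed.

Lemma measurable_orthant (R : realType) n : measurable (orthant n : set (borel_rV R n)).
Proof.
rewrite [X in measurable X](_ : _ = \bigcap_(i in [set: 'I_n])
    ((fun x : borel_rV R n => (x : 'rV[R]_n) ord0 i) @^-1` `[0, +oo[)).
  apply: fin_bigcap_measurable => // i _; rewrite -[_ @^-1` _]setTI.
  exact: measurable_coord.
by apply/seteqP; split => x Ox i; [move=> _|move: (Ox i I)]; rewrite /= in_itv/= andbT.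
Qed.

Lemma measurable_rV_set1 (R : realType) n (v : 'rV[R]_n) :
  measurable ([set v] : set (borel_rV R n)).
Proof.
rewrite [X in measurable X](_ : _ = \bigcap_(i in [set: 'I_n])
    ((fun x : borel_rV R n => (x : 'rV[R]_n) ord0 i) @^-1` [set v ord0 i])).
  apply: fin_bigcap_measurable => // i _; rewrite -[_ @^-1` _]setTI.
  exact: measurable_coord.
apply/seteqP; split => [x -> i _//|x xv].
by apply/rowP => i; exact: xv.
Qed.

(** * The operation [odot]: homogeneity, continuity and concavity in the price *)

Section odot_theory.
Context {R : realType} {n : nat} (alpha : R).
Hypotheses (alpha_gt0 : 0 < alpha).
Implicit Types p q x : 'rV[R]_n.

Let alphaV_gt0 : 0 < alpha^-1. Proof. by rewrite invr_gt0. Qed.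

Lemma odot_ge0 p x : 0 <= odot alpha p x.
Proof. exact: powR_ge0. Qed.

Lemma odot_powR p x : odot alpha p x `^ alpha = \sum_(i < n) (p ord0 i * x ord0 i) `^ alpha.
Proof.
by rewrite /odot -powRrM mulVf ?gt_eqF// powRr1// sumr_ge0// => i _; exact: powR_ge0.
Qed.

Lemma odot_powR_rV p x : orthant n p -> orthant n x ->
  odot alpha (powR_rV alpha^-1 p) x `^ alpha =
  \sum_(i < n) p ord0 i * x ord0 i `^ alpha.
Proof.
move=> Op Ox; rewrite odot_powR; apply: eq_bigr => i _; rewrite mxE powRM ?powR_ge0//.
by rewrite -powRrM mulVf ?gt_eqF// powRr1.
Qed.

Lemma odotZ p x (l : R) : orthant n p -> orthant n x -> 0 <= l ->
  odot alpha (l *: p) x = l * odot alpha p x.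
Proof.
move=> Op Ox l0; rewrite /odot.
under eq_bigr do rewrite mxE -mulrA powRM ?mulr_ge0//.
rewrite -mulr_sumr powRM ?powR_ge0//; last by apply: sumr_ge0 => i _; exact: powR_ge0.
by rewrite -powRrM mulfV ?gt_eqF// powRr1.
Qed.

Lemma odot0l x : odot alpha 0 x = 0.
Proof.
rewrite /odot big1 ?powR0 ?gt_eqF// => i _.
by rewrite mxE mul0r powR0 ?gt_eqF.
Qed.

(** This is what ties condition 3 to interior prices: if some [p_i] is 0, the whole axis of [x_i] is
    sent to 0, and its mass would show up in the derivative of the profit at 0. *)
Lemma odot_eq0 p x : orthant n x -> (forall i, 0 < p ord0 i) ->
  odot alpha p x = 0 -> x = 0.
Proof.
move=> Ox p0 /powR_eq0_eq0/eqP.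
rewrite psumr_eq0 => [/allP/= h|i _]; last exact: powR_ge0.
apply/rowP => i; rewrite mxE; have := h i (mem_index_enum _).
by rewrite powR_eq0 mulf_eq0 (gt_eqF (p0 i)) (gt_eqF alpha_gt0) /= andbT => /eqP.
Qed.

Lemma measurable_odot p : measurable_fun setT (odot alpha p : borel_rV R n -> R).
Proof.
apply: (measurableT_comp (measurable_powR _)).
apply: measurable_sum => i; apply: (measurableT_comp (measurable_powR _)).
apply: measurable_funM => //; exact: measurable_coord.
Qed.

Lemma cvg_odot p x : orthant n p -> orthant n x ->
  odot alpha q x @[q --> within (orthant n) (nbhs p)] --> odot alpha p x.
Proof.
(* The clamped function [h] is continuous everywhere and agrees with [odot] on the orthant, whereas
   [odot] itself jumps where a factor changes sign. *)
pose h q := (Num.max 0 (\sum_(i < n) (Num.max 0 (q ord0 i * x ord0 i)) `^ alpha)) `^ alpha^-1.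
have hE q : orthant n q -> orthant n x -> odot alpha q x = h q.
  move=> Oq Ox; rewrite /h (max_idPr _); last by apply: sumr_ge0 => i _; exact: powR_ge0.
  by congr (_ `^ _); apply: eq_bigr => i _; rewrite (max_idPr _)// mulr_ge0.
have ch : continuous h.
  move=> q; apply: (continuous_comp (g := fun t : R => (Num.max 0 t) `^ alpha^-1)); last first.
    exact: continuous_powR_max.
  apply: (cvgr_sum (F := nbhs q)) => i.
  apply: (@continuous_comp _ _ _ (fun q : 'rV[R]_n => q ord0 i * x ord0 i)
    (fun t : R => (Num.max 0 t) `^ alpha) q); last exact: continuous_powR_max.
  apply: (@cvgMr_tmp _ _ (nbhs q)); exact: (@coord_continuous R 1 n ord0 i q).
move=> Op Ox; rewrite hE//; apply: (@cvg_trans _ (h q @[q --> within (orthant n) (nbhs p)])).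
  apply: near_eq_cvg; rewrite near_withinE; apply: nearW => q Oq; exact/esym/hE.
apply: cvg_within_filter; exact: ch.
Qed.

End odot_theory.

(** Apply the convexity of the power [1/a >= 1] to the a-th powers of [u] and [v], then raise the
    resulting inequality to the power [a]. *)
Lemma concave_powR (R : realType) (a t u v : R) : 0 < a -> a <= 1 ->
  0 <= t -> t <= 1 -> 0 <= u -> 0 <= v ->
  t * u `^ a + (1 - t) * v `^ a <= (t * u + (1 - t) * v) `^ a.
Proof.
move=> a0 a1 t0 t1 u0 v0.
have s0 : 0 <= 1 - t by lra.
have aV : 1 <= a^-1 by rewrite invf_ge1.
have := @convex_powR R a^-1 aV (Itv01 t0 t1) (u `^ a) (v `^ a).
rewrite !inE/= !in_itv/= !powR_ge0 => /(_ isT isT).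
rewrite !convRE /= -!powRrM mulfV ?gt_eqF// !powRr1//.
have Z0 : 0 <= t * u `^ a + (1 - t) * v `^ a by rewrite addr_ge0 ?mulr_ge0 ?powR_ge0.
have W0 : 0 <= t * u + (1 - t) * v by rewrite addr_ge0 ?mulr_ge0.
move=> h; have {h} : (t * u `^ a + (1 - t) * v `^ a) `^ a^-1 <= t * u + (1 - t) * v by exact: h.
move: (t * u `^ a + _) Z0 (t * u + _) W0 => Z Z0 W W0 /(ge0_ler_powR (ltW a0)).
rewrite !nnegrE powR_ge0 W0 => /(_ isT isT).
by rewrite -powRrM mulVf ?gt_eqF// powRr1.
Qed.

(* The reverse Minkowski inequality for the exponent [a <= 1]. *)
Lemma powR_sum_superadditive (R : realType) (I : finType) (a : R) (u v : I -> R) :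
  0 < a -> a <= 1 -> (forall i, 0 <= u i) -> (forall i, 0 <= v i) ->
  (\sum_i u i `^ a) `^ a^-1 + (\sum_i v i `^ a) `^ a^-1 <=
  (\sum_i (u i + v i) `^ a) `^ a^-1.
Proof.
move=> a0 a1 u0 v0.
have sum0 (w : I -> R) : 0 <= \sum_i w i `^ a by apply: sumr_ge0 => i _; exact: powR_ge0.
have eq0 (w : I -> R) : (\sum_i w i `^ a) `^ a^-1 = 0 -> forall i, w i = 0.
  move=> /powR_eq0_eq0/eqP; rewrite psumr_eq0 => [/allP/= h i|i _]; last exact: powR_ge0.
  by apply/(@powR_eq0_eq0 _ _ a)/eqP/h/mem_index_enum.
have powK (w : I -> R) : \sum_i w i `^ a = ((\sum_i w i `^ a) `^ a^-1) `^ a.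
  by rewrite -powRrM mulVf ?gt_eqF// powRr1.
have [A0|Apos] := eqVneq ((\sum_i u i `^ a) `^ a^-1) 0.
  by rewrite A0 add0r; under [in leRHS]eq_bigr do rewrite eq0// add0r.
have [B0|Bpos] := eqVneq ((\sum_i v i `^ a) `^ a^-1) 0.
  by rewrite B0 addr0; under [in leRHS]eq_bigr do rewrite (eq0 v)// addr0.
have := powK u; have := powK v.
move: Apos Bpos; set A := _ `^ a^-1; set B := _ `^ a^-1 => Ane Bne HB HA.
have A0 : 0 < A by rewrite lt_neqAle eq_sym Ane powR_ge0.
have B0 : 0 < B by rewrite lt_neqAle eq_sym Bne powR_ge0.
clearbody A B.
have AB0 : 0 < A + B by exact: addr_gt0.
(* Division by [A] and [B] normalizes both sums of a-th powers to 1. With this weight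
   [(u i + v i) / (A + B)] is the convex combination of [u i / A] and [v i / B], so summing the
   concavity inequality gives 1 as a lower bound for the normalized right-hand side. *)
pose t := A / (A + B).
have t0 : 0 <= t by rewrite divr_ge0 ?ltW.
have t1 : t <= 1 by rewrite ler_pdivrMr// mul1r lerDl ltW.
have term i : t * (u i / A) `^ a + (1 - t) * (v i / B) `^ a <= ((u i + v i) / (A + B)) `^ a.
  have -> : (u i + v i) / (A + B) = t * (u i / A) + (1 - t) * (v i / B).
    by rewrite /t; field; rewrite !gt_eqF.
  by apply: concave_powR => //; rewrite divr_ge0// ltW.
have divE (w : I -> R) (C : R) : 0 < C -> (forall i, 0 <= w i) ->
    \sum_i (w i / C) `^ a = (\sum_i w i `^ a) / C `^ a.
  move=> C0 w0; rewrite mulr_suml; apply: eq_bigr => i _.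
  by rewrite powRM ?invr_ge0 ?(ltW C0)// -[C^-1]powR_inv1 ?(ltW C0)// powRAC powR_inv1 ?powR_ge0.
have : \sum_i (t * (u i / A) `^ a + (1 - t) * (v i / B) `^ a) <=
    \sum_i ((u i + v i) / (A + B)) `^ a by apply: ler_sum => i _; exact: term.
rewrite big_split/= -!mulr_sumr !divE// => [|i]; last exact: addr_ge0.
rewrite HA HB !divff ?gt_eqF ?powR_gt0// !mulr1 addrC subrK ler_pdivlMr ?powR_gt0// mul1r.
move=> /(@ge0_ler_powR _ a^-1); rewrite invr_ge0 (ltW a0) !nnegrE powR_ge0 sum0.
by rewrite -powRrM mulfV ?gt_eqF// powRr1 ?(ltW AB0)// => /(_ isT isT isT).
Qed.

Lemma concave_odot (R : realType) n (alpha t : R) (p q x : 'rV[R]_n) :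
  0 < alpha -> alpha <= 1 -> 0 <= t -> t <= 1 ->
  orthant n p -> orthant n q -> orthant n x ->
  t * odot alpha p x + (1 - t) * odot alpha q x <=
  odot alpha (t *: p + (1 - t) *: q) x.
Proof.
move=> a0 a1 t0 t1 Op Oq Ox; have s0 : 0 <= 1 - t by lra.
rewrite -!odotZ//.
rewrite {3}/odot; under [in leRHS]eq_bigr do rewrite mxE mulrDl.
by apply: powR_sum_superadditive => // i; rewrite mulr_ge0 ?mxE ?mulr_ge0.
Qed.

(** * Stieltjes measures as image measures *)

Lemma lebesgue_stieltjes_itv (R : realType) (G : cumulative R R) (a b : R) :
  a <= b -> lebesgue_stieltjes_measure G `]a, b]%classic = (G b - G a)%:E.
Proof.
move=> ab; rewrite /lebesgue_stieltjes_measure /measure_extension.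
rewrite measurable_mu_extE/=; last exact: is_ocitv.
by rewrite wlength_itv_bnd.
Qed.

Lemma lebesgue_stieltjes_pushforward (R : realType) d (Y : measurableType d)
    (mu : {measure set Y -> \bar R}) (s : Y -> measurableTypeR R) (G : cumulative R R) :
  measurable_fun setT s ->
  (forall a b, a <= b -> mu (s @^-1` `]a, b]) = (G b - G a)%:E) ->
  forall A : set (measurableTypeR R), measurable A ->
  lebesgue_stieltjes_measure G A = pushforward mu s A.
Proof.
move=> ms H A mA.
pose nu : {measure set (measurableTypeR R) -> \bar R} :=
  measure_function_pushforward__canonical__measure_function_Measure mu ms.
rewrite (lebesgue_stieltjes_measure_unique (mu := nu))// => X [[a b] _ <-] /=.
have [ab|ba] := leP a b; first by rewrite lebesgue_stieltjes_itv// -H.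
by rewrite set_itv_ge ?bnd_simp -?leNgt ?ltW// !measure0.
Qed.

(** This change of variables serves both implications: with [s] the map [odot alpha q] it computes
    the integral of condition 4, and with [s] a dilation it gives the scaling law along a ray. *)
Lemma ge0_integral_lebesgue_stieltjes (R : realType) d (Y : measurableType d)
    (mu : {measure set Y -> \bar R}) (s : Y -> R) (G : cumulative R R)
    (E : set R) (phi : R -> R) :
  measurable_fun setT s ->
  (forall a b, a <= b -> mu (s @^-1` `]a, b]) = (G b - G a)%:E) ->
  measurable E -> measurable_fun setT phi -> (forall t, 0 <= phi t) ->
  (\int[lebesgue_stieltjes_measure G]_(t in E) (phi t)%:E =
   \int[mu]_(x in s @^-1` E) (phi (s x))%:E)%E.
Proof.
move=> ms H mE mphi phi0.
rewrite -(@ge0_integral_pushforward _ _ Y (measurableTypeR R) R s ms mu E (EFin \o phi))//; first last.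
- by move=> y _; rewrite lee_fin.
- by apply/measurable_EFinP; apply: measurable_funTS.
by apply: eq_measure_integral => A mA _; exact: lebesgue_stieltjes_pushforward.
Qed.

Lemma continuous_pos_part (R : realType) : continuous (fun y : R => Num.max 0 y).
Proof.
move=> y; apply/cvgrPdist_lt => e e0; near=> z.
have : `|y - z| < e by near: z; apply: cvgr_dist_lt e0; exact: cvg_id.
rewrite !ltr_norml => /andP[? ?]; case: (leP 0 y) => ?; case: (leP 0 z) => ?; lra.
Unshelve. all: by end_near. Qed.

(** * The profit of a finite measure: convexity, continuity, right derivative *)

Section representation_properties.
Context {R : realType} {n : nat} (alpha : R) (mu : {measure set (borel_rV R n) -> \bar R}).
Hypotheses (alpha_gt0 : 0 < alpha) (alpha_le1 : alpha <= 1).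
Hypothesis (fin_mu : (mu (orthant n) < +oo)%E).
Implicit Types p q x : 'rV[R]_n.

Let O : set (borel_rV R n) := orthant n.
Let mO : measurable O. Proof. exact: measurable_orthant. Qed.

Definition Rprofit p (t : R) : R :=
  (\int[mu]_(x in (orthant n : set (borel_rV R n))) Num.max 0 (t - odot alpha p x))%R.

Let measurable_gain p (t : R) : measurable_fun O (fun x => Num.max 0 (t - odot alpha p x)).
Proof.
apply: measurable_maxr => //; apply: measurable_funB => //.
by apply: measurable_funTS; exact: measurable_odot.
Qed.

Let gain_bound p (t : R) x : 0 <= t -> `|Num.max 0 (t - odot alpha p x)| <= t.
Proof.
move=> t0; rewrite ger0_norm ?le_max ?lexx// ge_max t0/=.
by rewrite lerBlDr lerDl odot_ge0.
Qed.

Let integrable_gain p (t : R) : 0 <= t ->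
  mu.-integrable O (fun x => (Num.max 0 (t - odot alpha p x))%:E).
Proof.
move=> t0; apply: (@bounded_integrable _ _ _ mu O _ t) => // x _; exact: gain_bound.
Qed.

Lemma profitE p (t : R) : 0 <= t -> profit alpha mu p t = (Rprofit p t)%:E.
Proof. by move=> t0; rewrite /profit /Rprofit /Rintegral fineK//; apply: integrable_fin_num => //; exact: integrable_gain. Qed.

Let RprofitMl l p (t : R) : 0 <= t ->
  l * Rprofit p t = (\int[mu]_(x in O) (l * Num.max 0 (t - odot alpha p x)))%R.
Proof. by move=> t0; rewrite RintegralZl//; exact: integrable_gain. Qed.

(** For fixed [x] the gain is the positive part of [t] minus a concave function of [p], hence
    jointly convex; integration preserves this. *)
Lemma Rprofit_convex p q (a b t : R) : orthant n p -> orthant n q ->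
  0 <= a -> 0 <= b -> 0 <= t -> t <= 1 ->
  Rprofit (t *: p + (1 - t) *: q) (t * a + (1 - t) * b) <=
  t * Rprofit p a + (1 - t) * Rprofit q b.
Proof.
move=> Op Oq a0 b0 t0 t1; have s0 : 0 <= 1 - t by lra.
have i1 : mu.-integrable O (EFin \o (fun x => t * Num.max 0 (a - odot alpha p x))).
  by have := integrableZl mO t (integrable_gain p a0); apply: eq_integrable.
have i2 : mu.-integrable O (EFin \o (fun x => (1 - t) * Num.max 0 (b - odot alpha q x))).
  by have := integrableZl mO (1 - t) (integrable_gain q b0); apply: eq_integrable.
rewrite (RprofitMl t p a0) (RprofitMl (1 - t) q b0) -(RintegralD mO i1 i2).
have i3 := integrable_gain (t *: p + (1 - t) *: q) (addr_ge0 (mulr_ge0 t0 a0) (mulr_ge0 s0 b0)).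
have i4 := integrableD mO i1 i2.
apply: (le_Rintegral mO i3 i4).
move=> x Ox; have := concave_odot alpha_gt0 alpha_le1 t0 t1 Op Oq Ox.
move: (odot alpha (t *: p + _) x) (odot alpha p x) (odot alpha q x) => C A B h.
rewrite ge_max addr_ge0 ?mulr_ge0 ?le_max ?lexx//=.
have h1 : t * (a - A) <= t * Num.max 0 (a - A) by rewrite ler_wpM2l// le_max lexx orbT.
have h2 : (1 - t) * (b - B) <= (1 - t) * Num.max 0 (b - B) by rewrite ler_wpM2l// le_max lexx orbT.
lra.
Qed.

Lemma RprofitZ p (t l : R) : orthant n p -> 0 <= t -> 0 <= l ->
  Rprofit (l *: p) (l * t) = l * Rprofit p t.
Proof.
move=> Op t0 l0; rewrite (RprofitMl l p t0).
apply: eq_Rintegral => x /set_mem Ox; rewrite odotZ// -mulrBr.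
by rewrite -[in LHS](mulr0 l) maxr_pMr// mulr0.
Qed.

Lemma cvg_Rprofit p (t : R) : orthant n p -> 0 < t ->
  Rprofit z.1 z.2 @[z --> within (price_domain n) (nbhs ((p, t) : 'rV[R]_n * R))] --> Rprofit p t.
Proof.
move=> Op t0.
have csnd : snd z @[z --> ((p, t) : 'rV[R]_n * R)] --> t by exact: cvg_snd.
move: (csnd) => /cvgrPdist_lt/(_ _ ltr01) sndt.
(* Since [odot] is nonnegative, the gain at [z] is at most [z.2], which stays below [t + 1] near
   [(p, t)]. *)
apply: (@Rintegral_within_cvg _ _ _ mu O ('rV[R]_n * R)%type (price_domain n) (p, t)
  (fun z x => Num.max 0 (z.2 - odot alpha z.1 x))
  (fun x => Num.max 0 (t - odot alpha p x)) (t + 1)) => //.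
  near=> z; split => //.
  have [Oz] : price_domain n z by near: z; exact: withinT.
  rewrite /= in_itv/= andbT => z0 x Ox; apply: le_trans (gain_bound _ _ (ltW z0)) _.
  suff : `|t - z.2| < 1 by rewrite ltr_norml => /andP[? ?]; lra.
  by near: z; rewrite near_withinE; apply: filterS sndt => z + _.
move=> x Ox.
have c2 : snd z @[z --> within (price_domain n) (nbhs ((p, t) : 'rV[R]_n * R))] --> t.
  by apply: (@cvg_within_filter _ _ snd (nbhs ((p, t) : 'rV[R]_n * R))).
have c1 : odot alpha z.1 x @[z --> within (price_domain n) (nbhs ((p, t) : 'rV[R]_n * R))] -->
    odot alpha p x.
  move=> A /(cvg_odot alpha_gt0 Op Ox); rewrite /fmap/= /within/= => wA.
  have cfst : fst z @[z --> ((p, t) : 'rV[R]_n * R)] --> p by exact: cvg_fst.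
  by apply: (@filterS _ (nbhs ((p, t) : 'rV[R]_n * R)) _ _ _ _ (cfst _ wA)) => -[q s] /= qA [/= Oq _]; exact: qA.
have FF : Filter (within (price_domain n) (nbhs ((p, t) : 'rV[R]_n * R))).
  by apply: within_filter; exact: nbhs_filter.
have c3 := cvgB c2 c1.
exact: (cvg_comp _ _ (c3 FF) (@continuous_pos_part R (t - odot alpha p x))).
Unshelve. all: by end_near. Qed.

End representation_properties.

Section distribution_properties.
Context {R : realType} {n : nat} (alpha : R) (mu : {measure set (borel_rV R n) -> \bar R}).
Hypotheses (alpha_gt0 : 0 < alpha) (alpha_le1 : alpha <= 1).
Hypothesis (fin_mu : (mu (orthant n) < +oo)%E).
Hypothesis (supp_mu : supported_in mu (orthant n)).
Hypothesis (mu0 : mu [set (0 : 'rV[R]_n)] = 0%E).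
Implicit Types p q x : 'rV[R]_n.

Let O : set (borel_rV R n) := orthant n.
Let mO : measurable O. Proof. exact: measurable_orthant. Qed.

Definition odot_cdf p (t : R) : R :=
  (\int[mu]_(x in (orthant n : set (borel_rV R n))) (odot alpha p x <= t)%R%:R)%R.

Let ind p (t : R) := fun x : borel_rV R n => (odot alpha p x <= t)%R%:R : R.

Let indE p t : ind p t = \1_(odot alpha p @^-1` `]-oo, t]).
Proof.
apply/funext => x; rewrite /ind /indic; congr (nat_of_bool _)%:R.
by apply/idP/idP => [h|/set_mem]; rewrite ?inE /= in_itv.
Qed.

Let measurable_le p (t : R) : measurable (odot alpha p @^-1` `]-oo, t] : set (borel_rV R n)).
Proof. by rewrite -[_ @^-1` _]setTI; apply: measurable_odot. Qed.

Let measurable_ind p t : measurable_fun O (ind p t).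
Proof. by rewrite indE; apply: measurable_indic; exact: measurable_le. Qed.

Let ind_bound p t x : `|ind p t x| <= 1.
Proof. by rewrite /ind normr_nat lern1 leq_b1. Qed.

Let integrable_ind p t : mu.-integrable O (EFin \o ind p t).
Proof. exact: (@bounded_integrable _ _ _ mu O _ 1). Qed.

Let null_compl A : measurable A -> mu A = mu (A `&` O).
Proof.
move=> mA; rewrite (measureDI mu mA mO) [X in (X + _)%E](_ : _ = 0%E) ?add0e//.
apply: subset_measure0 supp_mu; [exact: measurableD|exact: measurableC|by move=> x []].
Qed.

Let odot_cdfE p t : (odot_cdf p t)%:E = mu (odot alpha p @^-1` `]-oo, t] : set (borel_rV R n)).
Proof.
rewrite (null_compl (measurable_le p t)) -integral_indic// -indE.
by rewrite /odot_cdf /Rintegral fineK//; apply: integrable_fin_num => //; exact: integrable_ind.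
Qed.

Lemma nondecreasing_odot_cdf p : {homo odot_cdf p : s t / s <= t}.
Proof.
move=> s t st; apply: (le_Rintegral mO (integrable_ind p s) (integrable_ind p t)) => x _.
by rewrite /ind ler_nat; case: (leP (odot _ _ _) s) => // h; rewrite (le_trans h st).
Qed.

Lemma right_continuous_odot_cdf p (t : R) : odot_cdf p s @[s --> t^'+] --> odot_cdf p t.
Proof.
apply: (@Rintegral_within_cvg _ _ _ mu O R (fun s => t < s) t (ind p) (ind p t) 1) => //.
  by apply: nearW.
move=> x Ox; apply: cvg_near_cst; rewrite near_withinE.
have [xt|tx] := leP (odot alpha p x) t.
  by apply: nearW => s ts; rewrite /ind xt (le_trans xt (ltW ts)).
near=> s => ts; rewrite /ind !leNgt tx /=.
by have -> : s < odot alpha p x by near: s; exact: lt_nbhsl.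
Unshelve. all: by end_near. Qed.

Lemma mu_odot_itv p (a b : R) : a <= b ->
  mu (odot alpha p @^-1` `]a, b] : set (borel_rV R n)) = (odot_cdf p b - odot_cdf p a)%:E.
Proof.
move=> ab; have finb : (mu (odot alpha p @^-1` `]-oo, b] : set (borel_rV R n)) < +oo)%E.
  by rewrite -odot_cdfE ltry.
rewrite EFinB !odot_cdfE.
have -> : odot alpha p @^-1` `]a, b] = (odot alpha p @^-1` `]-oo, b] : set (borel_rV R n))
    `\` (odot alpha p @^-1` `]-oo, a]).
  apply/seteqP; split => x /=; rewrite !in_itv/=; first by move=> /andP[? ?]; split => //; apply/negP; rewrite -ltNge.
  by move=> [xb /negP]; rewrite -ltNge xb andbT.
rewrite measureD; [|exact: measurable_le|exact: measurable_le|exact: finb].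
congr (_ - mu _)%E; apply/seteqP; split => x /=; rewrite !in_itv/=; first by case.
by move=> xa; split => //; apply: le_trans ab.
Qed.

Lemma odot_cdf0 p : (forall i, 0 < p ord0 i) -> odot_cdf p 0 = 0.
Proof.
move=> p0; apply/EFin_inj; rewrite odot_cdfE (null_compl (measurable_le p 0)).
apply/eqP; rewrite -measure_le0 -mu0; apply: le_measure; rewrite ?inE//.
- exact: measurableI.
- exact: measurable_rV_set1.
by move=> x []/=; rewrite in_itv/= => x0 Ox; apply: (odot_eq0 alpha_gt0 Ox p0); apply/eqP; rewrite eq_le x0 odot_ge0.
Qed.
End distribution_properties.

Section profit_derivative.
Context {R : realType} {n : nat} (alpha : R) (mu : {measure set (borel_rV R n) -> \bar R}).
Hypotheses (alpha_gt0 : 0 < alpha) (alpha_le1 : alpha <= 1).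
Hypothesis (fin_mu : (mu (orthant n) < +oo)%E).
Implicit Types p q x : 'rV[R]_n.

Let O : set (borel_rV R n) := orthant n.
Let mO : measurable O. Proof. exact: measurable_orthant. Qed.

Let mg p t : measurable_fun O (fun x => Num.max 0 (t - odot alpha p x)).
Proof.
apply: measurable_maxr => //; apply: measurable_funB => //.
by apply: measurable_funTS; exact: measurable_odot.
Qed.

Let ig p (t : R) : 0 <= t ->
  mu.-integrable O (EFin \o (fun x => (Num.max 0 (t - odot alpha p x)))).
Proof.
move=> t0; apply: (@bounded_integrable _ _ _ mu O _ t) => // x _.
rewrite ger0_norm ?le_max ?lexx// ge_max t0/=.
by rewrite lerBlDr lerDl odot_ge0.
Qed.

(** The difference quotients of the gain lie between 0 and 1. For [h > 0] they equal 1 also at the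
    points with [odot alpha p x = t], so the limit is the distribution function with the closed
    inequality, which is the right-continuous one. *)
Lemma cvg_Rprofit_slope p (t : R) : 0 <= t ->
  h^-1 * (Rprofit alpha mu p (t + h) - Rprofit alpha mu p t) @[h --> 0^'+] -->
  odot_cdf alpha mu p t.
Proof.
move=> t0.
pose f (h : R) (x : borel_rV R n) : R :=
  h^-1 * (Num.max 0 (t + h - odot alpha p x) - Num.max 0 (t - odot alpha p x)).
apply: (@cvg_trans _ ((\int[mu]_(x in O) f h x)%R @[h --> 0^'+])).
  apply: near_eq_cvg; near=> h.
  have h0 : 0 < h by near: h; exact: nbhs_right_gt.
  have th : 0 <= t + h by rewrite addr_ge0// ltW.
  rewrite /f RintegralZl//; last by have := integrableB mO (ig p th) (ig p t0); apply: eq_integrable.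
  by rewrite (RintegralB mO (ig p th) (ig p t0)).
apply: (@Rintegral_within_cvg _ _ _ mu O R (fun h => 0 < h) 0 f
   (fun x => (odot alpha p x <= t)%R%:R) 1) => //.
- rewrite near_withinE; apply: nearW => h h0; split.
    by apply: measurable_funM => //; apply: measurable_funB; exact: mg.
  move=> x _; rewrite /f normrM gtr0_norm ?invr_gt0// ler_pdivrMl// mulr1.
  have := odot_ge0 alpha p x; move: (odot alpha p x) => s s0.
  rewrite ler_norml; case: (leP 0 (t + h - s)); case: (leP 0 (t - s)) => ? ?; apply/andP; split; lra.
- rewrite (_ : (fun x => _) = \1_(odot alpha p @^-1` `]-oo, t])); last first.
    apply/funext => x; rewrite /indic; congr (nat_of_bool _)%:R.
    by apply/idP/idP => [h|/set_mem]; rewrite ?inE /= in_itv.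
  by apply: measurable_indic; rewrite -[_ @^-1` _]setTI; apply: measurable_odot.
move=> x Ox; apply: cvg_near_cst; rewrite near_withinE.
have [xt|tx] := leP (odot alpha p x) t.
  apply: nearW => h h0; rewrite /f !(max_idPr _) ?subr_ge0 ?ler_wpDr// ?(ltW h0)//.
  rewrite (_ : _ - _ = h); last by ring.
  by rewrite mulVf ?gt_eqF.
near=> h => h0; rewrite /f (max_idPl _) ?(max_idPl _) ?subrr ?mulr0//; first by rewrite subr_le0 ltW.
have : h < odot alpha p x - t by near: h; apply: lt_nbhsl; rewrite subr_gt0.
lra.
Unshelve. all: by end_near. Qed.

Lemma cvg_Rprofit0 p : Rprofit alpha mu p t @[t --> 0^'+] --> 0.
Proof.
have z0 : (\int[mu]_(x in O) 0)%R = 0 :> R by rewrite Rintegral_cst// mul0r.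
rewrite -[X in _ --> X]z0.
apply: (@Rintegral_within_cvg _ _ _ mu O R (fun t => 0 < t) 0
  (fun t x => Num.max 0 (t - odot alpha p x)) (fun=> 0) 1) => //.
  rewrite near_withinE; near=> t => t0; split => // x _.
  rewrite ger0_norm ?le_max ?lexx// ge_max ler01/= lerBlDr.
  apply: (@le_trans _ _ 1); last by rewrite lerDl odot_ge0.
  by apply: ltW; near: t; exact: lt_nbhsl.
move=> x Ox.
have zE : Num.max 0 (0 - odot alpha p x) = 0 by rewrite (max_idPl _)// sub0r oppr_le0 odot_ge0.
rewrite -[X in _ --> X]zE.
apply: (@cvg_within_filter _ _ _ (nbhs (0 : R))).
apply: (@continuous_comp _ _ _ (fun t : R => t - odot alpha p x) (fun y : R => Num.max 0 y) 0).
  by apply: cvgB; [exact: cvg_id|exact: cvg_cst].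
exact: continuous_pos_part.
Unshelve. all: by end_near. Qed.

End profit_derivative.

(** * Laplace transforms are completely monotone *)

Lemma powM_expRN_le (R : realType) (m : nat) (Y b : R) : 0 <= Y -> 0 < b ->
  Y ^+ m * expR (- (b * Y)) <= m`!%:R / b ^+ m.
Proof.
move=> Y0 b0; rewrite expRN ler_pdivrMr ?expR_gt0// mulrAC ler_pdivlMr ?exprn_gt0//.
rewrite -exprMn [Y * b]mulrC; have bY : 0 <= b * Y by rewrite mulr_ge0// ltW.
case: m => [|m]; first by rewrite fact0 expr0 mul1r -expR0 ler_expR.
have F0 : 0 < m.+1`!%:R :> R by rewrite ltr0n fact_gt0.
(* A single term of the exponential series is below its sum. *)
rewrite -ler_pdivrMl// [leLHS]mulrC; apply: le_trans (expR_ge1Dxn m bY).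
by rewrite lerDr.
Qed.

Lemma expR_sub1_le (R : realType) (u : R) : `|expR u - 1| <= `|u| * expR `|u|.
Proof.
have [u0|u0] := leP 0 u.
  have e1 : 1 <= expR u by rewrite -expR0 ler_expR.
  rewrite ger0_norm ?subr_ge0// (ger0_norm u0).
  have := expR_ge1Dx (- u); rewrite expRN -(ler_pM2r (expR_gt0 u)) mulVf ?gt_eqF ?expR_gt0//.
  lra.
have h : expR u <= 1 by rewrite -expR0 ler_expR ltW.
rewrite ler0_norm ?subr_le0// (ltr0_norm u0).
have := expR_ge1Dx u; have : 1 <= expR (- u) by rewrite -expR0 ler_expR; lra.
nra.
Qed.

Lemma pos_lower_bound (R : realType) (I : finType) (u : I -> R) :
  (forall i, 0 < u i) -> exists2 b : R, 0 < b & forall i, b <= u i.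
Proof.
move=> u0; exists (\big[Num.min/1]_i u i); first by apply: lt_bigmin => // i _; exact: u0.
by move=> i; exact: bigmin_le.
Qed.

Section laplace_transform.
Context {R : realType} {n : nat} d (Y : measurableType d) (mu : {measure set Y -> \bar R}).
Variables (D : set Y) (y : 'I_n -> Y -> R).
Hypotheses (mD : measurable D) (fin_mu : (mu D < +oo)%E).
Hypotheses (my : forall i, measurable_fun D (y i)) (y0 : forall i x, D x -> 0 <= y i x).
Implicit Types p q : 'rV[R]_n.

Let phi (s : seq 'I_n) p (x : Y) : R :=
  (\prod_(l <- s) - y l x) * expR (- \sum_(i < n) p ord0 i * y i x).

(** The Laplace transform after differentiation along the coordinates listed in [s], each of which
    brings down a factor [- y l]. Carrying the list makes the family stable under differentiation,
    so all orders are treated at once. *)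
Definition laplace s p : R := (\int[mu]_(x in D) phi s p x)%R.

Let mphi s p : measurable_fun D (phi s p).
Proof.
apply: measurable_funM.
  elim: s => [|l s IH]; first by under eq_fun do rewrite big_nil; exact: measurable_cst.
  under eq_fun do rewrite big_cons; apply: measurable_funM => //; exact: measurableT_comp.
apply: measurableT_comp => //; apply: measurableT_comp => //.
by apply: measurable_sum => i; exact: measurable_funM.
Qed.

Let norm_prod s x : D x -> `|\prod_(l <- s) - y l x| = \prod_(l <- s) y l x.
Proof.
move=> Dx; rewrite normr_prod; apply: eq_bigr => l _; rewrite normrN ger0_norm//; exact: y0.
Qed.

(** With [S] the sum of the [y i], the monomial is at most [S ^+ size s] and the exponential at most
    [expR (- (b * S))]. The bound is uniform in [p], as domination near a point requires. *)
Let phi_bound s (b : R) : 0 < b -> exists C : R, forall p, (forall i, b <= p ord0 i) ->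
  forall x, D x -> `|phi s p x| <= C.
Proof.
move=> b0; exists ((size s)`!%:R / b ^+ size s) => p bp x Dx.
pose S := \sum_(i < n) y i x.
have S0 : 0 <= S by apply: sumr_ge0 => i _; exact: y0.
have yS i : y i x <= S by rewrite /S (bigD1 i)//= lerDl sumr_ge0// => j _; exact: y0.
apply: le_trans (powM_expRN_le (size s) S0 b0).
rewrite normrM norm_prod// (ger0_norm (expR_ge0 _)); apply: ler_pM.
- by apply: prodr_ge0 => l _; exact: y0.
- exact: expR_ge0.
- elim: s => [|l s IH]; first by rewrite big_nil.
  rewrite big_cons exprS ler_pM//; first exact: y0.
  by apply: prodr_ge0 => k _; exact: y0.
- rewrite ler_expR lerN2 mulr_sumr; apply: ler_sum => i _.
  by rewrite ler_wpM2r// y0.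
Qed.

Let iphi s p : (forall i, 0 < p ord0 i) -> mu.-integrable D (EFin \o phi s p).
Proof.
move=> p0.
have [b b0 bp] := pos_lower_bound p0.
have [C HC] := phi_bound s b0.
by apply: (@bounded_integrable _ _ _ mu D _ C) => // x Dx; exact: HC.
Qed.

Lemma integrable_laplace s p : (forall i, 0 < p ord0 i) ->
  mu.-integrable D (fun x => ((\prod_(l <- s) - y l x) *
    expR (- \sum_(i < n) p ord0 i * y i x))%:E).
Proof. exact: iphi. Qed.

Lemma continuous_laplace s p : (forall i, 0 < p ord0 i) ->
  {for p, continuous (laplace s)}.
Proof.
move=> p0; have [b b0 bp] := pos_lower_bound p0.
have b20 : 0 < b / 2 by rewrite divr_gt0.
have [C HC] := phi_bound s b20.
rewrite /prop_for /continuous_at -[nbhs p](withinET (F := nbhs p)).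
apply: (@Rintegral_within_cvg _ _ _ mu D _ setT p (phi s) (phi s p) C) => //.
  rewrite near_withinE; near=> q => _; split => // x Dx; apply: HC => // i.
  have [_ /(_ ord0 i)] : ball p (b / 2) q by near: q; exact: nbhsx_ballx.
  by have := bp i; rewrite /ball/= ltr_norml => ? /andP[? ?]; lra.
move=> x Dx; rewrite withinET; apply: (@cvgM _ _ (nbhs p)); first exact: cvg_cst.
apply: (@continuous_comp _ _ _ (fun q : 'rV[R]_n => - \sum_(i < n) q ord0 i * y i x) expR p);
  last exact: continuous_expR.
apply: (@cvgN _ _ _ (nbhs p)); apply: (cvgr_sum (F := nbhs p)) => i.
apply: (@cvgMr_tmp _ _ (nbhs p)); exact: (@coord_continuous R 1 n ord0 i p).
Unshelve. all: by end_near. Qed.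

Let phi_shift s p l (h : R) x :
  phi s (h *: delta_mx ord0 l + p) x = phi s p x * expR (- (h * y l x)).
Proof.
rewrite /phi -mulrA -expRD -opprD; congr (_ * expR (- _)).
under eq_bigr do rewrite !mxE mulrDl; rewrite big_split/= addrC; congr (_ + _).
rewrite (bigD1 l)//= !eqxx mulr1 big1 ?addr0// => i /negPf il.
by rewrite il ?andbF mulr0 mul0r.
Qed.

Lemma is_derive_laplace s p l : (forall i, 0 < p ord0 i) ->
  is_derive p (delta_mx ord0 l) (laplace s) (laplace (l :: s) p).
Proof.
move=> p0; have [b b0 bp] := pos_lower_bound p0.
have b20 : 0 < b / 2 by rewrite divr_gt0.
have [C HC] := phi_bound (l :: s) b20.
pose v : 'rV[R]_n := delta_mx ord0 l.
pose f (h : R) (x : Y) : R := h^-1 * (phi s (h *: v + p) x - phi s p x).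
have posh (h : R) : `|h| < b / 2 -> forall i, b / 2 <= (h *: v + p) ord0 i.
  move=> + i; rewrite ltr_norml => /andP[h1 h2]; rewrite !mxE eqxx /=.
  by have := bp i; case: (i == l) => /=; rewrite ?mulr1 ?mulr0; lra.
suff H : h^-1 *: ((laplace s \o shift p) (h *: v) - laplace s p) @[h --> 0^'] -->
    laplace (l :: s) p.
  by apply: DeriveDef; [exact: cvgP H|exact: cvg_lim H].
apply: (@cvg_trans _ ((\int[mu]_(x in D) f h x)%R @[h --> 0^'])).
  apply: near_eq_cvg; near=> h.
  have hb : `|h| < b / 2 by near: h; apply: dnbhs0_lt.
  have ih : mu.-integrable D (EFin \o phi s (h *: v + p)).
    by apply: iphi => i; apply: lt_le_trans (posh h hb i).
  rewrite /f RintegralZl//; last by have := integrableB mD ih (iphi s p0); apply: eq_integrable.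
  by rewrite (RintegralB mD ih (iphi s p0)).
apply: (@Rintegral_within_cvg _ _ _ mu D R (fun h => h != 0) 0 f (phi (l :: s) p) C) => //.
  rewrite near_withinE; near=> h => h0; split.
    by apply: measurable_funM => //; exact: measurable_funB.
  have hb : `|h| < b / 2 by near: h; apply: (@nbhs0_lt R R).
  move=> x Dx.
  (* By [expR_sub1_le] the quotient is dominated, for either sign of [h], by the differentiated
     integrand at the point moved by [|h|] towards the face; that point keeps the distance [b / 2]
     from all faces, where [C] applies. *)
  apply: (@le_trans _ _ `|phi (l :: s) ((- `|h|) *: v + p) x|); last first.
    by apply: HC => //; apply: posh; rewrite normrN normr_id.
  rewrite /f /v (phi_shift s p l h x) (phi_shift (l :: s) p l (- `|h|) x).
  have : `|phi (l :: s) p x| = y l x * `|phi s p x|.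
    by rewrite /phi big_cons -mulrA normrM normrN (ger0_norm (y0 l Dx)).
  move: (phi s p x) (phi (l :: s) p x) => P1 P2 P2E.
  rewrite mulNr opprK -[X in _ - X]mulr1 -mulrBr !normrM P2E.
  rewrite (ger0_norm (expR_ge0 (`|h| * _))) normfV ler_pdivrMl ?normr_gt0//.
  have := expR_sub1_le (- (h * y l x)); rewrite normrN normrM (ger0_norm (y0 l Dx)) => e.
  apply: le_trans (ler_wpM2l (normr_ge0 _) e) _.
  by rewrite le_eqVlt; apply/orP; left; apply/eqP; ring.
move=> x Dx.
have [d1 d2] : is_derive (0 : R) 1 (fun h : R => expR (- (h * y l x))) (- y l x).
  have g1 : is_derive (0 : R) 1 (fun h : R => - (h * y l x)) (- y l x).
    by apply: is_derive_eq; rewrite scaler0 add0r /GRing.scale/= mulr1.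
  have g2 : is_derive (- (0 * y l x)) 1 expR (expR (- (0 * y l x))) by exact: is_derive_expR.
  have := @is_derive1_comp R expR (fun h : R => - (h * y l x)) 0 _ _ g2 g1.
  by rewrite mul0r oppr0 expR0 mul1r.
have c : h^-1 *: (expR (- ((h *: 1 + 0) * y l x)) - expR (- (0 * y l x))) @[h --> (0 : R)^'] --> - y l x.
  by rewrite -d2; exact: d1.
have -> : phi (l :: s) p x = phi s p x * (- y l x) by rewrite /phi big_cons -mulrA mulrC.
rewrite (_ : f ^~ x = fun h => phi s p x *
    (h^-1 *: (expR (- ((h *: 1 + 0) * y l x)) - expR (- (0 * y l x))))).
  exact: cvgMl_tmp c.
apply/funext => h; rewrite /f /v phi_shift addr0 /GRing.scale/= mulr1 mul0r oppr0 expR0.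
move: (phi s p x) => P; ring.
Unshelve. all: by end_near. Qed.

End laplace_transform.

(** A multi-index spelled out as a list of single derivatives, the form used by [smooth_on] and
    [laplace]. *)
Definition coords n (beta : 'I_n -> nat) (s : seq 'I_n) : seq 'I_n :=
  flatten [seq nseq (beta i) i | i <- s].

Lemma multi_partialE (R : realType) n (beta : 'I_n -> nat) (f : 'rV[R]_n -> R) :
  multi_partial beta f = foldr (@partial R n) f (coords beta (enum 'I_n)).
Proof.
rewrite /multi_partial /coords; elim: (enum _) => //= i s ->; rewrite foldr_cat.
by elim: (beta i) => //= k ->.
Qed.

Lemma size_coords n (beta : 'I_n -> nat) :
  size (coords beta (enum 'I_n)) = (\sum_(i < n) beta i)%N.
Proof.
rewrite size_flatten /shape -map_comp sumnE big_map big_enum /=.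
by apply: eq_bigr => i _; rewrite size_nseq.
Qed.

Lemma near_interior_orthant (R : realType) n (p : 'rV[R]_n) : (orthant n)° p ->
  \forall q \near p, (orthant n)° q.
Proof. by move=> Up; apply: (open_nbhs_nbhs (conj (@open_interior _ _) Up)). Qed.

Section laplace_completely_monotone.
Context {R : realType} {n : nat} d (Y : measurableType d) (mu : {measure set Y -> \bar R}).
Variables (D : set Y) (y : 'I_n -> Y -> R).
Hypotheses (mD : measurable D) (fin_mu : (mu D < +oo)%E).
Hypotheses (my : forall i, measurable_fun D (y i)) (y0 : forall i x, D x -> 0 <= y i x).
Variable (F : 'rV[R]_n -> R).
Hypothesis FE : forall p, (orthant n)° p -> F p = laplace mu D y [::] p.

Lemma foldr_partial_laplace s p : (orthant n)° p ->
  foldr (@partial R n) F s p = laplace mu D y s p.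
Proof.
elim: s p => [|l s IH] p Up; first exact: FE.
have E : {near p, foldr (@partial R n) F s =1 laplace mu D y s}.
  by apply: filterS (near_interior_orthant Up) => q Uq; exact: IH.
rewrite /= /partial (near_eq_derive _ E).
have [_ ->//] := is_derive_laplace mD fin_mu my y0 s l ((interior_orthantE p).1 Up).
Qed.

Lemma completely_monotone_laplace : completely_monotone F.
Proof.
split=> [s p Up|beta p Up].
  have E : {near p, laplace mu D y s =1 foldr (@partial R n) F s}.
    by apply: filterS (near_interior_orthant Up) => q Uq; exact/esym/foldr_partial_laplace.
  have p0 := (interior_orthantE p).1 Up.
  split=> [|i].
    rewrite /prop_for /continuous_at foldr_partial_laplace//.
    exact: (cvg_trans (near_eq_cvg E) (continuous_laplace (s := s) mD fin_mu my y0 p0)).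
  apply: near_eq_derivable E _.
  by have [] := is_derive_laplace mD fin_mu my y0 s i p0.
rewrite multi_partialE foldr_partial_laplace//.
rewrite -size_coords; move: (coords _ _) => s.
have sgn x : (-1) ^+ size s * (\prod_(l <- s) - y l x) = \prod_(l <- s) y l x.
  elim: s => [|l s IH]; first by rewrite !big_nil mulr1.
  by rewrite !big_cons exprS -IH /=; ring.
rewrite /laplace -RintegralZl//; last first.
  by apply: integrable_laplace => //; exact: (interior_orthantE p).1.
apply: Rintegral_ge0 => x Dx; rewrite mulrA sgn mulr_ge0 ?expR_ge0//.
by apply: prodr_ge0 => l _; exact: y0.
Qed.
End laplace_completely_monotone.

(** * The direct implication *)

Lemma convex_functionP (R : realType) (E : lmodType R) (D : set E) (f : E -> R) :
  convex_function (D : set (convex_lmodType E)) f <->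
  forall (t : R) (x y : E), D x -> D y -> 0 <= t -> t <= 1 ->
    f (t *: x + (1 - t) *: y) <= t * f x + (1 - t) * f y.
Proof.
split=> [cf t x y Dx Dy t0 t1|cf t x y /set_mem Dx /set_mem Dy].
  have := cf (Itv01 t0 t1) x y; rewrite !inE convRE /= => h; exact: h.
rewrite convRE; exact: cf.
Qed.

Section necessity.
Context {R : realType} {n : nat} (alpha : R) (Pi : 'rV[R]_n -> R -> R)
  (mu : {measure set (borel_rV R n) -> \bar R}).
Hypotheses (alpha_gt0 : 0 < alpha) (alpha_le1 : alpha <= 1).
Hypothesis (supp_mu : supported_in mu (orthant n)).
Hypothesis (mu0 : mu [set (0 : 'rV[R]_n)] = 0%E).
Hypothesis PiE : forall p p0, orthant n p -> 0 < p0 -> (Pi p p0)%:E = profit alpha mu p p0.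

Let O : set (borel_rV R n) := orthant n.
Let mO : measurable O. Proof. exact: measurable_orthant. Qed.

(** At zero prices and [p0 = 1] the gain is identically 1, so the total mass is the real number
    [Pi 0 1]. *)
Lemma representing_measure_finite : (mu (orthant n) < +oo)%E.
Proof.
have O0 : orthant n (0 : 'rV[R]_n) by move=> i; rewrite mxE.
suff <- : (Pi 0 1)%:E = mu O by exact: ltry.
rewrite (PiE O0 ltr01) /profit.
under eq_integral do rewrite odot0l// subr0 (max_idPr ler01).
by rewrite integral_cst// mul1e.
Qed.
Let fin_mu := representing_measure_finite.

Let PiR p t : orthant n p -> 0 < t -> Pi p t = Rprofit alpha mu p t.
Proof. by move=> Op t0; apply: EFin_inj; rewrite PiE// profitE// ltW. Qed.

Lemma representation_convex :
  convex_function (price_domain n) (fun z : 'rV[R]_n * R^o => Pi z.1 z.2).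
Proof.
apply/convex_functionP => t [p a] [q b] [/= Op +] [/= Oq +] t0 t1; rewrite !in_itv/= !andbT => a0 b0.
have s0 : 0 <= 1 - t by rewrite subr_ge0.
have Or : orthant n (t *: p + (1 - t) *: q).
  by move=> i; rewrite !mxE addr_ge0 ?mulr_ge0.
have c0 : 0 < t * a + (1 - t) * b.
  have [->|t_neq0] := eqVneq t 0; first by rewrite mul0r add0r subr0 mul1r.
  apply: ltr_pwDl; last by rewrite mulr_ge0// ltW.
  by rewrite mulr_gt0// lt_neqAle eq_sym t_neq0.
rewrite !PiR//; apply: Rprofit_convex => //; exact: ltW.
Qed.

Lemma representation_continuous :
  {within price_domain n, continuous (fun z : 'rV[R]_n * R => Pi z.1 z.2)}.
Proof.
apply/subspace_continuousP => -[p t] [/= Op]; rewrite in_itv/= andbT => t0.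
have := cvg_Rprofit alpha_gt0 fin_mu Op t0; rewrite -(PiR Op t0); apply: cvg_trans.
apply: near_eq_cvg; rewrite near_withinE; apply: nearW => -[q s] [/= Oq].
by rewrite in_itv/= andbT => s0; exact: esym (PiR Oq s0).
Qed.

Lemma representation_homogeneous p (p0 l : R) :
  orthant n p -> 0 < p0 -> 0 < l -> Pi (l *: p) (l * p0) = l * Pi p p0.
Proof.
move=> Op t0 l0; rewrite !PiR ?mulr_gt0 ?RprofitZ ?ltW//.
by move=> i; rewrite mxE mulr_ge0// ltW.
Qed.

Lemma rderive_representation p (t : R) : orthant n p -> 0 < t ->
  rderive (Pi p) t = odot_cdf alpha mu p t.
Proof.
move=> Op t0; apply: cvg_lim => //.
apply: cvg_trans (cvg_Rprofit_slope (alpha := alpha) fin_mu (p := p) (ltW t0)).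
by apply: near_eq_cvg; near=> h; rewrite !PiR// addr_gt0.
Unshelve. all: by end_near. Qed.

Lemma representation_at0 p : (orthant n)° p ->
  Pi p p0 @[p0 --> 0^'+] --> 0 /\ rderive (Pi p) p0 @[p0 --> 0^'+] --> 0.
Proof.
move=> Up; have p0 := (interior_orthantE p).1 Up; have Op : orthant n p := interior_subset Up.
split.
  apply: cvg_trans (cvg_Rprofit0 alpha fin_mu p); apply: near_eq_cvg.
  by near=> t; rewrite PiR.
rewrite -[X in _ --> X](odot_cdf0 alpha_gt0 fin_mu supp_mu mu0 p0).
apply: cvg_trans (right_continuous_odot_cdf (alpha := alpha) fin_mu (p := p) (t := 0)).
apply: near_eq_cvg.
by near=> t; rewrite rderive_representation.
Unshelve. all: by end_near. Qed.

(** The domain excludes the points with [odot alpha q x = 0], as the Stieltjes integral over the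
    open half-line does. For interior [q] this removes only null sets and the result is a Laplace
    transform; on the faces it may be smaller. *)
Definition exp_odot_integral q : R :=
  (\int[mu]_(x in (odot alpha q @^-1` `]0, +oo[ : set (borel_rV R n)))
     expR (- (odot alpha q x `^ alpha)))%R.

Let m_odot q (E : set R) : measurable E -> measurable (odot alpha q @^-1` E : set (borel_rV R n)).
Proof. by move=> mE; rewrite -[_ @^-1` _]setTI; apply: measurable_odot. Qed.

Let muT : (mu setT < +oo)%E.
Proof.
rewrite (measureDI mu measurableT mO) setTI [X in (X + _)%E](_ : _ = 0%E).
  by rewrite add0e; exact: fin_mu.
by rewrite setTD; exact: supp_mu.
Qed.

Let fin_sub (A : set (borel_rV R n)) : measurable A -> (mu A < +oo)%E.
Proof.
move=> mA; apply: le_lt_trans muT.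
by apply: le_measure; rewrite ?inE//; exact: measurableT.
Qed.

Let m_exp q : measurable_fun setT (fun x : borel_rV R n => expR (- (odot alpha q x `^ alpha))).
Proof.
apply: measurableT_comp => //; apply: measurableT_comp => //.
apply: (measurableT_comp (measurable_powR alpha)); exact: measurable_odot.
Qed.

Let exp_le1 q (x : 'rV[R]_n) : `|expR (- (odot alpha q x `^ alpha))| <= 1.
Proof. by rewrite ger0_norm ?expR_ge0// -expR0 ler_expR oppr_le0 powR_ge0. Qed.

Let int_exp q (A : set (borel_rV R n)) : measurable A ->
  mu.-integrable A (EFin \o (fun x : borel_rV R n => expR (- (odot alpha q x `^ alpha)))).
Proof.
move=> mA; apply: (@bounded_integrable _ _ _ mu A _ 1) => //; first exact: fin_sub.
exact: measurable_funTS.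
Qed.

Lemma stieltjes_integral_representation q : orthant n q ->
  is_stieltjes_integral (rderive (Pi q)) (fun tau => expR (- tau `^ alpha)) (exp_odot_integral q).
Proof.
move=> Oq.
pose Gm := isCumulative.Build R _ R (odot_cdf alpha mu q)
  (nondecreasing_odot_cdf alpha fin_mu q) (@right_continuous_odot_cdf _ _ alpha _ fin_mu q).
pose G : cumulative R R := HB.pack (odot_cdf alpha mu q) Gm.
exists G; split=> [t t0|]; first by rewrite rderive_representation.
rewrite (@ge0_integral_lebesgue_stieltjes _ _ _ mu (odot alpha q : borel_rV R n -> R) G
  `]0, +oo[%classic (fun tau => expR (- tau `^ alpha))) => //.
- have mA := m_odot q (measurable_itv `]0, +oo[).
  by rewrite /exp_odot_integral /Rintegral fineK//; apply: (integrable_fin_num mA); exact: int_exp.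
- exact: measurable_odot.
- by move=> a b ab; exact: mu_odot_itv.
- apply: measurableT_comp => //; apply: measurableT_comp => //; exact: measurable_powR.
Qed.

Lemma bounded_stieltjes_integral :
  [bounded exp_odot_integral (powR_rV alpha^-1 p) | p in orthant n].
Proof.
have bI q : orthant n q -> `|exp_odot_integral q| <= fine (mu setT).
  move=> Oq.
  have mA := m_odot (q) (measurable_itv `]0, +oo[).
  apply: le_trans (le_normr_Rintegral mA (int_exp _ mA)) _.
  apply: (@le_trans _ _ (\int[mu]_(x in odot alpha (q) @^-1` `]0, +oo[ ) 1)%R).
    apply: le_Rintegral => //.
    - by apply: (@bounded_integrable _ _ _ mu _ _ 1) => //; [exact: fin_sub|exact: measurableT_comp (measurable_funTS (m_exp _))|move=> x _; rewrite normr_id].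
    - by apply: (@bounded_integrable _ _ _ mu _ (cst 1) 1) => //; [exact: fin_sub|move=> x _; rewrite normr1].
  rewrite Rintegral_cst// mul1r fine_le//.
  - by rewrite ge0_fin_numE//; exact: fin_sub.
  - by rewrite ge0_fin_numE.
  - by apply: le_measure; rewrite ?inE//; exact: measurableT.
rewrite /bounded_near; near=> M; move=> p Op /=; apply: le_trans (bI (powR_rV alpha^-1 p) _) _.
  by move=> i; rewrite mxE powR_ge0.
by near: M; exact: nbhs_pinfty_ge.
Unshelve. all: by end_near. Qed.

Lemma completely_monotone_stieltjes_integral :
  completely_monotone (fun p => exp_odot_integral (powR_rV alpha^-1 p)).
Proof.
apply: (@completely_monotone_laplace R n _ _ mu O (fun i x => x ord0 i `^ alpha)) => //.
- by move=> i; apply: (measurableT_comp (measurable_powR alpha)); apply: measurable_funTS; exact: measurable_coord.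
- by move=> i x Ox; exact: powR_ge0.
move=> p Up; have p0 := (interior_orthantE p).1 Up; have Op : orthant n p := interior_subset Up.
pose q := powR_rV alpha^-1 p.
have q0 i : 0 < q ord0 i by rewrite mxE powR_gt0.
rewrite /exp_odot_integral /laplace /Rintegral; congr fine.
pose A : set (borel_rV R n) := odot alpha q @^-1` `]0, +oo[.
have mA : measurable A by exact: m_odot.
(* For interior [q] the sets [A] and [O] differ only within this null set; this uses both the
   support condition and the absence of mass at 0. *)
pose N : set (borel_rV R n) := ~` O `|` [set 0].
have mN : measurable N by apply: measurableU; [exact: measurableC|exact: measurable_rV_set1].
have N0 : mu N = 0%E by apply: null_set_setU => //; [exact: measurableC|exact: measurable_rV_set1].
rewrite (ge0_negligible_integral mN mA)//; first last.
- by apply/measurable_EFinP; apply: measurable_funTS; exact: m_exp.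
rewrite (_ : A `\` N = O `\` [set 0]); last first.
  apply/seteqP; split => x.
    move=> [_ Nx]; split; first by apply: contrapT => nO; apply: Nx; left.
  by move=> x0; apply: Nx; right.
  move=> [Ox x0]; split; last by case.
  rewrite /A/= in_itv/= andbT lt_neqAle odot_ge0 andbT eq_sym; apply/eqP => q0x.
  exact/x0/(odot_eq0 alpha_gt0 Ox q0).
rewrite [RHS](_ : _ = (\int[mu]_(x in O) (expR (- (odot alpha q x `^ alpha)))%:E)%E); last first.
  apply: eq_integral => x /set_mem Ox; rewrite big_nil mul1r.
  by rewrite odot_powR_rV.
rewrite [RHS](ge0_negligible_integral (measurable_rV_set1 0) mO _ _ mu0)//.
by apply/measurable_EFinP; apply: measurable_funTS; exact: m_exp.
Qed.

End necessity.

(** * Finite differences of completely monotone functions *)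

Section finite_differences.
Context {R : realType} {n : nat} (h : R).
Hypothesis h0 : 0 < h.
Implicit Types (f g : 'rV[R]_n -> R) (p : 'rV[R]_n) (s : seq 'I_n).

Definition shiftl (l : 'I_n) f p : R := f (p + h *: delta_mx ord0 l).

Definition diffl (l : 'I_n) f p : R := f p - shiftl l f p.

(** Complete monotonicity at mesh [h]: since [diffl] is the negated forward difference, the
    alternating signs are built in. *)
Definition alternating f := forall s p, (orthant n)° p -> 0 <= foldr diffl f s p.

Lemma interior_orthant_shift l p (t : R) : 0 <= t -> (orthant n)° p ->
  (orthant n)° (p + t *: delta_mx ord0 l).
Proof.
move=> t0 /interior_orthantE p0; apply/interior_orthantE => i.
by rewrite !mxE ltr_pwDl// mulr_ge0.
Qed.

Lemma diffl_shiftl l k f : diffl l (shiftl k f) = shiftl k (diffl l f).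
Proof. by apply/funext => p; rewrite /diffl /shiftl addrAC. Qed.

Lemma difflC l k f : diffl l (diffl k f) = diffl k (diffl l f).
Proof.
apply/funext => p; rewrite /diffl /shiftl [p + _ + _]addrAC; ring.
Qed.

Lemma foldr_diffl_shiftl s k f : foldr diffl (shiftl k f) s = shiftl k (foldr diffl f s).
Proof. by elim: s => //= l s ->; rewrite diffl_shiftl. Qed.

Lemma diffl_foldr s l f : diffl l (foldr diffl f s) = foldr diffl (diffl l f) s.
Proof. by elim: s => //= k s <-; rewrite difflC. Qed.

Lemma foldr_diffl_filter (a : pred 'I_n) s f :
  foldr diffl f s = foldr diffl (foldr diffl f (seq.filter a s)) (seq.filter (predC a) s).
Proof.
elim: s => //= l s ->; case: ifP => al //=.
by rewrite diffl_foldr.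
Qed.

Lemma alternating_shiftl l f : alternating f -> alternating (shiftl l f).
Proof.
by move=> af s p Up; rewrite foldr_diffl_shiftl; apply/af/interior_orthant_shift; rewrite ?ltW.
Qed.

Lemma alternating_diffl l f : alternating f -> alternating (diffl l f).
Proof. by move=> af s p Up; rewrite -diffl_foldr; exact: (af (l :: s)). Qed.

Lemma alternatingZ (c : R) f : 0 <= c -> alternating f -> alternating (fun p => c * f p).
Proof.
move=> c0 af s p Up; suff -> : foldr diffl (fun p => c * f p) s = fun p => c * foldr diffl f s p.
  by rewrite mulr_ge0// af.
elim: s => //= l s ->; apply/funext => q; rewrite /diffl /shiftl; ring.
Qed.

Lemma nonincreasing_partial g l p (t : R) : 0 <= t -> (orthant n)° p ->
  (forall q, (orthant n)° q -> derivable g q (delta_mx ord0 l)) ->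
  (forall q, (orthant n)° q -> partial l g q <= 0) ->
  g (p + t *: delta_mx ord0 l) <= g p.
Proof.
move=> t0 Up dg g_le0; pose v : 'rV[R]_n := delta_mx ord0 l.
pose phi (u : R) := g (p + u *: v).
have quot u : (fun e : R => e^-1 *: ((phi \o shift u) (e *: 1) - phi u)) =
   (fun e : R => e^-1 *: ((g \o shift (p + u *: v)) (e *: v) - g (p + u *: v))).
  apply/funext => e; rewrite /= /phi; congr (_ *: (g _ - _)).
  by have -> : e *: (1 : R) = e := mulr1 e; rewrite scalerDl addrCA.
have dphi u : 0 <= u -> derivable phi u 1.
  by move=> u0; rewrite /derivable quot; apply/dg/interior_orthant_shift.
have cphi : {within `[0, t], continuous phi}.
  by apply: derivable_within_continuous => u; rewrite in_itv/= => /andP[u0 _]; exact: dphi.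
have := @ler0_derive1_le_cc R phi 0 t _ _ cphi t 0.
rewrite !in_itv/= !lexx t0 /phi scale0r addr0; apply => //.
  by move=> u; rewrite in_itv/= => /andP[/ltW u0 _]; exact: dphi.
move=> u; rewrite in_itv/= => /andP[/ltW u0 _].
rewrite derive1E /derive quot; exact/g_le0/interior_orthant_shift.
Qed.

Let U : set 'rV[R]_n := (orthant n)°.

Lemma partial_shiftl k l f : partial k (shiftl l f) = shiftl l (partial k f).
Proof.
apply/funext => p; rewrite /shiftl /partial /derive.
rewrite (_ : (fun e : R => _) = (fun e : R => e^-1 *: ((f \o shift (p + h *: delta_mx ord0 l))
  (e *: delta_mx ord0 k) - f (p + h *: delta_mx ord0 l))))//.
by apply/funext => e; rewrite /= addrA.
Qed.

Let derivable_shiftl l f p v :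
  derivable f (p + h *: delta_mx ord0 l) v -> derivable (shiftl l f) p v.
Proof.
rewrite /derivable (_ : (fun e : R => e^-1 *: ((shiftl l f \o shift p) (e *: v) - shiftl l f p)) =
  (fun e : R => e^-1 *: ((f \o shift (p + h *: delta_mx ord0 l)) (e *: v) -
     f (p + h *: delta_mx ord0 l))))//.
by apply/funext => e; rewrite /shiftl /= addrA.
Qed.

Let derivable_diffl l f p v : derivable f p v ->
  derivable f (p + h *: delta_mx ord0 l) v -> derivable (diffl l f) p v.
Proof. by move=> d1 d2; apply: derivableB => //; exact: derivable_shiftl. Qed.

Lemma foldr_partial_diffl l f s p : smooth_on U f -> U p ->
  foldr (@partial R n) (diffl l f) s p = diffl l (foldr (@partial R n) f s) p.
Proof.
move=> sf; elim: s p => //= k s IH p Up.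
have E : {near p, foldr (@partial R n) (diffl l f) s =1 diffl l (foldr (@partial R n) f s)}.
  by apply: filterS (near_interior_orthant Up) => q Uq; exact: IH.
have Up' := interior_orthant_shift l (ltW h0) Up.
rewrite {1}/partial (near_eq_derive _ E).
rewrite [LHS]deriveB; [|exact: (sf s p Up).2|exact/derivable_shiftl/(sf s _ Up').2].
by rewrite /diffl -partial_shiftl.
Qed.

Lemma smooth_on_diffl l f : smooth_on U f -> smooth_on U (diffl l f).
Proof.
move=> sf s p Up.
have Up' := interior_orthant_shift l (ltW h0) Up.
have E : {near p, diffl l (foldr (@partial R n) f s) =1 foldr (@partial R n) (diffl l f) s}.
  by apply: filterS (near_interior_orthant Up) => q Uq; exact/esym/foldr_partial_diffl.
split=> [|i].
  rewrite /prop_for /continuous_at foldr_partial_diffl//.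
  apply: (cvg_trans (near_eq_cvg E)); apply: (@cvgB _ _ _ (nbhs p)); first exact: (sf s p Up).1.
  apply: (@continuous_comp _ _ _ (fun q : 'rV[R]_n => q + h *: delta_mx ord0 l)
    (foldr (@partial R n) f s) p); last exact: (sf s _ Up').1.
  by apply: (@cvgD _ _ _ (nbhs p)); [exact: cvg_id|exact: cvg_cst].
apply: near_eq_derivable E _; apply: derivable_diffl; [exact: (sf s p Up).2|exact: (sf s _ Up').2].
Qed.

(** An induction invariant: the sign condition for partials along the coordinates of [L] only, taken
    in the order of [L] with the head outermost. One more derivative along the head is then again of
    this form, with the opposite sign. *)
Definition signed_partials (L : seq 'I_n) f := forall beta p, U p ->
  0 <= (-1) ^+ size (coords beta L) * foldr (@partial R n) f (coords beta L) p.

(** Each signed partial [sg * G] has a nonpositive derivative along [l], so it decreases from [p] to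
    [p + h e_l], and its [diffl] is nonnegative. *)
Lemma signed_partials_diffl l L f : uniq (l :: L) -> smooth_on U f ->
  signed_partials (l :: L) f -> signed_partials (l :: L) (diffl l f).
Proof.
move=> /=/andP[lL uL] sf cmf beta p Up; rewrite foldr_partial_diffl//.
set c := coords _ _; set sg := (-1) ^+ _; set G := foldr _ _ _.
have [dG dG'] : (forall q, U q -> derivable G q (delta_mx ord0 l)) /\
    (forall q, U q -> partial l (sg \*: G) q <= 0).
  split=> [q Uq|q Uq]; first exact: (sf c q Uq).2.
  rewrite /partial deriveZ; last exact: (sf c q Uq).2.
  pose beta' i := if i == l then (beta i).+1 else beta i.
  have cE : coords beta' (l :: L) = l :: c.
    rewrite /c /coords /= /beta' eqxx /=; congr (_ :: _ ++ flatten _).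
    by apply/eq_in_map => i iL; case: eqP => // il; rewrite -il iL in lL.
  have := cmf beta' q Uq; rewrite cE /= exprS mulN1r mulNr oppr_ge0.
  exact.
rewrite /diffl mulrBr subr_ge0.
apply: (@nonincreasing_partial (sg \*: G) l p h) => //; first exact: ltW.
by move=> q Uq; apply: derivableZ; exact: dG.
Qed.

(** Differences commute, so those along the head of [L] are carried out first; they preserve the
    invariant. Afterwards that coordinate no longer occurs in [s] and is dropped from [L] by taking
    multi-indices that vanish there. *)
Lemma signed_partials_alternating L f s : uniq L -> smooth_on U f ->
  signed_partials L f -> {subset s <= L} -> forall p, U p -> 0 <= foldr diffl f s p.
Proof.
elim: L f s => [|l L IH] f s uL sf cmf sL p Up.
  case: s sL => [_|k s /(_ k)]; last by rewrite inE eqxx => /(_ isT).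
  by have := cmf (fun=> 0%N) p Up; rewrite /= mul1r.
rewrite (foldr_diffl_filter (pred1 l)).
have [sg cmg] : smooth_on U (foldr diffl f (seq.filter (pred1 l) s)) /\
    signed_partials (l :: L) (foldr diffl f (seq.filter (pred1 l) s)).
  elim: s {sL} => //= k s [sg cmg]; case: ifP => //= /eqP ->.
  by split; [exact: smooth_on_diffl|exact: signed_partials_diffl].
apply: IH => //; first by case/andP: uL.
  move=> beta q Uq; pose beta' i := if i == l then 0%N else beta i.
  have := cmg beta' q Uq; suff -> : coords beta' (l :: L) = coords beta L by [].
  rewrite /coords /= /beta' eqxx /=; congr flatten.
  by apply/eq_in_map => i iL; case: eqP => // il; case/andP: uL; rewrite -il iL.
move=> k; rewrite mem_filter /= => /andP[kl /sL]; rewrite inE (negPf kl).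
exact.
Qed.

Lemma completely_monotone_alternating f : completely_monotone f -> alternating f.
Proof.
move=> [sf cm] s p Up; apply: (@signed_partials_alternating (enum 'I_n)) => //.
- exact: enum_uniq.
- by move=> beta q Uq; rewrite size_coords -multi_partialE; exact: cm.
- by move=> k _; rewrite mem_enum.
Qed.

End finite_differences.

(** * Lattice values as approximate moments: Bernstein weights in the shift operators *)

Lemma bin_ffact_shift (D i j : nat) : (j <= i)%N -> (i <= D)%N ->
  ('C(D, i) * i ^_ j = D ^_ j * 'C(D - j, i - j))%N.
Proof.
(* Multiplied by the factorials of [i - j] and [D - i], both sides become the factorial of [D]. *)
move=> ji iD; apply/eqP; rewrite -(eqn_pmul2r (fact_gt0 (i - j))).
have -> : ('C(D, i) * i ^_ j * (i - j)`! = D ^_ i)%N by rewrite -mulnA ffact_fact// bin_ffact.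
rewrite -mulnA bin_ffact -(eqn_pmul2r (fact_gt0 (D - i))) ffact_fact// -mulnA.
have -> : (D - i = (D - j) - (i - j))%N by lia.
rewrite ffact_fact; last by lia.
by rewrite ffact_fact//; lia.
Qed.

Section ffact_ratio.
Context {R : realType}.

Lemma ffact_ratio_bounds (D i j : nat) : (i <= D)%N -> (j <= D)%N ->
  0 <= (i ^_ j)%:R / (D ^_ j)%:R :> R /\ (i ^_ j)%:R / (D ^_ j)%:R <= 1 :> R.
Proof.
move=> iD jD; have D0 : (0 : R) < (D ^_ j)%:R by rewrite ltr0n ffact_gt0.
rewrite divr_ge0//; split=> //; rewrite ler_pdivrMr// mul1r ler_nat.
by elim: j {jD D0} => // j IH; rewrite !ffactnSr leq_mul// leq_sub2r.
Qed.

(* Hence [f (p + j h e_l)], the [j]-th factorial moment of the binomial weights of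
   [bernstein_split], is nearly their [j]-th power moment at the nodes [i / D]. *)
Lemma ffact_ratio_approx (D i j : nat) : (i <= D)%N -> (j <= D)%N -> (0 < D)%N ->
  `|(i ^_ j)%:R / (D ^_ j)%:R - (i%:R / D%:R) ^+ j| <= j%:R ^+ 2 / D%:R :> R.
Proof.
move=> iD + D0; have D0R : (0 : R) < D%:R by rewrite ltr0n.
elim: j => [|j IH] jD.
  by rewrite !ffactn0 expr0 divr1 subrr normr0 divr_ge0.
have [a0 a1] := ffact_ratio_bounds iD (ltnW jD).
have {}IH := IH (ltnW jD).
rewrite !ffactnSr !natrM exprS.
have DjR : (0 : R) < (D - j)%:R by rewrite ltr0n subn_gt0.
have Dj0 : (0 : R) < (D ^_ j)%:R by rewrite ltr0n ffact_gt0 ltnW.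
rewrite -mulf_div; set a := (i ^_ j)%:R / _ in a0 a1 IH *.
set b := (i - j)%:R / _; set c := (i%:R / D%:R) ^+ j in IH *; set d := i%:R / D%:R.
have d01 : 0 <= d <= 1 by rewrite /d divr_ge0//= ler_pdivrMr// mul1r ler_nat.
have bd : `|b - d| <= j%:R / D%:R.
  have [ji|ij] := leqP j i; last first.
    (* For [i < j] truncated subtraction makes [b] zero, and [d = i / D] is itself below [j / D]. *)
    rewrite /b (_ : (i - j)%N = 0%N); last by lia.
    rewrite mul0r sub0r normrN ger0_norm; last by case/andP: d01.
    by rewrite ler_pM2r ?invr_gt0// ler_nat ltnW.
  have DE : d - b = (j%:R / D%:R) * ((D - i)%:R / (D - j)%:R).
    have nz1 : (D%:R : R) != 0 by rewrite gt_eqF.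
    have nz2 : (D%:R - j%:R : R) != 0 by rewrite -natrB ?gt_eqF// ltnW.
    by rewrite /d /b !natrB ?(ltnW jD)//; field; rewrite nz1 nz2.
  have [r0 r1] : 0 <= (D - i)%:R / (D - j)%:R :> R /\ (D - i)%:R / (D - j)%:R <= 1 :> R.
    by rewrite divr_ge0//; split=> //; rewrite ler_pdivrMr// mul1r ler_nat leq_sub2l.
  have jD0 : 0 <= j%:R / D%:R :> R by rewrite divr_ge0.
  rewrite distrC DE ger0_norm; last by rewrite mulr_ge0.
  by rewrite ler_piMr.
have /andP[d0 d1] := d01; clear DjR Dj0 d01; clearbody a b c d.
(* The new factor costs [j / D] and the old error is not amplified since [d <= 1]; the induction
   closes because [j + j^2 <= (j + 1)^2]. *)
have -> : a * b - d * c = a * (b - d) + d * (a - c) by ring.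
apply: (le_trans (ler_normD _ _)); rewrite !normrM (ger0_norm a0).
rewrite (ger0_norm d0).
have h1 : a * `|b - d| <= j%:R / D%:R by apply: le_trans bd; rewrite ler_piMl.
have h2 : d * `|a - c| <= j%:R ^+ 2 / D%:R by apply: le_trans IH; rewrite ler_piMl.
apply: (le_trans (lerD h1 h2)); rewrite -mulrDl ler_pM2r ?invr_gt0//.
rewrite -natr1; have : (0 : R) <= j%:R by []. nra.
Qed.

End ffact_ratio.

Section discrete_approximation.
Context {R : realType} {n : nat} (h : R).
Hypothesis h0 : 0 < h.
Implicit Types (f g : 'rV[R]_n -> R) (p : 'rV[R]_n) (q : {poly R}).

Let U : set 'rV[R]_n := (orthant n)°.

(** This is [q(T) f] for the translation [T] by [h] along coordinate [l]. Polynomial identities thus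
    become operator identities, with ['X] acting as [shiftl] and [1 - 'X] as [diffl]. *)
Definition poly_shift l f q p : R :=
  \sum_(k < size q) q`_k * f (p + (k%:R * h) *: delta_mx ord0 l).

Let poly_shift_wide l f q p N : (size q <= N)%N ->
  poly_shift l f q p = \sum_(k < N) q`_k * f (p + (k%:R * h) *: delta_mx ord0 l).
Proof.
move=> qN; rewrite /poly_shift (big_ord_widen_cond _ xpredT (fun k : nat => q`_k * f (p + (k%:R * h) *: delta_mx ord0 l)) qN).
rewrite big_mkcond; apply: eq_bigr => k _; case: ltnP => // sk.
by rewrite nth_default ?mul0r.
Qed.

Lemma poly_shiftD l f q1 q2 p :
  poly_shift l f (q1 + q2) p = poly_shift l f q1 p + poly_shift l f q2 p.
Proof.
pose N := maxn (size q1) (size q2).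
rewrite !(@poly_shift_wide _ _ _ _ N) ?leq_maxl ?leq_maxr ?size_polyD//.
by rewrite -big_split/=; apply: eq_bigr => k _; rewrite coefD mulrDl.
Qed.

Lemma poly_shiftZ l f (c : R) q p : poly_shift l f (c *: q) p = c * poly_shift l f q p.
Proof.
rewrite (@poly_shift_wide _ _ _ _ (size q)) ?size_scale_leq// /poly_shift mulr_sumr.
by apply: eq_bigr => k _; rewrite coefZ mulrA.
Qed.

Lemma poly_shift0 l f p : poly_shift l f 0 p = 0.
Proof. by rewrite /poly_shift size_poly0 big_ord0. Qed.

Lemma poly_shift_sum l f p (I : Type) (r : seq I) (Q : I -> {poly R}) :
  poly_shift l f (\sum_(i <- r) Q i) p = \sum_(i <- r) poly_shift l f (Q i) p.
Proof.
by elim: r => [|i r IH]; rewrite ?big_nil ?poly_shift0// !big_cons poly_shiftD IH.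
Qed.

Lemma poly_shiftX l f q : poly_shift l f ('X * q) = shiftl h l (poly_shift l f q).
Proof.
apply/funext => p; have sX : (size ('X * q)%R <= (size q).+1)%N.
  by rewrite (leq_trans (size_polyMleq _ _))// size_polyX.
rewrite (poly_shift_wide _ _ _ sX) big_ord_recl coefXM eqxx mul0r add0r.
rewrite /shiftl /poly_shift; apply: eq_bigr => k _.
rewrite coefXM /= -addrA -scalerDl; congr (_ * f (p + _ *: _)).
by rewrite /bump leq0n add1n -natr1 mulrDl mul1r addrC.
Qed.

Lemma poly_shift1X l f q : poly_shift l f ((1 - 'X) * q) = diffl h l (poly_shift l f q).
Proof.
apply/funext => p; rewrite mulrBl mul1r -scaleN1r poly_shiftD poly_shiftZ poly_shiftX.
by rewrite mulN1r.
Qed.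

Lemma poly_shift_Xn l f j p : poly_shift l f ('X^j) p = f (p + (j%:R * h) *: delta_mx ord0 l).
Proof.
rewrite /poly_shift size_polyXn big_ord_recr/= coefXn eqxx mul1r big1 ?add0r// => k _.
by rewrite coefXn ltn_eqF ?mul0r.
Qed.

Lemma alternating_poly_shift l f (a b : nat) : alternating h f ->
  alternating h (poly_shift l f ((1 - 'X) ^+ a * 'X^b)).
Proof.
move=> af; elim: a => [|a IH].
  rewrite mul1r; elim: b => [|b IH].
    rewrite (_ : poly_shift _ _ _ = f)//; apply/funext => p.
    by rewrite poly_shift_Xn mul0r scale0r addr0.
  by rewrite exprS poly_shiftX; exact: alternating_shiftl.
by rewrite exprS -mulrA poly_shift1X; exact: alternating_diffl.
Qed.

Lemma bernstein_split l f (D : nat) : (0 < D)%N -> alternating h f ->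
  exists w : 'I_D.+1 -> 'rV[R]_n -> R,
  [/\ forall i, alternating h (w i),
      forall p, \sum_(i < D.+1) w i p = f p &
      forall p j, U p -> (j <= D)%N ->
        `|f (p + (j%:R * h) *: delta_mx ord0 l) - \sum_(i < D.+1) (i%:R / D%:R) ^+ j * w i p|
        <= j%:R ^+ 2 / D%:R * f p].
Proof.
move=> D0 af.
pose B (i : nat) : {poly R} := (1 - 'X) ^+ (D - i) * 'X^i.
pose w (i : 'I_D.+1) p := 'C(D, i)%:R * poly_shift l f (B i) p.
have aw i : alternating h (w i).
  by apply: (alternatingZ (f := poly_shift l f (B i))) => //; exact: alternating_poly_shift.
have wE i p : w i p = poly_shift l f (B i *+ 'C(D, i)) p by rewrite -scaler_nat poly_shiftZ.
have sw p : \sum_(i < D.+1) w i p = f p.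
  under eq_bigr do rewrite wE.
  rewrite -poly_shift_sum -exprDn subrK expr1n -[1]/('X^0) poly_shift_Xn.
  by rewrite mul0r scale0r addr0.
exists w; split=> // p j Up jD.
(* An exact identity: multiply ['X^j] by the expansion of [((1 - 'X) + 'X)^(D - j)] and reindex by
   [i = k + j]. The terms with [i < j] vanish with the falling factorial. Replacing the ratio by
   [(i / D)^j] is the only source of error. *)
have XjE : 'X^j = \sum_(i < D.+1) ((i ^_ j)%:R / (D ^_ j)%:R : R) *: (B i *+ 'C(D, i)).
  have Dj0 : (0 : R) < (D ^_ j)%:R by rewrite ltr0n ffact_gt0.
  rewrite -(big_mkord xpredT (fun i => ((i ^_ j)%:R / (D ^_ j)%:R : R) *: (B i *+ 'C(D, i)))).
  rewrite (big_cat_nat (n := j))//=; last exact: leqW.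
  rewrite big_nat_cond big1 ?add0r; last first.
    by move=> i /andP[/andP[_ ij] _]; rewrite ffact_small// mul0r scale0r.
  rewrite -{2}[j]add0n big_addn subSn// big_mkord.
  rewrite -[LHS]mul1r -(expr1n _ (D - j)) -{1}[1](subrK 'X) exprDn mulr_suml.
  apply: eq_bigr => -[k /= kD] _.
  have cE : ((k + j) ^_ j)%:R / (D ^_ j)%:R * 'C(D, k + j)%:R = 'C(D - j, k)%:R :> R.
    rewrite mulrAC -natrM mulnC bin_ffact_shift ?leq_addl//; last by lia.
    by rewrite natrM mulrAC mulfV ?gt_eqF// mul1r addnK.
  rewrite -[B _ *+ _]scaler_nat scalerA cE scaler_nat mulrnAl /B exprD mulrA.
  by rewrite (_ : D - j - k = D - (k + j))%N//; lia.
rewrite -poly_shift_Xn XjE poly_shift_sum -sumrB.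
apply: (le_trans (ler_norm_sum _ _ _)); rewrite -(sw p) mulr_sumr; apply: ler_sum => i _.
rewrite poly_shiftZ -wE -mulrBl normrM.
have w0 : 0 <= w i p by exact: (aw i [::]).
rewrite (ger0_norm w0) ler_wpM2r//; apply: ffact_ratio_approx => //.
by rewrite -ltnS.
Qed.

End discrete_approximation.

(** The node [u a l] stands for [e^{-h y_l}], and [w a p] is its weight seen from the base point
    [p]. The weights are kept as alternating functions of [p] so that each can be split again along
    the next coordinate. *)
Definition discrete_split (R : realType) n (h : R) (f : 'rV[R]_n -> R) (D : nat)
    (s : seq 'I_n) (I : finType) (u : I -> 'I_n -> R) (w : I -> 'rV[R]_n -> R) : Prop :=
  [/\ forall a, alternating h (w a),
      forall a l, 0 <= u a l <= 1,
      forall p, \sum_a w a p = f p &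
      forall (j : 'I_n -> nat) p, (orthant n)° p -> (forall l, (j l <= D)%N) ->
        `|f (p + \sum_(l <- s) ((j l)%:R * h) *: delta_mx ord0 l) -
          \sum_a (\prod_(l <- s) u a l ^+ j l) * w a p|
        <= (\sum_(l <- s) (j l)%:R ^+ 2 / D%:R) * f p].

Lemma multi_bernstein_split (R : realType) n (h : R) (f : 'rV[R]_n -> R) (D : nat)
    (s : seq 'I_n) : 0 < h -> (0 < D)%N -> alternating h f -> uniq s ->
  exists (I : finType) (u : I -> 'I_n -> R) (w : I -> 'rV[R]_n -> R),
    discrete_split h f D s u w.
Proof.
move=> h0 D0 af; elim: s => [|l s IH].
  exists unit, (fun _ _ => 0), (fun=> f); split => // [a l|p|j p Up jD].
  - by rewrite lexx ler01.
  - by rewrite big_const card_unit /= addr0.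
  - rewrite !big_nil addr0; under eq_bigr do rewrite ?big_nil mul1r.
    by rewrite big_const card_unit /= addr0 subrr normr0 mul0r.
move=> /= /andP[ls us]; have [I [u [w [aw u01 sw E]]]] := IH us.
have [w' Hw'] := choice (fun a => bernstein_split h0 l D0 (aw a)).
have aw' a := let: And3 H _ _ := Hw' a in H.
have sw' a := let: And3 _ H _ := Hw' a in H.
have E' a := let: And3 _ _ H := Hw' a in H.
exists (I * 'I_D.+1)%type, (fun (ai : I * 'I_D.+1) l' => if l' == l then ai.2%:R / D%:R else u ai.1 l'),
  (fun ai : I * 'I_D.+1 => w' ai.1 ai.2).
split => [ai|ai l'|p|j p Up jD].
- exact: aw'.
- case: ifP => // _; rewrite divr_ge0//= ler_pdivrMr ?ltr0n// mul1r ler_nat.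
  by rewrite -ltnS.
- rewrite -(pair_big xpredT xpredT (fun a i => w' a i p))/= -[RHS]sw.
  by apply: eq_bigr => a _; exact: sw'.
have f0 : 0 <= f p by exact: (af [::]).
rewrite [X in f (p + X)]big_cons [X in _ <= X * _]big_cons addrA.
set p' := p + _.
have Up' : (orthant n)° p' by apply: interior_orthant_shift => //; rewrite mulr_ge0// ltW.
(* The induction hypothesis is applied at the moved base point [p']; monotonicity brings its error
   back to a multiple of [f p]. *)
have fp' : f p' <= f p.
  rewrite /p'; elim: (j l) => [|m]; first by rewrite mul0r scale0r addr0.
  apply: le_trans; rewrite -natr1 mulrDl mul1r scalerDl addrA -subr_ge0.
  by apply: (af [:: l]); apply: interior_orthant_shift => //; rewrite mulr_ge0// ltW.
have prodE (ai : I * 'I_D.+1) :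
    \prod_(l' <- l :: s) (if l' == l then ai.2%:R / D%:R else u ai.1 l') ^+ j l' =
    (ai.2%:R / D%:R) ^+ j l * \prod_(l' <- s) u ai.1 l' ^+ j l'.
  rewrite big_cons eqxx; congr (_ * _); apply: eq_big_seq => l' l's.
  by case: eqP => // ll; rewrite -ll l's in ls.
pose Ua a := \prod_(l' <- s) u a l' ^+ j l'.
have Ua01 a : 0 <= Ua a <= 1.
  rewrite /Ua; elim: (s) => [|k t IHt]; first by rewrite big_nil ler01 lexx.
  have /andP[u0 u1] := u01 a k.
  rewrite big_cons; case/andP: IHt => t0 t1; rewrite mulr_ge0 ?exprn_ge0//=.
  by rewrite mulr_ile1 ?exprn_ge0// exprn_ile1.
have sumE : \sum_(ai : I * 'I_D.+1)
    (\prod_(l' <- l :: s) (if l' == l then ai.2%:R / D%:R else u ai.1 l') ^+ j l') * w' ai.1 ai.2 p =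
    \sum_a Ua a * \sum_(i < D.+1) (i%:R / D%:R) ^+ j l * w' a i p.
  rewrite (eq_bigr (fun ai : I * 'I_D.+1 =>
    (ai.2%:R / D%:R) ^+ j l * Ua ai.1 * w' ai.1 ai.2 p)) => [|ai _]; last by rewrite prodE.
  rewrite -(pair_big xpredT xpredT (fun a (i : 'I_D.+1) =>
    (i%:R / D%:R) ^+ j l * Ua a * w' a i p))/=.
  by apply: eq_bigr => a _; rewrite mulr_sumr; apply: eq_bigr => i _; rewrite mulrCA !mulrA.
rewrite [X in `|_ - X|]sumE.
(* The intermediate sum uses the old weights at [p']. Its distance to [f] is the error for the
   coordinates in [s]; its distance to the new sum is the error along [l], and the old weights at
   [p] add up to [f p]. *)
rewrite -(subrKA (\sum_a Ua a * w a p')).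
apply: (le_trans (ler_normD _ _)); rewrite [leLHS]addrC mulrDl; apply: lerD.
  rewrite -sumrB; apply: (le_trans (ler_norm_sum _ _ _)).
  rewrite -(sw p) mulr_sumr; apply: ler_sum => a _.
  have /andP[U0 U1] := Ua01 a.
  rewrite -mulrBr normrM (ger0_norm U0); apply: le_trans (E' a p _ Up (jD l)).
  by rewrite ler_piMl.
apply: (le_trans (E j p' Up' jD)); rewrite ler_wpM2l//.
by apply: sumr_ge0 => k _; rewrite divr_ge0// exprn_ge0.
Qed.

(** * The limit functional on the cube *)

Definition dyadic_rV (R : realType) n (c : {ffun 'I_n -> nat} * nat) : 'rV[R]_n :=
  \row_l ((c.1 l).+1%:R / 2 ^+ c.2).

Definition unit_cube (R : realType) n : set ('I_n -> R) := [set v | forall l, 0 <= v l <= 1].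

(** A finitely additive mass of size at most [B] carried by [V], evaluated on all functions bounded
    on [V]. Only such conditions are imposed as survive pointwise limits. *)
Definition positive_functional (R : realType) (T : Type) (V : set T)
    (L : (T -> R) -> R) (B : R) : Prop :=
  let bounded f := exists M, forall v, V v -> `|f v| <= M in
  [/\ forall f g, bounded f -> bounded g -> L (fun v => f v + g v) = L f + L g,
      forall c f, bounded f -> L (fun v => c * f v) = c * L f,
      forall f g, bounded f -> bounded g -> (forall v, V v -> f v <= g v) -> L f <= L g &
      L (fun=> 1) <= B].

Lemma approximating_functionals (R : realType) n (F : 'rV[R]_n -> R) (B : R) :
  completely_monotone F -> (forall p, (orthant n)° p -> F p <= B) ->
  exists L : nat -> (('I_n -> R) -> R) -> R,
    (forall N, positive_functional (@unit_cube R n) (L N) B) /\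
    forall c, L N (fun v => \prod_(l < n) v l `^ (dyadic_rV R c ord0 l)) @[N --> \oo] -->
      F (dyadic_rV R c).
Proof.
move=> cmF FB.
pose h (N : nat) : R := 2^-1 ^+ N.
have h0 N : 0 < h N by rewrite exprn_gt0.
(* A fixed dyadic point is [j] steps of size [2^-N] with [j] of order [2^N], so the error [j^2 / D]
   is of order [4^N / 8^N = 2^-N]; also [j <= D] for large [N]. *)
pose D (N : nat) := (8 ^ N)%N.
have D0 N : (0 < D N)%N by rewrite expn_gt0.
have aF N := completely_monotone_alternating (h0 N) cmF.
have ex N := multi_bernstein_split (h0 N) (D0 N) (aF N) (enum_uniq 'I_n).
have [I [u [w Hw]]] : exists (I : nat -> finType) (u : forall N, I N -> 'I_n -> R)
    (w : forall N, I N -> 'rV[R]_n -> R),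
    forall N, discrete_split (h N) F (D N) (enum 'I_n) (u N) (w N).
  exists (fun N => projT1 (cid (ex N))).
  exists (fun N => projT1 (cid (projT2 (cid (ex N))))).
  exists (fun N => projT1 (cid (projT2 (cid (projT2 (cid (ex N))))))) => N.
  exact: projT2 (cid (projT2 (cid (projT2 (cid (ex N)))))).
(* The differences are controlled only in the interior, so the base point is taken there and tends
   to 0; it disappears in the limit by continuity of [F] at [p]. *)
pose pt N : 'rV[R]_n := const_mx (h N).
have Upt N : (orthant n)° (pt N) by apply/interior_orthantE => i; rewrite mxE.
have w0 N a : 0 <= w N a (pt N) by have [aw _ _ _] := Hw N; exact: (aw a [::]).
(* Nodes of different meshes are made comparable: if [u] stands for [e^{-h y}] then [v] stands for
   [e^{-y}], and [J = p / h] factors [u] become the power [p] of [v]. *)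
pose v N (a : I N) l := u N a l `^ (h N)^-1.
have v01 N a : unit_cube (v N a).
  move=> l; have [_ /(_ a l)/andP[u0 u1] _ _] := Hw N.
  have one : 1 `^ (h N)^-1 = 1 :> R by rewrite powR1.
  rewrite /v powR_ge0/= -[leRHS]one.
  by apply: ge0_ler_powR => //; rewrite ?nnegrE ?invr_ge0 ?(ltW (h0 N)) ?ler01.
exists (fun N f => \sum_a w N a (pt N) * f (v N a)); split=> [N|c].
  split=> [f g _ _|k f _|f g _ _ fg|].
  - by rewrite -big_split/=; apply: eq_bigr => a _; rewrite mulrDr.
  - by rewrite mulr_sumr; apply: eq_bigr => a _; rewrite mulrCA.
  - by apply: ler_sum => a _; rewrite ler_wpM2l//; exact/fg/v01.
  - under eq_bigr do rewrite mulr1.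
    by have [_ _ -> _] := Hw N; exact: FB.
set p := dyadic_rV R c.
have Up : (orthant n)° p by apply/interior_orthantE => i; rewrite mxE divr_gt0 ?exprn_gt0.
have B0 : 0 <= B by apply: le_trans (FB _ Up); exact: (aF 0%N [::]).
pose C : R := \sum_(l <- enum 'I_n) (c.1 l).+1%:R ^+ 2.
have C0 : 0 <= C by apply: sumr_ge0 => l _; rewrite exprn_ge0.
pose phi (x : 'I_n -> R) := \prod_(l < n) x l `^ (p ord0 l).
have half_cvg0 : (2^-1 : R) ^+ N @[N --> \oo] --> 0.
  by apply: cvg_expr; rewrite ger0_norm ?invr_ge0// invf_lt1// ltr1n.
have key : \forall N \near \oo, `|F (pt N + p) - \sum_a w N a (pt N) * phi (v N a)| <= C * B * 2^-1 ^+ N.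
  exists (\sum_(l < n) (c.1 l).+1 + c.2)%N => // N /= KN.
  pose J l := ((c.1 l).+1 * 2 ^ (N - c.2))%N.
  have JR l : (J l)%:R = (h N)^-1 * p ord0 l :> R.
    have -> : (h N)^-1 = 2 ^+ N by rewrite /h exprVn invrK.
    have cN : (c.2 <= N)%N by apply: leq_trans KN; rewrite leq_addl.
    by rewrite natrM natrX /p /dyadic_rV mxE exprB ?unitfE ?pnatr_eq0// mulrCA.
  have JD l : (J l <= D N)%N.
    have kK : ((c.1 l).+1 <= 2 ^ N)%N.
      apply: (@leq_trans (\sum_(l < n) (c.1 l).+1)%N).
        by rewrite (bigD1 l)//= leq_addr.
      apply: ltnW; apply: leq_trans (ltn_expl _ (isT : 1 < 2)%N) _.
      by rewrite leq_exp2l//; apply: leq_trans KN; rewrite leq_addr.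
    rewrite /J /D; apply: (@leq_trans (2 ^ N * 2 ^ N)%N).
      by rewrite leq_mul// leq_exp2l// leq_subr.
    by rewrite -expnMn; case: (N) => // m; rewrite leq_exp2r.
  have [_ u01 sw E] := Hw N.
  have ptE : pt N + p = pt N + \sum_(l <- enum 'I_n) ((J l)%:R * h N) *: delta_mx ord0 l.
    congr (_ + _); apply/rowP => i; rewrite summxE big_enum/= (bigD1 i)//= !mxE !eqxx/= mulr1.
    rewrite JR mulrAC mulVf ?gt_eqF// mul1r big1 ?addr0 ?mxE// => l /negPf li.
    by rewrite !mxE eqxx eq_sym li mulr0.
  have phiE a : phi (v N a) = \prod_(l <- enum 'I_n) u N a l ^+ J l.
    rewrite /phi big_enum/=; apply: eq_bigr => l _.
    have /andP[u0 _] := u01 a l.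
    by rewrite /v -powRrM -JR powR_mulrn.
  rewrite ptE; under [X in _ - X]eq_bigr do rewrite phiE mulrC.
  apply: le_trans (E J (pt N) (Upt N) JD) _.
  rewrite mulrAC; apply: ler_pM; rewrite ?FB//.
  - by apply: sumr_ge0 => l _; rewrite divr_ge0// exprn_ge0.
  - exact: (aF N [::]).
  rewrite /C mulr_suml; apply: ler_sum => l _.
  have D8 : (D N)%:R = (2 ^+ N) ^+ 3 :> R.
    by rewrite /D (_ : 8 = 2 ^ 3)%N// -expnM mulnC expnM !natrX.
  have N0 : (0 : R) < 2 ^+ N by rewrite exprn_gt0.
  have -> : 2^-1 ^+ N = (2 ^+ N) ^+ 2 / (D N)%:R :> R.
    by rewrite D8 exprVn; field; rewrite gt_eqF.
  rewrite mulrA -exprMn ler_pM2r ?invr_gt0 ?ltr0n//.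
  rewrite ler_pXn2r ?nnegrE ?mulr_ge0 ?(ltW N0)//.
  by rewrite -natrX -natrM ler_nat leq_mul// leq_exp2l// leq_subr.
have cvF : F (pt N + p) @[N --> \oo] --> F p.
  have cF : {for p, continuous F} by have [sm _] := cmF; exact: (sm [::] p Up).1.
  have ptp : pt N + p @[N --> \oo] --> p.
    rewrite -[X in _ --> X]add0r; apply: cvgD; last exact: cvg_cst.
    apply/cvgr0Pnorm_lt => e e0; near=> N.
    rewrite [`|_|]mx_normrE; apply: bigmax_lt => // i _; rewrite mxE.
    by near: N; apply: cvgr0_norm_lt.
  exact: (cvg_comp _ _ ptp cF).
rewrite -[X in _ --> X]subr0.
rewrite (_ : (fun N : nat => \sum_a _) = fun N => F (pt N + p) -
   (F (pt N + p) - \sum_a w N a (pt N) * phi (v N a))); last first.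
  by apply/funext => N; rewrite subKr.
apply: cvgB => //; apply: norm_cvg0.
apply: (squeeze_cvgr (f := fun=> 0) (h := fun N => C * B * 2^-1 ^+ N)).
- by apply: filterS key => N ->; rewrite normr_ge0.
- exact: cvg_cst.
- by rewrite -[X in _ --> X](mulr0 (C * B)); apply: cvgMl_tmp.
Unshelve. all: by end_near. Qed.

Section positive_functional_theory.
Context {R : realType} {T : Type} (V : set T) (L : (T -> R) -> R) (B : R).
Hypothesis HL : positive_functional V L B.

Definition bounded_on (f : T -> R) := exists M, forall v, V v -> `|f v| <= M.

Lemma bounded_on_cst c : bounded_on (fun=> c). Proof. by exists `|c|. Qed.

Lemma bounded_onD f g : bounded_on f -> bounded_on g -> bounded_on (fun v => f v + g v).
Proof.
move=> [M fM] [N gN]; exists (M + N) => v Vv.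
by apply: (le_trans (ler_normD _ _)); apply: lerD; [exact: fM|exact: gN].
Qed.

Lemma bounded_onZ c f : bounded_on f -> bounded_on (fun v => c * f v).
Proof. by move=> [M fM]; exists (`|c| * M) => v Vv; rewrite normrM ler_wpM2l ?fM. Qed.

Lemma bounded_on_sum (I : Type) (r : seq I) (f : I -> T -> R) :
  (forall i, bounded_on (f i)) -> bounded_on (fun v => \sum_(i <- r) f i v).
Proof.
move=> bf; elim: r => [|k r IH]; first by exists 0 => v _; rewrite big_nil normr0.
by have [M HM] := bounded_onD (bf k) IH; exists M => v Vv; rewrite big_cons HM.
Qed.

Lemma positive_functional_cst c : L (fun=> c) = c * L (fun=> 1).
Proof.
have [_ LZ _ _] := HL; rewrite -LZ; last exact: bounded_on_cst.
by congr L; apply/funext => v; rewrite mulr1.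
Qed.

Lemma positive_functional1_ge0 : 0 <= L (fun=> 1).
Proof.
have [_ _ Lle _] := HL.
have := Lle (fun=> 0) (fun=> 1) (bounded_on_cst 0) (bounded_on_cst 1) (fun _ _ => ler01).
by rewrite positive_functional_cst mul0r.
Qed.

Lemma positive_functional_norm f (M : R) : (forall v, V v -> `|f v| <= M) ->
  `|L f| <= M * L (fun=> 1).
Proof.
move=> fM; have [_ _ Lle _] := HL; have bf : bounded_on f by exists M.
rewrite ler_norml -mulNr -!positive_functional_cst; apply/andP; split; apply: Lle => //;
  try exact: bounded_on_cst.
  by move=> v /fM; rewrite ler_norml => /andP[].
by move=> v /fM; rewrite ler_norml => /andP[].
Qed.

Lemma positive_functional_dist f g (e : R) : bounded_on f -> bounded_on g ->
  (forall v, V v -> `|f v - g v| <= e) -> `|L f - L g| <= e * L (fun=> 1).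
Proof.
move=> bf bg fg; have [LD LZ _ _] := HL.
have -> : L f - L g = L (fun v => f v + -1 * g v).
  by rewrite LD ?LZ ?mulN1r//; exact: bounded_onZ.
by apply: positive_functional_norm => v Vv; rewrite mulN1r fg.
Qed.

Lemma positive_functional_sum (I : Type) (r : seq I) (f : I -> T -> R) :
  (forall i, bounded_on (f i)) ->
  L (fun v => \sum_(i <- r) f i v) = \sum_(i <- r) L (f i).
Proof.
move=> bf; elim: r => [|i r IH].
  have -> : (fun v => \sum_(i <- [::]) f i v) = fun=> 0 by apply/funext => v; rewrite big_nil.
  by rewrite big_nil positive_functional_cst mul0r.
rewrite big_cons -IH; have [LD _ _ _] := HL.
rewrite -(LD _ _ (bf i) (bounded_on_sum r bf)).
by congr L; apply/funext => v; rewrite big_cons.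
Qed.

End positive_functional_theory.

(** Along an ultrafilter every bounded real sequence converges, by compactness of segments. So all
    bounded [f] receive a limit simultaneously, and linearity and order pass to it; sequences that
    already converge keep their limit because the ultrafilter refines [\oo]. *)
Lemma limit_positive_functional (R : realType) (T : Type) (V : set T)
    (L : nat -> (T -> R) -> R) (B : R) :
  (forall N, positive_functional V (L N) B) ->
  exists2 Lam : (T -> R) -> R, positive_functional V Lam B &
    forall f l, bounded_on V f -> L N f @[N --> \oo] --> l -> Lam f = l.
Proof.
move=> HL; have [U [uU ooU]] := ultraFilterLemma (eventually_filter : ProperFilter \oo).
have cvU f : bounded_on V f -> cvg (L N f @[N --> U]).
  move=> [M fM]; pose K := `|M| * B.
  have LK N : `|L N f| <= K.
    have [_ _ _ L1] := HL N.
    have L0 := positive_functional1_ge0 (HL N).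
    apply: le_trans (positive_functional_norm (M := `|M|) (HL N) _) _.
      by move=> v Vv; apply: le_trans (fM v Vv) (ler_norm _).
    by rewrite ler_wpM2l.
  have [|l [_ cl]] := @segment_compact R (- K) K (L N f @[N --> U]) _.
    suff : U ((fun N => L N f) @^-1` `[- K, K]) by [].
    by apply: filterE => N /=; rewrite in_itv/= -ler_norml; exact: LK.
  apply/cvg_ex; exists l => A Al.
  have [//|nA] := in_ultra_setVsetC ((fun N => L N f) @^-1` A) uU.
  by have [x [nAx Ax]] := cl (~` A) A nA Al.
exists (fun f => lim (L N f @[N --> U])) => [|f l _ fl]; last first.
  by apply: cvg_lim => //; apply: cvg_trans fl; exact: cvg_app.
split=> [f g bf bg|c f bf|f g bf bg fg|].
- under eq_fun do rewrite (let: And4 H _ _ _ := HL _ in H f g bf bg).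
  by apply: cvg_lim => //; apply: cvgD; exact: cvU.
- under eq_fun do rewrite (let: And4 _ H _ _ := HL _ in H c f bf).
  by apply: cvg_lim => //; apply: cvgMl_tmp; exact: cvU.
- apply: ler_lim; [exact: cvU|exact: cvU|].
  by apply: nearW => N; have [_ _ H _] := HL N; exact: H.
- apply: limr_le; first exact/cvU/bounded_on_cst.
  by apply: nearW => N; have [_ _ _ H] := HL N.
Qed.

(** * Realization of a positive functional on an interval *)

Section functional_representation.
Context {R : realType} {T : Type} {C : countType} (V : set T) (Lam : (T -> R) -> R) (B : R).
Variables (f : C -> T -> R) (t0 : T).
Hypothesis HL : positive_functional V Lam B.
Hypothesis f01 : forall c v, V v -> 0 <= f c v <= 1.

(* [Lam] is realized on the interval [0, m[, m = Lam 1, by successively bisecting it: the yes/no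
   questions [f c v < r], [r] rational, split [V] into cells, and the points giving the answers
   [w] correspond to the subinterval starting at [cell_start w] of length [Lam] of the indicator
   of the cell. Along the nested intervals around [om] each [f c] oscillates less and less.
   No countable additivity of [Lam] is needed. *)
Definition question (j : nat) (v : T) : bool :=
  if unpickle j is Some (c, q) then f c v < ratr (q : rat) else true.

Fixpoint answers (j : nat) (v : T) : seq bool :=
  if j is j'.+1 then question j' v :: answers j' v else [::].

Definition cell_mass (w : seq bool) : R :=
  Lam (fun v => (answers (size w) v == w)%:R).

Fixpoint cell_start (w : seq bool) : R :=
  if w is b :: w' then cell_start w' + (if b then 0 else cell_mass (true :: w')) else 0.

Fixpoint random_answers (j : nat) (om : R) : seq bool :=
  if j is j'.+1 then
    let w := random_answers j' om in
    (om < cell_start w + cell_mass (true :: w)) :: w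
  else [::].

Let m : R := Lam (fun=> 1).
Let D : set R := `[0, m[%classic.

Let size_answers j v : size (answers j v) = j.
Proof. by elim: j => //= j ->. Qed.

Let size_random_answers j om : size (random_answers j om) = j.
Proof. by elim: j => //= j ->. Qed.

Let bounded_bool (P : T -> bool) : bounded_on V (fun v => (P v)%:R : R).
Proof. by exists 1 => v _; rewrite normr_nat lern1 leq_b1. Qed.

Let cell_mass_ge0 w : 0 <= cell_mass w.
Proof.
have [_ _ Lle _] := HL.
have := Lle (fun=> 0) _ (bounded_on_cst V 0) (bounded_bool (fun v => answers (size w) v == w)).
by rewrite (positive_functional_cst HL) mul0r; apply => v _; rewrite ler0n.
Qed.

Let cell_mass_split w : cell_mass w = cell_mass (true :: w) + cell_mass (false :: w).
Proof.
have [LD _ _ _] := HL; rewrite /cell_mass -LD; try exact: bounded_bool.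
congr Lam; apply/funext => v /=; rewrite !eqseq_cons.
by case: (question _ v); case: eqP => _ /=; rewrite ?addr0 ?add0r.
Qed.

Let cell_mass_nil : cell_mass [::] = m. Proof. by []. Qed.

Let random_answers_itv j om : 0 <= om < m ->
  cell_start (random_answers j om) <= om <
  cell_start (random_answers j om) + cell_mass (random_answers j om).
Proof.
move=> om0; elim: j => [|j IH] /=; first by rewrite add0r cell_mass_nil.
move: IH; set w := random_answers j om => /andP[h1 h2].
case: ltP => h3; first by rewrite addr0 h1.
by rewrite h3/= -addrA -cell_mass_split.
Qed.

Let itv_random_answers w om :
  cell_start w <= om < cell_start w + cell_mass w -> random_answers (size w) om = w.
Proof.
elim: w => //= b w IH /andP[h1 h2].
have t0' := cell_mass_ge0 (true :: w); have f0 := cell_mass_ge0 (false :: w).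
have sp := cell_mass_split w.
have -> : random_answers (size w) om = w.
  by apply: IH; apply/andP; case: b h1 h2 => h1 h2; lra.
congr (_ :: _); case: b h1 h2 => h1 h2; first by rewrite addr0 in h2.
by apply/negbTE; rewrite -leNgt.
Qed.

Let cell_start_ge0 w : 0 <= cell_start w.
Proof. by elim: w => //= b w IH; rewrite addr_ge0//; case: b. Qed.

Let cell_end w : cell_start w + cell_mass w <= m.
Proof.
elim: w => [|b w IH] /=; first by rewrite add0r cell_mass_nil.
apply: le_trans IH; rewrite -addrA lerD2l (cell_mass_split w).
have := cell_mass_ge0 (false :: w).
by case: b => h; lra.
Qed.

Let cell_itv (w : seq bool) : set R := `[cell_start w, cell_start w + cell_mass w[%classic.

Let expansion (phi : seq bool -> R) j om : D om ->
  phi (random_answers j om) = \sum_(t : j.-tuple bool) phi t * \1_(cell_itv t) om.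
Proof.
rewrite /D/= in_itv/= => omD.
have sz : size (random_answers j om) == j by rewrite size_random_answers.
rewrite (bigD1 (Tuple sz))//= big1 ?addr0 => [|t tne].
  rewrite /indic mem_set ?mulr1// /cell_itv/= in_itv/=; exact: random_answers_itv.
rewrite /indic memNset ?mulr0 // /cell_itv /= in_itv /= => /itv_random_answers e.
move/eqP: tne; apply; apply/val_inj => /=.
by rewrite -e size_tuple.
Qed.

Let mD : measurable D. Proof. exact: measurable_itv. Qed.

Let m_ge0 : 0 <= m. Proof. exact: (positive_functional1_ge0 HL). Qed.

Let muD : lebesgue_measure D = m%:E.
Proof.
rewrite /D lebesgue_measure_itv/= lte_fin; case: ltP => m0; first by rewrite -EFinB subr0.
by congr EFin; apply/le_anti; rewrite m0 m_ge0.
Qed.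

Let fin_muD : (lebesgue_measure D < +oo)%E. Proof. by rewrite muD ltry. Qed.

Let mu_cell w : lebesgue_measure (cell_itv w) = (cell_mass w)%:E.
Proof.
rewrite /cell_itv lebesgue_measure_itv/= lte_fin; case: ltP => h.
  by rewrite -EFinB addrAC subrr add0r.
by congr EFin; apply/le_anti; rewrite cell_mass_ge0 /=; lra.
Qed.

Let measurable_expansion (phi : seq bool -> R) j :
  measurable_fun D (fun om => \sum_(t : j.-tuple bool) phi t * \1_(cell_itv t) om).
Proof.
apply: measurable_sum => t; apply: measurable_funM => //.
by apply: measurable_indic; exact: measurable_itv.
Qed.

(* Under the Lebesgue measure on [0, m[ the first j answers have the same law as under [Lam]. *)
Let integral_random_answers (phi : seq bool -> R) j :
  (\int[lebesgue_measure]_(om in D) phi (random_answers j om))%R =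
  Lam (fun v => phi (answers j v)).
Proof.
have i1 (t : j.-tuple bool) : lebesgue_measure.-integrable D (EFin \o (fun om => phi t * \1_(cell_itv t) om)).
  apply: (@bounded_integrable _ _ _ lebesgue_measure D _ `|phi t|) => //.
    apply: measurable_funM => //; apply: measurable_indic; exact: measurable_itv.
  move=> om _; rewrite normrM ler_piMr// /indic normr_nat lern1 leq_b1//.
transitivity (\int[lebesgue_measure]_(om in D) (\sum_(t : j.-tuple bool) phi t * \1_(cell_itv t) om))%R.
  by apply: eq_Rintegral => om /set_mem; exact: expansion.
have -> : (\int[lebesgue_measure]_(om in D) (\sum_(t : j.-tuple bool) phi t * \1_(cell_itv t) om))%R
    = \sum_(t : j.-tuple bool) phi t * cell_mass t.
  rewrite /Rintegral; under eq_integral do rewrite -sumEFin.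
  rewrite integral_sum//.
  rewrite (eq_bigr (fun t : j.-tuple bool => (phi t * cell_mass t)%:E)) ?sumEFin// => t _.
  have fi : lebesgue_measure.-integrable D (EFin \o (\1_(cell_itv t) : R -> R)).
    apply: (@bounded_integrable _ _ _ lebesgue_measure D _ 1) => //.
      by apply: measurable_indic; exact: measurable_itv.
    by move=> om _; rewrite /indic normr_nat lern1 leq_b1.
  under eq_integral do rewrite EFinM.
  rewrite integralZl// integral_indic//; last exact: measurable_itv.
  rewrite EFinM -mu_cell; congr (_ * _)%E; congr lebesgue_measure.
  apply/setIidPl => om; rewrite /cell_itv /D /= !in_itv/= => /andP[h1 h2].
  by rewrite (le_trans (cell_start_ge0 t) h1)/= (lt_le_trans h2 (cell_end t)).
have bt (t : j.-tuple bool) : bounded_on V (fun v => (answers (size t) v == t)%:R : R).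
  exact: bounded_bool.
have [_ LZ _ _] := HL.
under eq_bigr => t _ do rewrite /cell_mass -(LZ _ _ (bt t)).
rewrite -(positive_functional_sum HL) => [|t]; last exact: bounded_onZ.
congr Lam; apply/funext => v.
have sz : size (answers j v) == j by rewrite size_answers.
rewrite (bigD1 (Tuple sz))//= size_answers eqxx mulr1 big1 ?addr0// => t tne.
rewrite size_tuple; case: eqP => [e|_]; last by rewrite mulr0.
by move/eqP: tne; case; apply/val_inj => /=.
Qed.
Let answers_question j v v' : answers j v = answers j v' ->
  forall i, (i < j)%N -> question i v = question i v'.
Proof.
elim: j => // j IH /= [q a] i; rewrite ltnS leq_eqVlt => /predU1P[->//|]; exact: IH.
Qed.

(** As [f c] has values in [0, 1], the questions with thresholds [i / (k+1)], [i <= k+1], suffice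
    when [1 / (k+1) < e]: two values more than [e] apart are separated by one of them. [J] exceeds
    the indices of all these questions. *)
Let answers_determine c (e : R) : 0 < e -> exists J, forall j, (J <= j)%N ->
  forall v v', V v -> V v' -> answers j v = answers j v' -> `|f c v - f c v'| <= e.
Proof.
move=> e0; have [k _ /(_ k (leqnn k)) /= ke] := near_infty_natSinv_lt (PosNum e0).
pose idx (i : nat) := pickle (c, i%:R / k.+1%:R : rat).
have k0 : (0 : R) < k.+1%:R by rewrite ltr0n.
exists (\max_(i < k.+2) idx i).+1 => j Jj.
suff main v v' : V v -> V v' -> answers j v = answers j v' -> f c v' <= f c v + e.
  move=> v v' Vv Vv' a; rewrite ler_norml; apply/andP; split.
    by have := main _ _ Vv Vv' a; lra.
  by have := main _ _ Vv' Vv (esym a); lra.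
move=> Vv Vv' a; rewrite leNgt; apply/negP => lt.
have /andP[v0 v1] := f01 c Vv; have /andP[v'0 v'1] := f01 c Vv'.
have fk0 : 0 <= f c v * k.+1%:R by rewrite mulr_ge0// ltW.
(* The first grid index strictly above [f c v]; the corresponding threshold is still at most
   [f c v']. *)
pose i := (Num.truncn (f c v * k.+1%:R)).+1.
have /andP[i1 i2] := truncn_itv fk0; rewrite -/i in i2.
have vi : f c v < i%:R / k.+1%:R by rewrite ltr_pdivlMr.
have iv' : i%:R / k.+1%:R <= f c v'.
  apply: le_trans (ltW lt); apply: (@le_trans _ _ (f c v + k.+1%:R^-1)); last by rewrite lerD2l ltW.
  by rewrite ler_pdivrMr// mulrDl mulVf ?gt_eqF// /i -natr1 lerD2r.
have ik : (i < k.+2)%N.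
  by rewrite ltnS -(ler_nat R) -[leRHS]mul1r -ler_pdivrMr// (le_trans iv').
have ij : (idx i < j)%N.
  by apply: leq_trans Jj; rewrite ltnS; exact: (leq_bigmax (Ordinal ik)).
have := answers_question a ij; rewrite /question /idx pickleK.
have -> : ratr (i%:R / k.+1%:R : rat) = i%:R / k.+1%:R :> R.
  by rewrite fmorph_div /= !rmorph_nat.
by rewrite vi ltNge iv'.
Qed.

Let pick (w : seq bool) : T :=
  if pselect (exists v, V v /\ answers (size w) v = w) is left e then projT1 (cid e) else t0.

Let pickP w v : V v -> answers (size w) v = w -> V (pick w) /\ answers (size w) (pick w) = w.
Proof.
move=> Vv aw; rewrite /pick; case: pselect => [e|[]]; last by exists v.
exact: projT2 (cid e).
Qed.

Let rep (j : nat) (om : R) : T := pick (random_answers j om).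

(** The interval of a cell that contains [om] has positive length, while a cell without points of
    [V] has mass at most 0 by monotonicity. Hence the default [t0] in [pick] is never reached from
    [D]. *)
Let rep_spec j om : D om -> V (rep j om) /\ answers j (rep j om) = random_answers j om.
Proof.
rewrite /D/= in_itv/= => /(@random_answers_itv j) /andP[h1 h2].
have : 0 < cell_mass (random_answers j om) by lra.
have [[v [Vv av]] _|nex] := pselect (exists v, V v /\ answers j v = random_answers j om).
  have := @pickP (random_answers j om) v Vv; rewrite size_random_answers; exact.
rewrite ltNge => /negP; case.
have [_ _ Lle _] := HL; rewrite /cell_mass size_random_answers.
have := Lle _ (fun=> 0) (bounded_bool (fun v => answers j v == random_answers j om)) (bounded_on_cst V 0).
rewrite (positive_functional_cst HL 0) mul0r; apply => v Vv.
by case: eqP => // av; case: nex; exists v.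
Qed.

Let rep_answers i j om : D om -> (i <= j)%N -> answers i (rep j om) = random_answers i om.
Proof.
move=> Dom; have [_] := rep_spec j Dom; move: (rep j om) => v.
elim: j => [|j IH]; first by rewrite leqn0 => av /eqP ->.
by move=> av; rewrite leq_eqVlt => /predU1P[->//|]; apply: IH; case: av.
Qed.

Let rep_cauchy c (e : R) : 0 < e -> exists J, forall i j om, D om -> (J <= i)%N -> (i <= j)%N ->
  `|f c (rep i om) - f c (rep j om)| <= e.
Proof.
move=> e0; have [J HJ] := answers_determine c e0; exists J => i j om Dom Ji ij.
apply: (HJ _ Ji); [exact: (rep_spec i Dom).1|exact: (rep_spec j Dom).1|].
by rewrite !rep_answers.
Qed.

Let Y c om : R := lim (f c (rep j om) @[j --> \oo]).

Let cvg_Y c om : D om -> f c (rep j om) @[j --> \oo] --> Y c om.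
Proof.
move=> Dom; apply: cauchy_cvg; apply: cauchy_exP => e e0.
have [J HJ] := rep_cauchy c (divr_gt0 e0 (ltr0n R 2)).
exists (f c (rep J om)); exists J => // j /= Jj.
by rewrite /ball/= (le_lt_trans (HJ _ _ _ Dom (leqnn J) Jj))//; lra.
Qed.

Let measurable_rep c j : measurable_fun D (fun om => f c (rep j om)).
Proof.
apply: (eq_measurable_fun _ _ (measurable_expansion (fun w => f c (pick w)) j)).
by move=> om /set_mem Dom; rewrite -(expansion (fun w => f c (pick w)) _ Dom).
Qed.

Let measurable_Y c : measurable_fun D (Y c).
Proof.
apply: (measurable_fun_cvg (h := fun j om => f c (rep j om))) => // om Dom.
exact: cvg_Y.
Qed.

Let rep01 c j om : D om -> 0 <= f c (rep j om) <= 1.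
Proof. by move=> Dom; have [/(f01 c)] := rep_spec j Dom. Qed.

Let Y01 c om : D om -> 0 <= Y c om <= 1.
Proof.
move=> Dom; have cY := @cvg_Y c om Dom; apply/andP; split.
  have := @cvgr_to_ge nat \oo _ R (fun j => f c (rep j om)) _ 0 cY.
  by apply; apply: nearW => j; have /andP[] := rep01 c j Dom.
have := @cvgr_to_le nat \oo _ R (fun j => f c (rep j om)) _ 1 cY.
by apply; apply: nearW => j; have /andP[] := rep01 c j Dom.
Qed.

(** Up to [e], both [Y c] and [f c] are functions of the first [J] answers, and these have the same
    law on both sides. *)
Let integral_Y c : (\int[lebesgue_measure]_(om in D) Y c om)%R = Lam (f c).
Proof.
have bf : bounded_on V (f c).
  by exists 1 => v /(f01 c)/andP[? ?]; rewrite ger0_norm.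
have close (e : R) : 0 < e ->
    `|(\int[lebesgue_measure]_(om in D) Y c om)%R - Lam (f c)| <= e * m + e * m.
  move=> e0; have [J1 HJ1] := rep_cauchy c e0; have [J2 HJ2] := answers_determine c e0.
  pose J := maxn J1 J2.
  have bpick : bounded_on V (fun v => f c (pick (answers J v))).
    exists 1 => v Vv; have [Vp _] := @pickP (answers J v) v Vv (congr1 (answers^~ v) (size_answers J v)).
    by have /andP[? ?] := f01 c Vp; rewrite ger0_norm.
  rewrite -(subrKA (Lam (fun v => f c (pick (answers J v))))).
  apply: (le_trans (ler_normD _ _)); apply: lerD; last first.
    apply: (positive_functional_dist HL) => // v Vv.
    have [Vp ap] := @pickP (answers J v) v Vv (congr1 (answers^~ v) (size_answers J v)).
    by apply: (HJ2 J) => //; [exact: leq_maxr|rewrite -[RHS]ap size_answers].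
  rewrite -(integral_random_answers (fun w => f c (pick w))).
  have iY : lebesgue_measure.-integrable D (EFin \o Y c).
    apply: (@bounded_integrable _ _ _ lebesgue_measure D _ 1) => // [|om Dom]; first exact: measurable_Y.
    have /andP[? ?] := Y01 c Dom; by rewrite ger0_norm.
  have iJ : lebesgue_measure.-integrable D (EFin \o (fun om => f c (rep J om))).
    apply: (@bounded_integrable _ _ _ lebesgue_measure D _ 1) => // [|om Dom]; first exact: measurable_rep.
    by have /andP[? ?] := rep01 c J Dom; rewrite ger0_norm.
  rewrite -RintegralB//.
  have iYJ : lebesgue_measure.-integrable D (EFin \o (fun om => Y c om - f c (rep J om))).
    have := @integrableB _ _ R lebesgue_measure D mD _ _ iY iJ.
    by apply: eq_integrable.
  apply: (le_trans (le_normr_Rintegral _ iYJ)) => //.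
  have -> : e * m = (\int[lebesgue_measure]_(om in D) e)%R.
    by rewrite Rintegral_cst//; congr (_ * _); rewrite -[LHS]/(fine m%:E) -muD.
  apply: le_Rintegral => //.
  - by have := integrable_abse iYJ; apply: eq_integrable.
  - by apply: (@bounded_integrable _ _ _ lebesgue_measure D (cst e) `|e|).
  move=> om Dom; rewrite distrC.
  have := @cvgr_to_le nat \oo _ R (fun j => `|f c (rep J om) - f c (rep j om)|) `|f c (rep J om) - Y c om| e.
  apply.
    by apply: cvg_norm; apply: cvgB; [exact: cvg_cst|exact: cvg_Y].
  by exists J => // j /= Jj; apply: HJ1 => //; exact: leq_maxl.
apply/eqP; rewrite -subr_eq0 -normr_le0 leNgt; apply/negP => d0.
set d := `|_| in d0; have m10 : 0 < m + 1 by have := m_ge0; lra.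
(* The denominator [m + 1] allows [m = 0]; each of the two errors is then at most [d / 4], against a
   supposed distance [d > 0]. *)
have := close (d / 4 / (m + 1)) (divr_gt0 (divr_gt0 d0 (ltr0n R 4)) m10).
have : d / 4 / (m + 1) * m <= d / 4.
  by rewrite mulrAC ler_pdivrMr// ler_wpM2l ?ler_wpDr// ltW// divr_gt0.
rewrite -/d; lra.
Qed.

(** The points [x j om] are returned along with the limits so that pointwise relations among the
    [f c] on [V] can be transferred to the [X c]. *)
Lemma functional_representation :
  exists (M : R) (x : nat -> R -> T) (X : C -> R -> R),
  [/\ 0 <= M,
      forall c, measurable_fun `[0, M[ (X c),
      forall om, 0 <= om < M ->
        (forall j, V (x j om)) /\ forall c, f c (x j om) @[j --> \oo] --> X c om &
      forall c, (\int[lebesgue_measure]_(om in `[0, M[) X c om)%R = Lam (f c)].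
Proof.
exists m, rep, Y; split => // om omD.
have Dom : D om by rewrite /D/= in_itv.
by split=> [j|c]; [exact: (rep_spec j Dom).1|exact: cvg_Y].
Qed.

End functional_representation.

(** * The function [F] as a Laplace transform *)

Lemma ge0_integral_mrestr (R : realType) d (Y : measurableType d)
    (mu : {measure set Y -> \bar R}) (A E : set Y) (mA : measurable A) (f : Y -> \bar R) :
  measurable E -> measurable_fun E f -> (forall x, E x -> 0 <= f x)%E ->
  (\int[mrestr mu mA]_(x in E) f x = \int[mu]_(x in E `&` A) f x)%E.
Proof.
move=> mE mf f0; have mAC : measurable (~` A) by exact: measurableC.
have AC0 : mrestr mu mA (~` A) = 0%E by rewrite /mrestr setICl measure0.
rewrite (ge0_negligible_integral mAC mE mf f0 AC0) setDE setCK.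
apply: eq_measure_integral => X mX XEA; congr (mu _).
by apply/setIidPl => x /XEA[].
Qed.

Lemma cvg_powR (R : realType) (a : R) (u : nat -> R) (l : R) : 0 < a ->
  (forall j, 0 <= u j) -> u j @[j --> \oo] --> l -> u j `^ a @[j --> \oo] --> l `^ a.
Proof.
move=> a0 u0 ul.
have l0 : 0 <= l.
  have := @cvgr_to_ge nat \oo _ R u l 0 ul; apply; exact: nearW.
have -> : (fun j => u j `^ a) = (fun t => Num.max 0 t `^ a) \o u.
  by apply/funext => j /=; rewrite (max_idPr (u0 j)).
have := cvg_comp _ _ ul (@continuous_powR_max R a a0 l).
by rewrite (max_idPr l0).
Qed.

Lemma monomial_representation (R : realType) n (F : 'rV[R]_n -> R) (B : R) :
  completely_monotone F -> (forall p, (orthant n)° p -> F p <= B) ->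
  exists (M : R) (X : 'I_n -> R -> R),
  [/\ 0 <= M, forall l, measurable_fun `[0, M[ (X l),
      forall om l, 0 <= om < M -> 0 <= X l om <= 1 &
      forall c, (\int[lebesgue_measure]_(om in `[0%R, M[)
        \prod_(l < n) X l om `^ (dyadic_rV R c ord0 l))%R = F (dyadic_rV R c)].
Proof.
move=> cmF FB.
have [L [HL cvgL]] := approximating_functionals cmF FB.
have [Lam HLam LamE] := limit_positive_functional HL.
(* The coordinates are adjoined to the dyadic monomials. Both then converge along the same points,
   which forces the limit of a monomial to be the monomial in the limits of the coordinates. *)
pose f (c : ({ffun 'I_n -> nat} * nat) + 'I_n) (v : 'I_n -> R) : R :=
  match c with inl c => \prod_(l < n) v l `^ (dyadic_rV R c ord0 l) | inr l => v l end.
have dy0 (c : {ffun 'I_n -> nat} * nat) l : 0 < dyadic_rV R c ord0 l by rewrite mxE divr_gt0// exprn_gt0.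
have f01 c v : @unit_cube R n v -> 0 <= f c v <= 1.
  move=> v01; case: c => [c|l] /=; last exact: v01.
  apply: (big_ind (fun t : R => 0 <= t <= 1)) => [|s t /andP[s0 s1] /andP[r0 r1]|l _].
  - by rewrite ler01 lexx.
  - by rewrite mulr_ge0//= mulr_ile1.
  rewrite powR_ge0/=.
  have /andP[v0 v1] := v01 l.
  by have := @ge0_ler_powR R _ (ltW (dy0 c l)) (v l) 1; rewrite powR1 !nnegrE; apply.
have [M [x [X [M0 mX cX iX]]]] := functional_representation (fun=> 0) HLam f01.
exists M, (fun l => X (inr l)); split=> // [om l omM|c].
  have [Vx /(_ (inr l)) cx] := cX om omM.
  apply/andP; split.
    have := @cvgr_to_ge nat \oo _ R _ _ 0 cx; apply; apply: nearW => j.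
    by have /andP[] := Vx j l.
  have := @cvgr_to_le nat \oo _ R _ _ 1 cx; apply; apply: nearW => j.
  by have /andP[] := Vx j l.
have <- : Lam (f (inl c)) = F (dyadic_rV R c).
  apply: LamE; last exact: cvgL.
  by exists 1 => v /(f01 (inl c))/andP[? ?]; rewrite ger0_norm.
rewrite -iX; apply: eq_Rintegral => om /set_mem/=; rewrite in_itv/= => omM.
have [Vx cx] := cX om omM.
have c1 := cx (inl c).
have c2 : f (inl c) (x j om) @[j --> \oo] --> \prod_(l < n) X (inr l) om `^ (dyadic_rV R c ord0 l).
  apply: (@cvgr_prod R nat _ \oo) => l; apply: cvg_powR => //; last exact: cx (inr l).
  by move=> j; have /andP[] := Vx j l.
exact: (cvg_unique _ c2 c1).
Qed.

(* [x_l = (- ln X_l)^(1/alpha)] turns the monomials into exponentials; the points where some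
   [X_l] vanishes are dropped, since all the exponents are positive. *)
Lemma laplace_representation (R : realType) n (alpha : R) (F : 'rV[R]_n -> R) (B : R) :
  0 < alpha ->
  completely_monotone F -> (forall p, (orthant n)° p -> F p <= B) ->
  exists mu : {measure set (borel_rV R n) -> \bar R},
  [/\ (mu setT < +oo)%E, supported_in mu (orthant n) &
      forall c, (\int[mu]_(x in (orthant n : set (borel_rV R n)))
        (expR (- (\sum_(l < n) dyadic_rV R c ord0 l * (x : 'rV[R]_n) ord0 l `^ alpha)))%:E)%E
        = (F (dyadic_rV R c))%:E].
Proof.
move=> alpha_gt0 cmF FB.
have [M [X [M0 mX X01 iX]]] := monomial_representation cmF FB.
pose D : set R := `[0, M[%classic.
have mD : measurable D by exact: measurable_itv.
pose A : set R := D `&` [set om | forall l, 0 < X l om].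
have mA : measurable A.
  have -> : A = D `&` \bigcap_(l in [set: 'I_n]) (D `&` X l @^-1` `]0, +oo[%classic).
    apply/seteqP; split=> om /= [Dom h]; split=> // l.
      by move=> _; split=> //=; rewrite in_itv/= andbT; exact: h.
    by have [_ /=] := h l Logic.I; rewrite in_itv/= andbT.
  apply: measurableI => //; apply: fin_bigcap_measurable => // l _.
  by apply: (mX l) => //; exact: measurable_itv.
pose zl l om := (- ln (X l om)) `^ alpha^-1.
(* Outside [A] the value is 0, which keeps [z] in the orthant; these points carry no mass once
   Lebesgue measure is restricted to [A]. *)
pose z (om : R) : 'rV[R]_n := \row_l (zl l \_ A) om.
have mz : measurable_fun setT (z : measurableTypeR R -> borel_rV R n).
  apply: measurable_fun_rV => l; under eq_fun do rewrite mxE.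
  apply/(measurable_restrictT _ mA).
  apply: (measurableT_comp (measurable_powR _)); apply: measurable_funN.
  apply: (measurableT_comp (@measurable_ln R)).
  by apply: measurable_funS (mX l) => // om [].
pose nu : {measure set (measurableTypeR R) -> \bar R} := mrestr (@lebesgue_measure R) mA.
pose mu : {measure set (borel_rV R n) -> \bar R} :=
  measure_function_pushforward__canonical__measure_function_Measure nu mz.
have finD : (lebesgue_measure D < +oo)%E.
  rewrite /D lebesgue_measure_itv/=; case: ifP => _; last exact: ltry.
  by rewrite -EFinB ltry.
have Oz om : orthant n (z om).
  by move=> l; rewrite mxE patchE; case: ifP => // _; exact: powR_ge0.
exists mu; split.
- rewrite /= /pushforward preimage_setT /nu /mrestr setTI.
  apply: (@le_lt_trans _ _ (lebesgue_measure D)).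
    by apply: le_measure; rewrite ?inE// => om [].
  exact: finD.
- rewrite /supported_in /= /pushforward.
  have -> : z @^-1` (~` orthant n) = set0 by apply/seteqP; split=> // om /=; apply.
  exact: measure0.
move=> c; rewrite -iX.
pose phi (x : 'rV[R]_n) := expR (- (\sum_(l < n) dyadic_rV R c ord0 l * x ord0 l `^ alpha)).
have mphi : measurable_fun setT (phi : borel_rV R n -> R).
  apply: (measurableT_comp (@measurable_expR R)); apply: measurable_funN.
  apply: measurable_sum => l; apply: measurable_funM => //.
  apply: (measurableT_comp (measurable_powR alpha)); exact: measurable_coord.
rewrite (@ge0_integral_pushforward _ _ (measurableTypeR R) (borel_rV R n) R z mz nu _ (EFin \o phi)); first last.
- by move=> y _; rewrite lee_fin expR_ge0.
- by apply/measurable_EFinP; apply: measurable_funTS.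
- exact: measurable_orthant.
have -> : z @^-1` orthant n = setT by apply/seteqP; split=> // om _; exact: Oz.
rewrite ge0_integral_mrestr//; first last.
- by move=> y _; rewrite lee_fin expR_ge0.
- by apply/measurable_EFinP; exact: (measurableT_comp mphi mz).
pose g om := \prod_(l < n) X l om `^ (dyadic_rV R c ord0 l).
have g01 om : D om -> 0 <= g om <= 1.
  rewrite /D/= in_itv/= => omD.
  apply: (big_ind (fun t : R => 0 <= t <= 1)) => [|s t /andP[s0 s1] /andP[r0 r1]|l _].
  - by rewrite ler01 lexx.
  - by rewrite mulr_ge0//= mulr_ile1.
  have /andP[v0 v1] := X01 om l omD; rewrite powR_ge0/=.
  have c0 : 0 <= dyadic_rV R c ord0 l by rewrite mxE divr_ge0// exprn_ge0.
  by have := @ge0_ler_powR R _ c0 (X l om) 1; rewrite powR1 !nnegrE; apply.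
have ig : lebesgue_measure.-integrable D (EFin \o g).
  apply: (@bounded_integrable _ _ _ lebesgue_measure D g 1) => //.
  - apply: measurable_prod => l _.
    by apply: (measurableT_comp (measurable_powR _)); exact: mX.
  by move=> om /g01/andP[? ?]; rewrite ger0_norm.
rewrite /Rintegral fineK; last exact: integrable_fin_num ig.
rewrite setTI integral_mkcond [RHS]integral_mkcond; congr integral.
apply/funext => om; rewrite !patchE; case: ifPn => [|/negP omA].
  rewrite inE => -[Dom Xpos]; rewrite mem_set//=; congr EFin.
  rewrite /phi /g -sumrN expR_sum; apply: eq_bigr => l _.
  have -> : z om ord0 l = zl l om by rewrite mxE patchE mem_set.
  rewrite /zl -powRrM mulVf ?gt_eqF// powRr1.
    by rewrite mulrN opprK [RHS]/powR gt_eqF.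
  by rewrite oppr_ge0 ln_le0//; have /andP[] := X01 om l Dom.
case: ifPn => //; rewrite inE => Dom /=; congr EFin.
have [l Xl] : exists l, X l om = 0.
  apply/not_existsP => h; apply: omA; rewrite inE; split=> // l.
  have /andP[X0 _] := X01 om l Dom; rewrite lt_neqAle X0 andbT eq_sym.
  by apply/eqP; exact: h.
rewrite (bigD1 l)//= Xl powR0 ?mul0r// mxE gt_eqF// divr_gt0// exprn_gt0//.
Qed.

(** * Convex functions on the half-line and their right derivatives *)

Section convex_halfline.
Context {R : realType} (f : R -> R).
Hypothesis convf : forall x y t, 0 < x -> 0 < y -> 0 <= t -> t <= 1 ->
  f (t * x + (1 - t) * y) <= t * f x + (1 - t) * f y.

Lemma convex_three_points a b c : 0 < a -> a <= b -> b < c ->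
  (c - a) * f b <= (c - b) * f a + (b - a) * f c.
Proof.
move=> a0 ab bc; have ca : 0 < c - a by lra.
have := @convf a c ((c - b) / (c - a)) a0 (lt_trans (lt_le_trans a0 ab) bc).
have cb : 0 <= c - b by lra.
rewrite (divr_ge0 cb (ltW ca)) => /(_ isT).
rewrite ler_pdivrMr// mul1r lerD2l lerN2 ab => /(_ isT).
have -> : 1 - (c - b) / (c - a) = (b - a) / (c - a) by field; rewrite gt_eqF.
have -> : (c - b) / (c - a) * a + (b - a) / (c - a) * c = b by field; rewrite gt_eqF.
rewrite -(ler_pM2l ca) => /le_trans; apply.
by rewrite le_eqVlt; apply/orP; left; apply/eqP; field; rewrite gt_eqF.
Qed.

Lemma convex_slope_le t h k : 0 < t -> 0 < h -> h <= k ->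
  h^-1 * (f (t + h) - f t) <= k^-1 * (f (t + k) - f t).
Proof.
move=> t0 h0; rewrite le_eqVlt => /predU1P[->//|hk].
have k0 : 0 < k by exact: lt_trans hk.
have := @convex_three_points t (t + h) (t + k) t0.
rewrite lerDl ltrD2l => /(_ (ltW h0) hk) H.
rewrite mulrC ler_pdivrMr// -mulrA [leRHS]mulrC ler_pdivlMr//; nra.
Qed.

(** The right slopes at [t] are monotone in [h] and bounded below by the slope on [[t / 2, t]], an
    interval that stays inside the open half-line. *)
Lemma cvg_rderive_convex t : 0 < t ->
  h^-1 * (f (t + h) - f t) @[h --> 0^'+] --> rderive f t.
Proof.
move=> t0; pose g h := h^-1 * (f (t + h) - f t).
have cg : cvg (g h @[h --> 0^'+]).
  apply/cvg_ex; eexists; apply: (@nondecreasing_at_right_cvgr R g 0 (BLeft 1)).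
  - by rewrite bnd_simp.
  - move=> x y; rewrite !in_itv/= => /andP[x0 _] /andP[y0 _] xy.
    exact: convex_slope_le.
  exists ((t / 2)^-1 * (f t - f (t / 2))) => _ /= [h + <-].
  rewrite in_itv/= => /andP[h0 _].
  have := @convex_three_points (t / 2) t (t + h).
  move=> /(_ (divr_gt0 t0 (ltr0n R 2))).
  have t2 : 0 < t / 2 by exact: divr_gt0.
  have e2 : t = t / 2 + t / 2 by field.
  rewrite /g; move: t2 e2; set s := t / 2 => s0 ->.
  rewrite lerDl (ltW s0) ltrDl h0 => /(_ isT isT) H.
  rewrite mulrC ler_pdivrMr// -mulrA [leRHS]mulrC ler_pdivlMr//; nra.
exact: cg.
Qed.

Lemma rderive_slope_le a b : 0 < a -> a <= b -> rderive f a * (b - a) <= f b - f a.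
Proof.
move=> a0; rewrite le_eqVlt => /predU1P[->|ab]; first by rewrite !subrr mulr0.
have ba : 0 < b - a by lra.
rewrite -ler_pdivlMr// mulrC.
have := @cvgr_to_le _ _ _ R _ _ ((b - a)^-1 * (f b - f a)) (cvg_rderive_convex a0).
apply; near=> h; have -> : b = a + (b - a) by ring.
rewrite [X in X - a]addrC addrK; apply: convex_slope_le => //.
by apply: ltW; near: h; exact: nbhs_right_lt.
Unshelve. all: by end_near. Qed.

Lemma slope_le_rderive a b : 0 < a -> a <= b -> f b - f a <= rderive f b * (b - a).
Proof.
move=> a0; rewrite le_eqVlt => /predU1P[->|ab]; first by rewrite !subrr mulr0.
have ba : 0 < b - a by lra.
rewrite -ler_pdivrMr//.
have := @cvgr_to_ge _ _ _ R _ _ ((f b - f a) / (b - a)) (cvg_rderive_convex (lt_trans a0 ab)).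
apply; near=> h.
have h0 : 0 < h by near: h; exact: nbhs_right_gt.
have := @convex_three_points a b (b + h) a0 (ltW ab).
rewrite ltrDl => /(_ h0) H.
rewrite ler_pdivrMr// -mulrA ler_pdivlMl//; nra.
Unshelve. all: by end_near. Qed.

End convex_halfline.

(* The increments of two functions whose slopes are squeezed by the same [G] agree: on a
   subdivision of mesh [d] they differ by at most [d * (G b - G a)]. *)
Lemma eq_increments_slope (R : realType) (f g G : R -> R) :
  (forall a b, 0 < a -> a <= b -> G a * (b - a) <= f b - f a <= G b * (b - a)) ->
  (forall a b, 0 < a -> a <= b -> G a * (b - a) <= g b - g a <= G b * (b - a)) ->
  forall a b, 0 < a -> a <= b -> f b - f a = g b - g a.
Proof.
move=> Hf Hg a b a0 ab.
have step d N : 0 <= d ->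
    `|f (a + N%:R * d) - g (a + N%:R * d) - (f a - g a)| <= (G (a + N%:R * d) - G a) * d.
  move=> d0; elim: N => [|N IH]; first by rewrite mul0r addr0 !subrr normr0 mul0r.
  have x0 : 0 < a + N%:R * d by rewrite ltr_wpDr// mulr_ge0.
  have xy : a + N%:R * d <= a + N.+1%:R * d by rewrite lerD2l ler_wpM2r// ler_nat.
  have yx : a + N.+1%:R * d - (a + N%:R * d) = d by rewrite -natr1; ring.
  have := Hf _ _ x0 xy; have := Hg _ _ x0 xy; rewrite yx.
  move: IH; rewrite !ler_norml.
  move: (f (a + N.+1%:R * d)) (g (a + N.+1%:R * d)) (G (a + N.+1%:R * d)) => f1 g1 G1.
  move: (f (a + N%:R * d)) (g (a + N%:R * d)) (G (a + N%:R * d)) => f2 g2 G2.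
  rewrite !mulrBl; move=> /andP[h1 h2] /andP[h3 h4] /andP[h5 h6].
  by apply/andP; split; lra.
pose K := (G b - G a) * (b - a).
have KN N : `|f b - g b - (f a - g a)| <= K / N.+1%:R.
  have := @step ((b - a) / N.+1%:R) N.+1.
  rewrite divr_ge0 ?subr_ge0// => /(_ isT).
  have -> : a + N.+1%:R * ((b - a) / N.+1%:R) = b by rewrite mulrC divfK ?pnatr_eq0//; ring.
  by rewrite mulrA.
suff : f b - g b - (f a - g a) = 0 by lra.
apply/eqP; rewrite -normr_le0.
have cK : K / N.+1%:R @[N --> \oo] --> 0.
  rewrite -[X in _ --> X](mulr0 K); apply: cvgM; first exact: cvg_cst.
  exact: cvg_harmonic.
have := @cvgr_to_ge nat \oo _ R (fun N => K / N.+1%:R) 0 `|f b - g b - (f a - g a)| cK.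
by apply; apply: nearW => N; exact: KN.
Qed.

(** * Stieltjes integrals over the open half-line under scaling *)

Section stieltjes_halfline.
Context {R : realType}.
Implicit Types G : cumulative R R.

Lemma cumulative_at0 G (g : R -> R) : (forall t, 0 < t -> G t = g t) ->
  g t @[t --> 0^'+] --> 0 -> G 0 = 0.
Proof.
move=> Gg g0; have rG : G t @[t --> 0^'+] --> G 0 := cumulative_is_right_continuous G 0.
suff h : G t @[t --> 0^'+] --> (0 : R) by exact: (cvg_unique _ rG h).
apply: cvg_trans g0; apply: near_eq_cvg.
by near=> t; rewrite Gg//; near: t; exact: nbhs_right_gt.
Unshelve. all: by end_near. Qed.

(** An extension [G] is arbitrary at negative arguments. Freezing it there removes the mass of
    []-oo, 0]], so that the whole measure, and not just its restriction, can be an image of a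
    measure on the half-line. *)
Definition clamp0 G (t : R) : R := G (Num.max t 0).

Section clamp0_cumulative.
Variable G : cumulative R R.

Let nd : nondecreasing (clamp0 G).
Proof.
move=> s t st; apply: cumulative_is_nondecreasing.
by rewrite ge_max !le_max st lexx orbT.
Qed.

Let rc : right_continuous (clamp0 G).
Proof.
move=> t; have [t0|t0] := ltP t 0.
  rewrite /clamp0 (max_idPr (ltW t0)); apply: cvg_near_cst; near=> s.
  by rewrite (max_idPr _)// ltW//; near: s; exact: nbhs_right_lt.
rewrite /clamp0 (max_idPl t0); apply: cvg_trans (cumulative_is_right_continuous G t).
apply: near_eq_cvg; near=> s.
rewrite (max_idPl _)// (le_trans t0)// ltW//; near: s; exact: nbhs_right_gt.
Unshelve. all: by end_near. Qed.

HB.instance Definition _ := isCumulative.Build R _ R (clamp0 G) nd rc.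

End clamp0_cumulative.

Let halfline_pushforward G G' (c : R) (phi : R -> R) : 0 < c ->
  (forall t, 0 < t -> G' (c * t) = G t) ->
  measurable_fun setT phi -> (forall t, 0 <= phi t) ->
  (\int[lebesgue_stieltjes_measure (clamp0 G')]_(t in `]0%R, +oo[) (phi t)%:E =
   \int[lebesgue_stieltjes_measure G]_(t in `]0%R, +oo[) (phi (c * t))%:E)%E.
Proof.
move=> c0 GG.
have cc : c * t @[t --> 0^'+] --> 0^'+.
  move=> P [e /= e0 HP]; exists (e / c) => /=; first exact: divr_gt0.
  move=> t /=; rewrite sub0r normrN => te t0; apply: HP => /=; last exact: mulr_gt0.
  by rewrite sub0r normrN normrM gtr0_norm// mulrC -ltr_pdivlMr.
have G00 : G' 0 = G 0.
  have c1 := cvg_comp _ _ cc (cumulative_is_right_continuous G' 0).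
  have rG : G t @[t --> 0^'+] --> G 0 := cumulative_is_right_continuous G 0.
  suff h : G' (c * t) @[t --> 0^'+] --> G 0 by exact: (cvg_unique _ c1 h).
  apply: cvg_trans rG; apply: near_eq_cvg; near=> t; rewrite /= GG//; near: t; exact: nbhs_right_gt.
have GE t : 0 <= t -> G' (c * t) = G t.
  by rewrite le_eqVlt => /predU1P[<-|/GG//]; rewrite mulr0.
move=> mphi phi0.
have mE : measurable (`]0, +oo[%classic : set (measurableTypeR R)) by exact: measurable_itv.
pose nu : {measure set (measurableTypeR R) -> \bar R} := mrestr (lebesgue_stieltjes_measure G) mE.
have ms : measurable_fun setT (fun t : measurableTypeR R => c * t : R).
  exact: measurable_funM.
rewrite (@ge0_integral_lebesgue_stieltjes R _ (measurableTypeR R) nu (fun t => c * t) (clamp0 G'))//.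
  have -> : ( *%R c) @^-1` `]0, +oo[%classic = `]0, +oo[%classic.
    by apply/seteqP; split=> t; rewrite /= !in_itv/= !andbT pmulr_rgt0.
  rewrite ge0_integral_mrestr ?setIid//.
  - by apply/measurable_EFinP; apply: measurable_funTS; exact: (measurableT_comp mphi ms).
  - by move=> t _; rewrite lee_fin.
move=> a b ab; rewrite /= /mrestr.
have max_div x : Num.max x 0 = c * Num.max (x / c) 0.
  by rewrite maxr_pMr ?ltW// mulr0 mulrCA divff ?mulr1// gt_eqF.
have gE x : clamp0 G' x = G (Num.max (x / c) 0) by rewrite /clamp0 max_div GE// le_max lexx orbT.
rewrite !gE.
rewrite -lebesgue_stieltjes_itv; last by rewrite ge_max !le_max lexx ler_pM2r ?invr_gt0// ab orbT.
congr (lebesgue_stieltjes_measure G _); apply/seteqP; split=> t /=; rewrite !in_itv/= ?andbT.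
  move=> [/andP[h1 h2] t0]; rewrite gt_max le_max t0 andbT.
  by rewrite ltr_pdivrMr// ler_pdivlMr// mulrC h1 h2.
rewrite gt_max le_max => /andP[/andP[h1 t0]].
rewrite ltr_pdivrMr// in h1; rewrite (leNgt t 0) t0 orbF ler_pdivlMr// => h2.
by rewrite mulrC h1 h2.
Unshelve. all: by end_near. Qed.

Lemma stieltjes_scale G G' (c : R) (phi : R -> R) : 0 < c ->
  (forall t, 0 < t -> G' (c * t) = G t) ->
  measurable_fun setT phi -> (forall t, 0 <= phi t) ->
  (\int[lebesgue_stieltjes_measure G']_(t in `]0%R, +oo[) (phi t)%:E =
   \int[lebesgue_stieltjes_measure G]_(t in `]0%R, +oo[) (phi (c * t))%:E)%E.
Proof.
move=> c0 GG mphi phi0.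
rewrite -(halfline_pushforward c0 GG)//.
(* The case [c = 1] shows that clamping does not change integrals over the open half-line. *)
rewrite (@halfline_pushforward G' G' 1)// => [|t _]; last by rewrite mul1r.
by under [in RHS]eq_integral do rewrite mul1r.
Qed.

End stieltjes_halfline.

(** * Bernstein approximation and measures with equal moments *)

Lemma cvg_Rintegral_dominated (R : realType) d (Y : measurableType d)
    (mu : {measure set Y -> \bar R}) (D : set Y) (f : nat -> Y -> R) (f0 g : Y -> R) :
  measurable D -> (forall k, measurable_fun D (f k)) -> measurable_fun D f0 ->
  (forall x, D x -> f k x @[k --> \oo] --> f0 x) ->
  mu.-integrable D (EFin \o g) -> (forall k x, D x -> `|f k x| <= g x) ->
  (\int[mu]_(x in D) f k x)%R @[k --> \oo] --> (\int[mu]_(x in D) f0 x)%R.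
Proof.
move=> mD mf mf0 ff0 ig fg.
have [] := @dominated_convergence _ Y R mu D mD
  (fun k x => (f k x)%:E) (EFin \o f0) (EFin \o g).
- by move=> k; apply/measurable_EFinP.
- exact/measurable_EFinP.
- by apply: aeW => x Dx; apply: cvg_EFin; [exact: nearW|exact: ff0].
- exact: ig.
- by apply: aeW => x k Dx; rewrite lee_fin; exact: fg.
move=> if0 _ cv.
have /fine_cvgP[_] : ((\int[mu]_(x in D) (f k x)%:E)%E @[k --> \oo] -->
   (\int[mu]_(x in D) (f0 x))%R%:E)%classic.
  rewrite /Rintegral fineK; first exact: cv.
  exact: integrable_fin_num.
by [].
Qed.

Section bernstein.
Context {R : realType}.
Implicit Types (f g : nat -> R) (u a : R).

(* [bernstein N f] is [\sum_(i <= N) f i *: ('C(N, i) X^i (1 - X)^(N - i))], presented by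
   Pascal's recursion. *)
Fixpoint bernstein (N : nat) f : {poly R} :=
  if N is N'.+1 then 'X * bernstein N' (f \o S) + (1 - 'X) * bernstein N' f else (f 0%N)%:P.

Lemma hornerE_bernstein N f u : (bernstein N.+1 f).[u] =
  u * (bernstein N (f \o S)).[u] + (1 - u) * (bernstein N f).[u].
Proof. by rewrite /= !hornerE. Qed.

Lemma bernstein_le N f g u : 0 <= u <= 1 -> (forall i, (i <= N)%N -> f i <= g i) ->
  (bernstein N f).[u] <= (bernstein N g).[u].
Proof.
move=> /andP[u0 u1]; elim: N f g => [|N IH] f g fg; first by rewrite /= !hornerC fg.
rewrite !hornerE_bernstein lerD// ler_wpM2l ?subr_ge0//; apply: IH => i iN; apply: fg => //.
exact: leqW.
Qed.

Lemma bernstein_cst N a u : (bernstein N (fun=> a)).[u] = a.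
Proof.
elim: N => [|N IH]; first by rewrite hornerC.
by rewrite hornerE_bernstein !IH; ring.
Qed.

Lemma bernstein_affine N f u a (b : R) :
  (bernstein N (fun i => a + b * f i)).[u] = a + b * (bernstein N f).[u].
Proof.
elim: N f => [|N IH] f; first by rewrite /= !hornerC.
by rewrite !hornerE_bernstein (IH (f \o S)) IH; ring.
Qed.

(** The second moment about [a] of the binomial law with parameters [N] and [u]: squared bias plus
    variance. *)
Lemma bernstein_sqr N u a : (bernstein N (fun i => (i%:R - a) ^+ 2)).[u] =
  (N%:R * u - a) ^+ 2 + N%:R * u * (1 - u).
Proof.
elim: N a => [|N IH] a; first by rewrite /= hornerC; ring.
rewrite hornerE_bernstein IH.
have -> : (fun i => (i%:R - a) ^+ 2) \o S = (fun i => (i%:R - (a - 1)) ^+ 2).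
  by apply/funext => i /=; rewrite -natr1; congr (_ ^+ 2); ring.
by rewrite IH -natr1; ring.
Qed.

Variables (psi : R -> R) (C : R).
Hypothesis psiC : forall t, 0 <= t <= 1 -> `|psi t| <= C.

Definition bernstein_approx N : {poly R} := bernstein N (fun i => psi (i%:R / N%:R)).

Let node01 i N : (i <= N)%N -> 0 <= (i%:R / N%:R : R) <= 1.
Proof.
move=> iN; rewrite divr_ge0//=; case: N iN => [|N] iN; first by rewrite invr0 mulr0.
by rewrite ler_pdivrMr// mul1r ler_nat.
Qed.

Lemma bernstein_approx_le N u : 0 <= u <= 1 -> `|(bernstein_approx N).[u]| <= C.
Proof.
move=> u01; rewrite ler_norml; apply/andP; split.
  rewrite -[leLHS](bernstein_cst N _ u); apply: bernstein_le => // i iN.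
  by have := psiC (node01 iN); rewrite ler_norml => /andP[].
rewrite -[leRHS](bernstein_cst N _ u); apply: bernstein_le => // i iN.
by have := psiC (node01 iN); rewrite ler_norml => /andP[].
Qed.

Lemma cvg_bernstein_approx u : 0 <= u <= 1 -> {for u, continuous psi} ->
  (bernstein_approx N).[u] @[N --> \oo] --> psi u.
Proof.
move=> u01 cu; have C0 : 0 <= C by apply: le_trans (psiC u01).
apply/cvgrPdist_le => e e0.
have /nbhs_ballP[d /= d0 Hd] : \forall t \near u, `|psi u - psi t| <= e / 2.
  by move/cvgrPdist_le: cu; apply; exact: divr_gt0.
(* Chebyshev's argument: at distance at least [d] from [u] the oscillation [2 * C] is at most
   [K * (t - u)^2], and the binomial mean of that square is [u (1 - u) / N]. *)
pose K := 2 * C / d ^+ 2.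
have K0 : 0 <= K by rewrite divr_ge0 ?mulr_ge0 ?exprn_ge0// ltW.
have pt t : 0 <= t <= 1 -> `|psi t - psi u| <= e / 2 + K * (t - u) ^+ 2.
  move=> t01; have [tu|tu] := ltP `|u - t| d.
    rewrite distrC (le_trans (Hd _ tu))// lerDl mulr_ge0// sqr_ge0//.
  apply: (@le_trans _ _ (C + C)).
    by rewrite (le_trans (ler_normB _ _))// lerD// psiC.
  rewrite (@le_trans _ _ (K * (t - u) ^+ 2))//; last by rewrite lerDr ltW// divr_gt0.
  rewrite /K mulrAC ler_pdivlMr ?exprn_gt0// -[(t - u) ^+ 2]real_normK ?num_real// distrC.
  have h : d ^+ 2 <= `|u - t| ^+ 2 by rewrite lerXn2r// nnegrE// ltW.
  by have := ler_wpM2l (mulr_ge0 (ler0n R 2) C0) h; lra.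
have bd N : (0 < N)%N -> `|psi u - (bernstein_approx N).[u]| <= e / 2 + K / N%:R.
  move=> N0; have N0' : 0 < N%:R :> R by rewrite ltr0n.
  pose q i : R := e / 2 + K / N%:R ^+ 2 * (i%:R - N%:R * u) ^+ 2.
  have qE i : (i <= N)%N -> `|psi (i%:R / N%:R) - psi u| <= q i.
    move=> iN; apply: (le_trans (pt _ (node01 iN))); rewrite /q lerD2l.
    rewrite le_eqVlt; apply/orP; left; apply/eqP; field; rewrite gt_eqF//.
  have qu : (bernstein N q).[u] <= e / 2 + K / N%:R.
    rewrite /q bernstein_affine bernstein_sqr subrr expr0n/= add0r lerD2l.
    rewrite ler_pdivlMr//.
    have -> : K / N%:R ^+ 2 * (N%:R * u * (1 - u)) * N%:R = K * (u * (1 - u)).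
      by field; rewrite gt_eqF.
    by rewrite ler_piMr//; case/andP: u01 => u0 u1; nra.
  rewrite distrC ler_norml; apply/andP; split.
    suff : psi u + -1 * (bernstein N q).[u] <= (bernstein_approx N).[u] by lra.
    rewrite -bernstein_affine; apply: bernstein_le => // i iN.
  by have := qE i iN; rewrite ler_norml => /andP[]; lra.
  suff : (bernstein_approx N).[u] <= psi u + 1 * (bernstein N q).[u] by lra.
  rewrite -bernstein_affine; apply: bernstein_le => // i iN.
  by have := qE i iN; rewrite ler_norml => /andP[]; lra.
have [M _ HM] := near_infty_natSinv_lt (PosNum (divr_gt0 (divr_gt0 e0 (ltr0n R 2)) (ltr_wpDl K0 ltr01))).
exists M.+1 => // -[//|N] MN; apply: (le_trans (bd _ _)) => //.
have /= := HM N MN.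
rewrite ltr_pdivlMr ?ltr_wpDl// => h.
have : 0 <= N.+1%:R^-1 :> R by rewrite invr_ge0.
by move: h; set w := N.+1%:R^-1 => h w0; nra.
Qed.

End bernstein.

Section moments.
Context {R : realType} d (Y : measurableType d) (mu : {measure set Y -> \bar R}) (D : set Y)
  (u : Y -> R).
Hypotheses (mD : measurable D) (mu_ : measurable_fun D u) (u01 : forall x, D x -> 0 <= u x <= 1).
Hypothesis iu : mu.-integrable D (EFin \o u).

(** The exponent starts at 1 because only [u], not the constant 1, is assumed integrable. *)
Definition moment (k : nat) : R := (\int[mu]_(x in D) (u x ^+ k.+1))%R.

Let iuX k : mu.-integrable D (EFin \o (fun x => u x ^+ k.+1)).
Proof.
apply: le_integrable iu => //.
  by apply/measurable_EFinP; exact: measurable_funX.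
move=> x Dx /=; have /andP[u0 u1] := u01 Dx.
by rewrite lee_fin !ger0_norm ?exprn_ge0// exprS ler_piMr// exprn_ile1.
Qed.

Lemma integral_poly_moment (p : {poly R}) :
  (\int[mu]_(x in D) (p.[u x] * u x))%R = \sum_(k < size p) p`_k * moment k.
Proof.
have ip k : mu.-integrable D (EFin \o (fun x => p`_k * u x ^+ k.+1)).
  by have := integrableZl mD p`_k (iuX k); apply: eq_integrable.
transitivity (\int[mu]_(x in D) (\sum_(k < size p) p`_k * u x ^+ k.+1))%R.
  apply: eq_Rintegral => x _; rewrite horner_coef mulr_suml; apply: eq_bigr => k _.
  by rewrite exprSr mulrA.
rewrite /Rintegral; under eq_integral do rewrite -sumEFin.
rewrite integral_sum//; last by move=> k; exact: ip.
rewrite (eq_bigr (fun k : 'I_(size p) => (p`_k * moment k)%:E)) ?sumEFin// => k _.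
under eq_integral do rewrite EFinM.
rewrite integralZl//; last exact: iuX.
by rewrite EFinM /moment /Rintegral fineK//; exact: integrable_fin_num (iuX k).
Qed.

Lemma cvg_integral_bernstein (psi : R -> R) (C : R) :
  (forall t, 0 <= t <= 1 -> `|psi t| <= C) ->
  (forall t, 0 <= t <= 1 -> {for t, continuous psi}) -> measurable_fun setT psi ->
  \sum_(k < size (bernstein_approx psi N)) (bernstein_approx psi N)`_k * moment k @[N --> \oo] -->
  (\int[mu]_(x in D) (psi (u x) * u x))%R.
Proof.
move=> psiC cpsi mpsi; under eq_fun do rewrite -integral_poly_moment.
apply: (@cvg_Rintegral_dominated _ _ _ _ _ _ _ (fun x => C * u x)) => //.
- move=> N; apply: measurable_funM => //.
  apply: (measurableT_comp _ mu_) => //; apply: continuous_measurable_fun.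
  exact: continuous_horner.
- by apply: measurable_funM => //; exact: (measurableT_comp mpsi mu_).
- move=> x Dx; apply: cvgM; last exact: cvg_cst.
  by apply: cvg_bernstein_approx (u01 Dx) (cpsi _ (u01 Dx)); exact: psiC.
- by have := integrableZl mD C iu; apply: eq_integrable.
move=> N x Dx; have /andP[u0 _] := u01 Dx.
by rewrite normrM (ger0_norm u0) ler_wpM2r// (bernstein_approx_le psiC)// u01.
Qed.

End moments.

(** For a polynomial in place of [psi] both integrals are the same combination of moments. The
    Bernstein polynomials of [psi] are uniformly bounded and converge pointwise, and [C * u]
    dominates. The two measures may live on different spaces. *)
Lemma eq_integral_moments (R : realType) d1 (Y1 : measurableType d1)
    (mu1 : {measure set Y1 -> \bar R}) (D1 : set Y1) (u1 : Y1 -> R)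
    d2 (Y2 : measurableType d2)
    (mu2 : {measure set Y2 -> \bar R}) (D2 : set Y2) (u2 : Y2 -> R) (psi : R -> R) (C : R) :
  measurable D1 -> measurable_fun D1 u1 -> (forall x, D1 x -> 0 <= u1 x <= 1) ->
  mu1.-integrable D1 (EFin \o u1) ->
  measurable D2 -> measurable_fun D2 u2 -> (forall x, D2 x -> 0 <= u2 x <= 1) ->
  mu2.-integrable D2 (EFin \o u2) ->
  (forall k, moment mu1 D1 u1 k = moment mu2 D2 u2 k) ->
  (forall t, 0 <= t <= 1 -> `|psi t| <= C) ->
  (forall t, 0 <= t <= 1 -> {for t, continuous psi}) -> measurable_fun setT psi ->
  (\int[mu1]_(x in D1) (psi (u1 x) * u1 x))%R = (\int[mu2]_(x in D2) (psi (u2 x) * u2 x))%R.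
Proof.
move=> mD1 mu1_ u1_01 iu1 mD2 mu2_ u2_01 iu2 mm psiC cpsi mpsi.
have c1 := cvg_integral_bernstein mD1 mu1_ u1_01 iu1 psiC cpsi mpsi.
have c2 := cvg_integral_bernstein mD2 mu2_ u2_01 iu2 psiC cpsi mpsi.
have mE : moment mu1 D1 u1 = moment mu2 D2 u2 by apply/funext.
by rewrite mE in c1; exact: (cvg_unique _ c1 c2).
Qed.

Lemma cvg_rV (R : realType) n (u : nat -> 'rV[R]_n) (p : 'rV[R]_n) :
  (forall l, u N ord0 l @[N --> \oo] --> p ord0 l) -> u N @[N --> \oo] --> p.
Proof.
move=> up A /nbhs_ballP[e /= e0 eA].
suff : \forall N \near \oo, forall l, `|p ord0 l - u N ord0 l| < e.
  move=> h; apply: filterS h => N hN; apply: eA; split=> // i l.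
  by rewrite (ord1 i); exact: hN.
apply: filter_forall => l; by move/cvgrPdist_lt: (up l); apply.
Qed.

Lemma cvg_dyadic_rV (R : realType) n (p : 'rV[R]_n) : orthant n p ->
  exists c : nat -> {ffun 'I_n -> nat} * nat,
  forall l, dyadic_rV R (c N) ord0 l @[N --> \oo] --> p ord0 l.
Proof.
(* As [dyadic_rV] adds 1 to the numerator, this approximates [p] strictly from above, within [2^-N],
   and with positive coordinates even on the faces. *)
move=> Op; exists (fun N => ([ffun l => Num.truncn (p ord0 l * 2 ^+ N)], N)) => l.
apply/cvgrPdist_lt => e e0.
have [M _ HM] := near_infty_natSinv_expn_lt (PosNum e0).
exists M => // N /= MN; have := HM N MN; rewrite mxE /= ffunE => h.
have t0 : 0 < 2 ^+ N :> R by rewrite exprn_gt0.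
have /andP[h1 h2] := truncn_itv (mulr_ge0 (Op l) (ltW t0)).
set m := Num.truncn _ in h1 h2 *.
apply: le_lt_trans h; rewrite distrC ger0_norm; last by rewrite subr_ge0 ler_pdivlMr// ltW.
by rewrite lerBlDr ler_pdivrMr// mulrDl mul1r mulVf ?gt_eqF// -natr1 addrC lerD2l.
Qed.

(** * The gain divided by [u], as a test function *)

Section payoff_ratio.
Context {R : realType} (alpha tau : R).
Hypotheses (alpha_gt0 : 0 < alpha) (tau_gt0 : 0 < tau).

(* The continuous extension to all of [R] of the ratio [(tau - s)_+ / u], where
   [u = exp (- s^alpha)] determines [s]; the ratio vanishes for [u <= exp (- tau^alpha)]. *)
Definition payoff_ratio (u : R) : R :=
  let w := Num.max (expR (- tau `^ alpha)) u in
  Num.max 0 (tau - (Num.max 0 (- ln w)) `^ alpha^-1) / w.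

Lemma payoff_ratioE (s : R) : 0 <= s ->
  payoff_ratio (expR (- s `^ alpha)) * expR (- s `^ alpha) = Num.max 0 (tau - s).
Proof.
move=> s0; rewrite /payoff_ratio.
have key (t : R) : 0 <= t -> (Num.max 0 (- ln (expR (- t `^ alpha)))) `^ alpha^-1 = t.
  move=> t0; rewrite expRK opprK (max_idPr (powR_ge0 _ _)) -powRrM divff ?gt_eqF//.
  by rewrite powRr1.
have [st|ts] := leP s tau.
  have -> : Num.max (expR (- tau `^ alpha)) (expR (- s `^ alpha)) = expR (- s `^ alpha).
    by apply/max_idPr; rewrite ler_expR lerN2 ge0_ler_powR// ?nnegrE ltW.
  by rewrite key// divfK// gt_eqF// expR_gt0.
have -> : Num.max (expR (- tau `^ alpha)) (expR (- s `^ alpha)) = expR (- tau `^ alpha).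
  by apply/max_idPl; rewrite ler_expR lerN2 ge0_ler_powR// ?nnegrE ltW.
rewrite key ?ltW// subrr maxxx mul0r mul0r (max_idPl _)//.
by rewrite subr_le0 ltW.
Qed.

Lemma payoff_ratio_le (u : R) : `|payoff_ratio u| <= tau / expR (- tau `^ alpha).
Proof.
rewrite /payoff_ratio; set w := Num.max _ u; have e0 := expR_gt0 (- tau `^ alpha).
have ew : expR (- tau `^ alpha) <= w by rewrite le_max lexx.
have w0 : 0 < w by exact: lt_le_trans ew.
rewrite ger0_norm; last by rewrite divr_ge0 ?le_max ?lexx// ltW.
rewrite ler_pM ?le_max ?lexx ?invr_ge0 ?(ltW w0)//.
  by rewrite ge_max ltW//= lerBlDr lerDl powR_ge0.
by rewrite lef_pV2 ?posrE.
Qed.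

Lemma continuous_payoff_ratio : continuous payoff_ratio.
Proof.
move=> u.
have e0 := expR_gt0 (- tau `^ alpha).
have cw : Num.max (expR (- tau `^ alpha)) v @[v --> u] --> Num.max (expR (- tau `^ alpha)) u.
  have mE v : Num.max (expR (- tau `^ alpha)) v =
      expR (- tau `^ alpha) + Num.max 0 (v - expR (- tau `^ alpha)).
    by rewrite addr_maxr addr0 subrKC.
  rewrite mE; under eq_fun do rewrite mE.
  apply: cvgD; first exact: cvg_cst.
  have cv : v - expR (- tau `^ alpha) @[v --> u] --> u - expR (- tau `^ alpha).
    by apply: cvgB; [exact: cvg_id|exact: cvg_cst].
  exact: (cvg_comp _ _ cv (@continuous_pos_part R _)).
rewrite /payoff_ratio; set w := Num.max _ u in cw *.
have w0 : 0 < w by rewrite lt_max e0.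
apply: cvgM; last by apply: cvgV => //; rewrite gt_eqF.
have cl : - ln (Num.max (expR (- tau `^ alpha)) v) @[v --> u] --> - ln w.
  by apply: cvgN; exact: (cvg_comp _ _ cw (continuous_ln w0)).
have ai : 0 < alpha^-1 by rewrite invr_gt0.
have cp : (Num.max 0 (- ln (Num.max (expR (- tau `^ alpha)) v))) `^ alpha^-1 @[v --> u]
    --> (Num.max 0 (- ln w)) `^ alpha^-1.
  exact: (cvg_comp _ _ cl (@continuous_powR_max R alpha^-1 ai _)).
have cs : tau - (Num.max 0 (- ln (Num.max (expR (- tau `^ alpha)) v))) `^ alpha^-1 @[v --> u]
    --> tau - (Num.max 0 (- ln w)) `^ alpha^-1.
  by apply: cvgB => //; exact: cvg_cst.
exact: (cvg_comp _ _ cs (@continuous_pos_part R _)).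
Qed.

End payoff_ratio.

(** * The converse implication: identification along rays and extension to the orthant *)

Section sufficiency.
Context {R : realType} {n : nat} (alpha : R) (Pi : 'rV[R]_n -> R -> R) (F : 'rV[R]_n -> R).
Hypotheses (alpha_gt0 : 0 < alpha).
Hypothesis convPi : convex_function (price_domain n) (fun z : 'rV[R]_n * R^o => Pi z.1 z.2).
Hypothesis contPi :
  {within price_domain n, continuous (fun z : 'rV[R]_n * R => Pi z.1 z.2)}.
Hypothesis homPi : forall p p0 lambda, orthant n p -> 0 < p0 -> 0 < lambda ->
  Pi (lambda *: p) (lambda * p0) = lambda * Pi p p0.
Hypothesis Pi0 : forall p, (orthant n)° p ->
  Pi p p0 @[p0 --> 0^'+] --> 0 /\ rderive (Pi p) p0 @[p0 --> 0^'+] --> 0.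
Hypothesis stF : forall p, orthant n p ->
  is_stieltjes_integral (rderive (Pi (powR_rV alpha^-1 p)))
    (fun tau => expR (- tau `^ alpha)) (F p).

Let q c := powR_rV alpha^-1 (dyadic_rV R (n := n) c).

(** The code of [(k+1) p]: codes store numerators minus one, hence the [.-1], and the factor [k.+1]
    matches the exponent in [moment]. *)
Let multiple k (c : {ffun 'I_n -> nat} * nat) : {ffun 'I_n -> nat} * nat :=
  ([ffun l => (k.+1 * (c.1 l).+1).-1], c.2).

Let dyadic_multiple k c : dyadic_rV R (multiple k c) = k.+1%:R *: dyadic_rV R c.
Proof.
apply/rowP => l; rewrite !mxE.
have -> : ((multiple k c).1 l).+1 = (k.+1 * (c.1 l).+1)%N by rewrite ffunE prednK ?muln_gt0.
by rewrite natrM mulrA.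
Qed.

Let dyadic_gt0 c l : 0 < dyadic_rV R (n := n) c ord0 l.
Proof. by rewrite mxE divr_gt0// exprn_gt0. Qed.

Let orthant_dyadic c : orthant n (dyadic_rV R c).
Proof. by move=> l; exact/ltW/dyadic_gt0. Qed.

Let q_gt0 c l : 0 < q c ord0 l.
Proof. by rewrite mxE powR_gt0. Qed.

Let orthant_q c : orthant n (q c).
Proof. by move=> l; exact/ltW/q_gt0. Qed.

Let interior_q c : (orthant n)° (q c).
Proof. by apply/interior_orthantE; exact: q_gt0. Qed.

Let scale k : R := k.+1%:R `^ alpha^-1.

Let scale_gt0 k : 0 < scale k. Proof. by rewrite powR_gt0. Qed.

Let q_multiple k c : q (multiple k c) = scale k *: q c.
Proof.
apply/rowP => l; by rewrite /q dyadic_multiple !mxE powRM// divr_ge0// exprn_ge0.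
Qed.

Let convexPi p x y t : orthant n p -> 0 < x -> 0 < y -> 0 <= t -> t <= 1 ->
  Pi p (t * x + (1 - t) * y) <= t * Pi p x + (1 - t) * Pi p y.
Proof.
move=> Op x0 y0 t0 t1.
have dom z : 0 < z -> price_domain n ((p, z) : 'rV[R]_n * R).
  by move=> z0; split=> //=; rewrite in_itv/= z0.
have := (convex_functionP _ _).1 convPi t (p, x) (p, y) (dom _ x0) (dom _ y0) t0 t1.
by rewrite /= -scalerDl subrKC scale1r.
Qed.

(** [Pi] is homogeneous of degree 1, so its derivative in the last argument has degree 0; convexity
    guarantees that the limit defining [rderive] exists. *)
Let rderive_scale p l t : orthant n p -> 0 < l -> 0 < t ->
  rderive (Pi (l *: p)) (l * t) = rderive (Pi p) t.
Proof.
move=> Op l0 t0; apply: cvg_lim => //.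
have c0 : l^-1 * h @[h --> 0^'+] --> 0^'+.
  move=> P [e /= e0 HP]; exists (l * e) => /=; first exact: mulr_gt0.
  move=> h /=; rewrite sub0r normrN => te h0; apply: HP => /=; last by rewrite mulr_gt0 ?invr_gt0.
  by rewrite sub0r normrN normrM gtr0_norm ?invr_gt0// ltr_pdivrMl.
have c1 := cvg_comp _ _ c0 (cvg_rderive_convex (fun x y s => @convexPi p x y s Op) t0).
apply: cvg_trans c1; apply: near_eq_cvg; near=> h.
have h0 : 0 < h by near: h; exact: nbhs_right_gt.
have lh : 0 < l^-1 * h by rewrite mulr_gt0 ?invr_gt0.
have -> : l * t + h = l * (t + l^-1 * h) by rewrite mulrDr mulrA divff ?mul1r// gt_eqF.
rewrite /= !homPi// ?addr_gt0// -mulrBr invfM invrK mulrA [l * _]mulrC.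
by [].
Unshelve. all: by end_near. Qed.

Let G_ c : exists G : cumulative R R, (forall t, 0 < t -> G t = rderive (Pi (q c)) t) /\
  (\int[lebesgue_stieltjes_measure G]_(t in `]0%R, +oo[) (expR (- t `^ alpha))%:E
       = (F (dyadic_rV R c))%:E)%E.
Proof. exact: stF (orthant_dyadic c). Qed.

Let mhalf : measurable (`]0, +oo[%classic : set (measurableTypeR R)).
Proof. exact: measurable_itv. Qed.

Let mexp : measurable_fun setT (fun t : R => expR (- t `^ alpha)).
Proof.
apply: (measurableT_comp (@measurable_expR R)); apply: measurable_funN.
exact: measurable_powR.
Qed.

Section one_ray.
Variables (c : {ffun 'I_n -> nat} * nat) (G : cumulative R R).
Hypothesis GE : forall t, 0 < t -> G t = rderive (Pi (q c)) t.
Hypothesis GF : (\int[lebesgue_stieltjes_measure G]_(t in `]0%R, +oo[) (expR (- t `^ alpha))%:E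
       = (F (dyadic_rV R c))%:E)%E.

Let LS := lebesgue_stieltjes_measure G.
Let E : set (measurableTypeR R) := `]0, +oo[%classic.
Let u (t : R) := expR (- t `^ alpha).

Lemma ray_u01 t : E t -> 0 <= u t <= 1.
Proof. by move=> _; rewrite expR_ge0 -[leRHS]expR0 ler_expR oppr_le0 powR_ge0. Qed.

(** Multiplying the dyadic point by [k + 1] multiplies [q c] by [scale k], the power [1/alpha] of
    [k + 1]. By homogeneity this dilates the Stieltjes measure, and the dilation turns [u t] into
    its power [k + 1]. *)
Lemma ray_integral_expX k :
  (\int[LS]_(t in E) (u t ^+ k.+1)%:E = (F (dyadic_rV R (multiple k c)))%:E)%E.
Proof.
have [Gk [GkE <-]] := G_ (multiple k c).
rewrite (@stieltjes_scale R G Gk (scale k))//.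
- apply: eq_integral => t /set_mem; rewrite /E/= in_itv/= andbT => t0.
  rewrite /u -expRM_natl; congr (expR _)%:E.
  rewrite powRM; [|exact: ltW|exact: ltW].
  by rewrite /scale -powRrM mulVf ?gt_eqF// powRr1// mulrN.
- move=> t t0; rewrite GkE ?mulr_gt0// q_multiple GE//.
  exact: rderive_scale.
Qed.

Lemma ray_integrable : LS.-integrable E (EFin \o u).
Proof.
apply/integrableP; split; first by apply/measurable_EFinP; exact: measurable_funTS.
rewrite (_ : (\int[LS]_(t in E) _ = (F (dyadic_rV R c))%:E)%E) ?ltry//.
by rewrite -GF; apply: eq_integral => t _; rewrite /= ger0_norm// expR_ge0.
Qed.

Lemma ray_moment k : moment LS E u k = F (dyadic_rV R (multiple k c)).
Proof. by rewrite /moment /Rintegral ray_integral_expX. Qed.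

(** For [t > 0] one has [u t < 1], so the powers tend to 0 under the integrable bound [u]; the
    exclusion of [t = 0] from the integral is essential. *)
Lemma cvg_ray_moment : F (dyadic_rV R (multiple k c)) @[k --> \oo] --> 0.
Proof.
have -> : (fun k => F (dyadic_rV R (multiple k c))) = moment LS E u.
  by apply/funext => k; rewrite ray_moment.
have e0 : (\int[LS]_(t in E) 0)%R = 0 :> R by rewrite /Rintegral integral0.
suff : moment LS E u k @[k --> \oo] --> (\int[LS]_(t in E) 0)%R by rewrite e0.
apply: (@cvg_Rintegral_dominated R _ (measurableTypeR R) LS E
  (fun k t => u t ^+ k.+1) (fun=> 0) u) => //.
- by move=> k; apply: measurable_funX; exact: measurable_funTS.
- move=> t; rewrite /E/= in_itv/= andbT => t0.
  rewrite (_ : (fun k => u t ^+ k.+1) = (fun k => u t * u t ^+ k)); last first.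
    by apply/funext => k; rewrite exprS.
  rewrite -[X in _ --> X](mulr0 (u t)); apply: cvgM; first exact: cvg_cst.
  apply: cvg_expr; rewrite ger0_norm ?expR_ge0// -[ltRHS]expR0 ltr_expR oppr_lt0 powR_gt0//.
- exact: ray_integrable.
move=> k t Et; have /andP[u0 u1] := ray_u01 Et.
by rewrite ger0_norm ?exprn_ge0// exprS ler_piMr// exprn_ile1.
Qed.

(** Right continuity turns the limit of the derivative in condition 3 into a value, so that [LS]
    gives []0, b]] exactly the mass [G b]. *)
Let G0 : G 0 = 0.
Proof. exact: cumulative_at0 GE (Pi0 (interior_q c)).2. Qed.

Let LS_itv b : 0 < b -> LS `]0, b]%classic = (G b)%:E.
Proof. by move=> b0; rewrite /LS lebesgue_stieltjes_itv ?ltW// G0 subr0. Qed.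

Definition ray_profit (tau : R) : R := (\int[LS]_(t in E) Num.max 0 (tau - t))%R.

Let mgain tau : measurable_fun E (fun t : R => Num.max 0 (tau - t)).
Proof. by apply: measurable_maxr => //; exact: measurable_funB. Qed.

Let ind_le b x : 0 < b -> 0 <= x -> LS.-integrable E (EFin \o (fun t => x * \1_(`]0, b]%classic) t)) /\
  (\int[LS]_(t in E) (x * \1_(`]0, b]%classic) t))%R = x * G b.
Proof.
move=> b0 x0.
have mb : measurable (`]0, b]%classic : set (measurableTypeR R)) by exact: measurable_itv.
have iE : (\int[LS]_(t in E) (\1_(`]0, b]%classic) t)%:E = (G b)%:E)%E.
  rewrite (integral_indic _ mhalf mb).
  rewrite (_ : `]0, b] `&` E = `]0, b]%classic); first exact: LS_itv.
  by apply/setIidPl => t; rewrite /E/= !in_itv/= => /andP[->].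
have i1 : LS.-integrable E (EFin \o (\1_(`]0, b]%classic) : R -> R)).
  apply/integrableP; split.
    by apply/measurable_EFinP; exact: measurable_indic.
  rewrite (_ : (\int[LS]_(t in E) _ = (G b)%:E)%E) ?ltry// -iE.
  by apply: eq_integral => t _; rewrite /= ger0_norm.
split; first by have := integrableZl mhalf x i1; apply: eq_integrable.
transitivity (x * (\int[LS]_(t in E) (\1_(`]0, b]%classic) t))%R).
  exact: (RintegralZl x mhalf i1).
by rewrite /Rintegral iE.
Qed.

Let igain tau : 0 < tau -> LS.-integrable E (EFin \o (fun t => Num.max 0 (tau - t))).
Proof.
move=> tau0; have [i1 _] := ind_le tau0 (ltW tau0).
apply: le_integrable i1 => //; first by apply/measurable_EFinP; exact: mgain.
move=> t; rewrite /E/= in_itv/= andbT => t0; rewrite lee_fin.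
rewrite ger0_norm ?le_max ?lexx// ger0_norm; last by rewrite mulr_ge0// ltW.
rewrite /indic mem_setE in_itv/= t0/=; case: (leP t tau) => h.
  by rewrite mulr1 ge_max ltW//=; lra.
by rewrite mulr0 ge_max lexx/=; lra.
Qed.

(** The increment of the integrand lies between [b - a] times the indicators of []0, a]] and of []0,
    b]]. *)
Lemma ray_profit_slope a b : 0 < a -> a <= b ->
  G a * (b - a) <= ray_profit b - ray_profit a <= G b * (b - a).
Proof.
move=> a0 ab; have b0 : 0 < b by exact: lt_le_trans ab.
have ba : 0 <= b - a by rewrite subr_ge0.
have [ia iaE] := ind_le a0 ba; have [ib ibE] := ind_le b0 ba.
rewrite (mulrC (G a)) (mulrC (G b)) -iaE -ibE.
have -> : ray_profit b - ray_profit a =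
    (\int[LS]_(t in E) (Num.max 0 (b - t) - Num.max 0 (a - t)))%R.
  by rewrite (RintegralB mhalf (igain b0) (igain a0)).
have ig : LS.-integrable E (EFin \o (fun t => Num.max 0 (b - t) - Num.max 0 (a - t))).
  by have := integrableB mhalf (igain b0) (igain a0); apply: eq_integrable.
apply/andP; split.
  apply: (le_Rintegral mhalf ia ig) => t; rewrite /E/= in_itv/= andbT => t0.
  rewrite /indic mem_setE in_itv/= t0/=.
  by case: (leP t a) => h; rewrite ?mulr1 ?mulr0; case: (leP 0 (b - t)); case: (leP 0 (a - t)); lra.
apply: (le_Rintegral mhalf ig ib) => t; rewrite /E/= in_itv/= andbT => t0.
rewrite /indic mem_setE in_itv/= t0/=.
by case: (leP t b) => h; rewrite ?mulr1 ?mulr0; case: (leP 0 (b - t)); case: (leP 0 (a - t)); lra.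
Qed.

Let ray_profit_le tau : 0 < tau -> 0 <= ray_profit tau <= tau * G tau.
Proof.
move=> tau0; have [it itE] := ind_le tau0 (ltW tau0); apply/andP; split.
  by apply: Rintegral_ge0 => // t _; rewrite le_max lexx.
rewrite -itE; apply: (le_Rintegral mhalf (igain tau0) it) => t.
rewrite /E/= in_itv/= andbT => t0; rewrite /indic mem_setE in_itv/= t0/=.
by case: (leP t tau) => h; rewrite ?mulr1 ?mulr0; case: (leP 0 (tau - t)); lra.
Qed.

Let cvg_ray_profit0 : ray_profit t @[t --> 0^'+] --> 0.
Proof.
have cG : t * G t @[t --> 0^'+] --> 0 * G 0.
  apply: cvgM; last exact: cumulative_is_right_continuous.
  by apply: cvg_at_right_filter; exact: cvg_id.
rewrite mul0r in cG.
apply: (squeeze_cvgr _ (cvg_cst 0) cG); near=> t.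
by apply: ray_profit_le; near: t; exact: nbhs_right_gt.
Unshelve. all: by end_near. Qed.

(** The slopes of both functions are squeezed by the same [G], so their increments agree; both tend
    to 0 at 0, which removes the remaining constant. *)
Lemma ray_profitE tau : 0 < tau -> Pi (q c) tau = ray_profit tau.
Proof.
move=> tau0; have Oq := orthant_q c.
have cv := fun x y s => @convexPi (q c) x y s Oq.
have inc : forall a b, 0 < a -> a <= b -> Pi (q c) b - Pi (q c) a = ray_profit b - ray_profit a.
  apply: (@eq_increments_slope R _ _ G) => a b a0 ab; last exact: ray_profit_slope.
  have b0 : 0 < b by exact: lt_le_trans ab.
  by rewrite !GE// (rderive_slope_le cv)//= (slope_le_rderive cv).
have c1 : Pi (q c) t - ray_profit t @[t --> 0^'+] --> 0 - 0.
  by apply: cvgB; [exact: (Pi0 (interior_q c)).1|exact: cvg_ray_profit0].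
suff h : Pi (q c) t - ray_profit t @[t --> 0^'+] --> Pi (q c) tau - ray_profit tau.
  have e : 0 - 0 = Pi (q c) tau - ray_profit tau by exact: (cvg_unique _ c1 h).
  by apply/eqP; rewrite -subr_eq0 -e subr0.
apply: cvg_near_cst; near=> t.
have t0 : 0 < t by near: t; exact: nbhs_right_gt.
have tt : t <= tau by apply: ltW; near: t; exact: nbhs_right_lt.
by have := inc t tau t0 tt; lra.
Unshelve. all: by end_near. Qed.

Lemma ray_profit_ratio tau : 0 < tau ->
  ray_profit tau = (\int[LS]_(t in E) (payoff_ratio alpha tau (u t) * u t))%R.
Proof.
move=> tau0; apply: eq_Rintegral => t /set_mem; rewrite /E/= in_itv/= andbT => t0.
by rewrite payoff_ratioE// ltW.
Qed.

End one_ray.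

Section measure_side.
Variable mu : {measure set (borel_rV R n) -> \bar R}.
Hypothesis mu_fin : (mu setT < +oo)%E.
Hypothesis muF : forall c, (\int[mu]_(x in (orthant n : set (borel_rV R n)))
  (expR (- (\sum_(l < n) dyadic_rV R c ord0 l * (x : 'rV[R]_n) ord0 l `^ alpha)))%:E)%E
  = (F (dyadic_rV R c))%:E.

Let O : set (borel_rV R n) := orthant n.
Let mO : measurable O. Proof. exact: measurable_orthant. Qed.

Let fin_muO : (mu O < +oo)%E.
Proof. by apply: le_lt_trans mu_fin; apply: le_measure; rewrite ?inE. Qed.

Let v c (x : 'rV[R]_n) : R := expR (- (\sum_(l < n) dyadic_rV R c ord0 l * x ord0 l `^ alpha)).

Let mv c : measurable_fun O (v c).
Proof.
apply: measurable_funTS; apply: (measurableT_comp (@measurable_expR R)).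
apply: measurable_funN; apply: measurable_sum => l; apply: measurable_funM => //.
apply: (measurableT_comp (measurable_powR alpha)); exact: measurable_coord.
Qed.

Let v01 c x : O x -> 0 <= v c x <= 1.
Proof.
move=> Ox; rewrite expR_ge0 -[leRHS]expR0 ler_expR oppr_le0 sumr_ge0// => l _.
by rewrite mulr_ge0 ?powR_ge0// ltW.
Qed.

Let iv c : mu.-integrable O (EFin \o v c).
Proof.
apply: (@bounded_integrable _ _ _ mu O (v c) 1) => // x Ox.
by have /andP[v0 v1] := v01 c Ox; rewrite ger0_norm.
Qed.

Let v_odot c x : O x -> v c x = expR (- odot alpha (q c) x `^ alpha).
Proof. by move=> Ox; rewrite odot_powR_rV. Qed.

Let v_momentE c k : moment mu O (v c) k = F (dyadic_rV R (multiple k c)).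
Proof.
rewrite /moment /Rintegral -[RHS]/(fine (F _)%:E) -muF; congr fine.
apply: eq_integral => x _; congr EFin; rewrite /v -expRM_natl dyadic_multiple.
congr expR; rewrite mulrN mulr_sumr; congr (- _); apply: eq_bigr => l _.
by rewrite !mxE mulrA.
Qed.

Lemma representing_measure0 : mu [set (0 : 'rV[R]_n)] = 0%E.
Proof.
(* The point with all coordinates 1; any dyadic point would do. Since [v c] is 1 at the origin,
   every moment bounds the mass of the origin from above. *)
pose c : {ffun 'I_n -> nat} * nat := ([ffun=> 0%N], 0%N).
have [G [GE GF]] := G_ c.
have m0 : measurable ([set 0] : set (borel_rV R n)) by exact: measurable_rV_set1.
have O0 : [set (0 : 'rV[R]_n)] `<=` O by move=> _ -> l; rewrite mxE.
have fin0 : mu [set (0 : 'rV[R]_n)] \is a fin_num.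
  rewrite ge0_fin_numE//; apply: le_lt_trans fin_muO.
  by apply: le_measure => //; rewrite inE.
rewrite -(fineK fin0); congr EFin; apply/le_anti; rewrite fine_ge0// andbT.
have := @cvgr_to_ge nat \oo _ R (fun k => F (dyadic_rV R (multiple k c))) 0
  (fine (mu [set (0 : 'rV[R]_n)])) (cvg_ray_moment GE GF).
apply; apply: nearW => k; rewrite -v_momentE /moment.
have i0 : mu.-integrable O (EFin \o (\1_([set (0 : 'rV[R]_n)]) : borel_rV R n -> R)).
  apply: (@bounded_integrable _ _ _ mu O _ 1) => // x _.
  by rewrite /indic normr_nat lern1 leq_b1.
have -> : fine (mu [set (0 : 'rV[R]_n)]) =
    (\int[mu]_(x in O) (\1_([set (0 : 'rV[R]_n)]) : borel_rV R n -> R) x)%R.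
  rewrite /Rintegral (integral_indic _ mO m0); congr (fine (mu _)).
  exact/esym/setIidPl.
apply: (le_Rintegral mO i0) => [|x Ox].
  apply: (@bounded_integrable _ _ _ mu O _ 1) => // [|x Ox]; first exact: measurable_funX.
  by have /andP[v0 v1] := v01 c Ox; rewrite ger0_norm ?exprn_ge0// exprn_ile1.
rewrite /indic; case: (boolP (x \in _)) => [|_]; last by rewrite exprn_ge0// expR_ge0.
rewrite inE => ->; rewrite /v big1 ?oppr0 ?expR0 ?expr1n// => l _.
by rewrite [X in X `^ _]mxE powR0 ?mulr0// gt_eqF.
Qed.

Let Rprofit_dyadic c tau : 0 < tau -> Pi (q c) tau = Rprofit alpha mu (q c) tau.
Proof.
move=> tau0; have [G [GE GF]] := G_ c.
rewrite (ray_profitE GE)// ray_profit_ratio//.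
have -> : Rprofit alpha mu (q c) tau =
    (\int[mu]_(x in O) (payoff_ratio alpha tau (v c x) * v c x))%R.
  apply: eq_Rintegral => x /set_mem Ox.
  by rewrite v_odot// payoff_ratioE// odot_ge0.
apply: (@eq_integral_moments R _ (measurableTypeR R) (lebesgue_stieltjes_measure G) _ _ _ _ mu _ _
  (payoff_ratio alpha tau) (tau / expR (- tau `^ alpha))) => //.
- exact: measurable_funTS.
- exact: ray_u01.
- exact: ray_integrable GF.
- by move=> x; exact: v01.
- by move=> k; rewrite v_momentE; exact: (ray_moment GE k).
- by move=> t _; exact: payoff_ratio_le.
- by move=> t _; exact: continuous_payoff_ratio.
by apply: continuous_measurable_fun; exact: continuous_payoff_ratio.
Qed.

(** Dyadic points are interior, so prices on the faces are reached only as limits: there the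
    continuity of [Pi] on the price domain decides its values. The approximation is made for the
    power [alpha] of [p], because [q] applies the power [1/alpha]. *)
Lemma profit_representation p (p0 : R) : orthant n p -> 0 < p0 ->
  (Pi p p0)%:E = profit alpha mu p p0.
Proof.
move=> Op t0; rewrite (profitE alpha fin_muO)// ?ltW//; congr EFin.
have Opa : orthant n (powR_rV alpha p) by move=> l; rewrite mxE powR_ge0.
have [c cp] := cvg_dyadic_rV Opa.
have qp : q (c N) @[N --> \oo] --> p.
  apply: cvg_rV => l; under eq_fun do rewrite mxE.
  have -> : p ord0 l = powR_rV alpha p ord0 l `^ alpha^-1.
    by rewrite mxE -powRrM divff ?gt_eqF// powRr1.
  by apply: cvg_powR => //; [rewrite invr_gt0|move=> N; exact/ltW].
have dom N : price_domain n ((q (c N), p0) : 'rV[R]_n * R).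
  by split=> //=; rewrite in_itv/= t0.
have zp : (q (c N), p0) @[N --> \oo] -->
    within (price_domain n) (nbhs ((p, p0) : 'rV[R]_n * R)).
  move=> A /= wA.
  have cz : (q (c N), p0) @[N --> \oo] --> ((p, p0) : 'rV[R]_n * R).
    by apply: (@cvg_pair _ _ _ \oo (nbhs p) (nbhs p0)) => //; exact: cvg_cst.
  have h : \forall N \near \oo, price_domain n ((q (c N), p0) : 'rV[R]_n * R) ->
    A (q (c N), p0) by exact: cz _ wA.
  suff : \forall N \near \oo, A (q (c N), p0) by [].
  by apply: filterS h => N; apply; exact: dom.
have c1 := cvg_comp _ _ zp (cvg_Rprofit alpha_gt0 fin_muO Op t0).
have dp : price_domain n ((p, p0) : 'rV[R]_n * R) by split=> //=; rewrite in_itv/= t0.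
have c2 := cvg_comp _ _ zp ((subspace_continuousP _ _).1 contPi _ dp).
apply: (cvg_unique _ c2 _) => //=.
apply: cvg_trans c1; apply: near_eq_cvg; apply: nearW => N /=.
exact: esym (Rprofit_dyadic (c N) t0).
Qed.

End measure_side.

Lemma exists_representing_measure (bF : [bounded F p | p in orthant n])
  (cmF : completely_monotone F) :
  exists mu : {measure set (borel_rV R n) -> \bar R},
     [/\ supported_in mu (orthant n),
         mu [set (0 : 'rV[R]_n)] = 0%E &
         forall (p : 'rV[R]_n) (p0 : R), orthant n p -> 0 < p0 ->
           (Pi p p0)%:E = profit alpha mu p p0].
Proof.
have [B FB] : exists B, forall p, (orthant n)° p -> F p <= B.
  case: bF => M [_ /(_ (M + 1))]; rewrite ltrDl ltr01 => /(_ isT) bM; exists (M + 1) => p Up.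
  by apply: le_trans (ler_norm _) _; apply: bM; exact: interior_subset.
have [mu [mu_fin supp muF]] := laplace_representation alpha_gt0 cmF FB.
exists mu; split=> //; first exact: representing_measure0 muF.
exact: profit_representation muF.
Qed.

End sufficiency.

Theorem theorem2p4 (R : realType) (n : nat) (alpha : R)
    (Pi : 'rV[R]_n -> R -> R)
    (n_ge1 : (1 <= n)%N) (alpha_gt0 : 0 < alpha) (alpha_le1 : alpha <= 1)
    (Pi_ge0 : forall (p : 'rV[R]_n) (p0 : R),
       orthant n p -> 0 < p0 -> 0 <= Pi p p0) :
  (exists mu : {measure set (borel_rV R n) -> \bar R},
     [/\ supported_in mu (orthant n),
         mu [set (0 : 'rV[R]_n)] = 0%E &
         forall (p : 'rV[R]_n) (p0 : R), orthant n p -> 0 < p0 ->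
           (Pi p p0)%:E = profit alpha mu p p0])
  <->
  [/\ convex_function (price_domain n)
        (fun z : 'rV[R]_n * R^o => Pi z.1 z.2) /\
      {within price_domain n, continuous (fun z : 'rV[R]_n * R => Pi z.1 z.2)},
      forall (p : 'rV[R]_n) (p0 lambda : R),
        orthant n p -> 0 < p0 -> 0 < lambda ->
        Pi (lambda *: p) (lambda * p0) = lambda * Pi p p0,
      forall p : 'rV[R]_n, (orthant n)° p ->
        Pi p p0 @[p0 --> 0^'+] --> 0 /\
        rderive (Pi p) p0 @[p0 --> 0^'+] --> 0 &
      exists F : 'rV[R]_n -> R,
        [/\ forall p : 'rV[R]_n, orthant n p ->
              is_stieltjes_integral (rderive (Pi (powR_rV alpha^-1 p)))
                (fun tau => expR (- tau `^ alpha)) (F p),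
            [bounded F p | p in orthant n] &
            completely_monotone F]].
Proof.
split=> [[mu [supp_mu mu0 PiE]]|[[convPi contPi] homPi Pi0 [F [stF bF cmF]]]].
  split.
  - split; first exact: (representation_convex alpha_gt0 alpha_le1 PiE).
    exact: (representation_continuous alpha_gt0 PiE).
  - by move=> p p0 l; exact: (representation_homogeneous alpha_gt0 PiE).
  - by move=> p; exact: (representation_at0 alpha_gt0 supp_mu mu0 PiE).
  (* The witness [F] is left open and gets fixed by the complete monotonicity goal, which is
     therefore treated first. *)
  eexists; split=> [p Op||]; last 1 first.
  - exact: (completely_monotone_stieltjes_integral alpha_gt0 supp_mu mu0 PiE).
  - apply: (stieltjes_integral_representation alpha_gt0 supp_mu PiE).
    by move=> i; rewrite mxE powR_ge0.
  - exact: (bounded_stieltjes_integral alpha_gt0 supp_mu PiE).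
exact: (exists_representing_measure alpha_gt0 convPi contPi homPi Pi0 stF bF cmF).
Qed.
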